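(* Let $A=kQ/I$ be a gentle algebra with fringed algebra $\hat A=k\hat Q/\hat I$, and let $X$ and $Y$ be strings in $Q$. (1) The elements of $\operatorname{Hom}_{\hat A}(X,\tau_{\hat A}Y)$ corresponding to kisses from $\operatorname{cohook}(X)$ to $\operatorname{cohook}(Y)$ form a basis of $\operatorname{Hom}_{\hat A}(X,\tau_{\hat A}Y)$. (2) The elements of $\operatorname{Hom}_A(X,\tau_AY)$ corresponding to kisses from $\operatorname{cohook}(X)$ to $\operatorname{cohook}(Y)$ form a basis of $\operatorname{Hom}_A(X,\tau_AY)$.
   Context: **Gentle algebras.** $k$ is a field. Quivers $Q=(Q_0,Q_1,s,e)$ are finite and connected; $s(\gamma),e(\gamma)$ are the source and target of an arrow $\gamma$. Paths are written right to left: $\gamma_m\cdots\gamma_1$ is a path if $s(\gamma_{j+1})=e(\gamma_j)$. $A=kQ/I$ is gentle if $I$ is an admissible ideal generated by paths of length two, every vertex has at most two incoming and two outgoing arrows, and for every arrow $\alpha$ there is at most one arrow $\beta$ with $\alpha\beta$ a path not in $I$, at most one $\gamma$ with $\gamma\alpha$ a path not in $I$, at most one $\beta$ with $\alpha\beta$ a path in $I$, and at most one $\gamma$ with $\gamma\alpha$ a path in $I$. **Strings.** To each arrow $\delta$ associate a formal inverse $\delta^{-1}$ with $s(\delta^{-1})=e(\delta)$, $e(\delta^{-1})=s(\delta)$. A string in $Q$ is either a lazy path $e_x$ at a vertex $x$ (length zero, its own inverse) or a path $C=\gamma_n\cdots\gamma_1$ whose letters are arrows (''direct'') or formal inverses (''inverse''),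 such that no letter is followed by its inverse and neither $C$ nor $C^{-1}$ contains a subpath in $I$; $s(C)=s(\gamma_1)$, $e(C)=e(\gamma_n)$. A string is direct (inverse) if all its letters are. The string module $M(C)$ has basis $z_0,\dots,z_n$ placed at the successive vertices of $C$; a direct $\gamma_i$ sends $z_{i-1}$ to $z_i$, and if $\gamma_i=\delta^{-1}$ then $\delta$ sends $z_i$ to $z_{i-1}$; all other actions of arrows are zero. $M(C)\cong M(C^{-1})$; strings $C$ and $C^{-1}$ are identified, and $C$ also denotes $M(C)$. $\tau_A$ is the Auslander–Reiten translation. **Fringed algebra.** A vertex is defective if it does not have exactly two incoming and two outgoing arrows. $\hat Q$ is obtained from $Q$ by adding, for each defective vertex $v$ of $Q$, new vertices (fringe vertices), each joined to $v$ by one new arrow into or out of $v$, so that every vertex of $Q_0$ has exactly two incoming and two outgoing arrows in $\hat Q$. $\hat I\supseteq I$ is the ideal of $k\hat Q$ (well defined up to relabelling fringe vertices) obtained by adding to $I$ length-two paths involving new arrows, passing through vertices of $Q_0$, so that $\hat A=k\hat Q/\hat I$ is gentle. $A$ is the quotient of $\hat A$ by the ideal generated by the idempotents of the fringe vertices, so $A$-modules are $\hat A$-modules and strings in $Q$ are strings in $\hat Q$. **Cohook completion.** For a string $X$ in $Q$, $\operatorname{cohook}(X)=\mathcal I\,\beta\,X\,\alpha^{-1}\,\mathcal D$, a string in $\hat Q$, where $\alpha,\beta$ are the arrows of $\hat Q$ such that $\beta X\alpha^{-1}$ is a string in $\hat Q$ (for $X=e_x$ they are the two distinct arrows of $\hat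 Q$ starting at $x$), $\mathcal D$ is the longest direct string with $\alpha^{-1}\mathcal D$ a string in $\hat Q$, and $\mathcal I$ is the longest inverse string with $\mathcal I\beta$ a string in $\hat Q$. One has $\tau_{\hat A}Y=\operatorname{cohook}(Y)$ for $Y$ a string in $Q$. **Factorizations, graph maps.** A factorization $C=FED$ of a string, written $(F,E,D)$, is a quotient factorization if $D$ is lazy or its last (leftmost) letter is inverse, and $F$ is lazy or its first (rightmost) letter is direct; then $M(C)\to M(E)$ is a quotient map. It is a submodule factorization if $D$ is lazy or its last letter is direct, and $F$ is lazy or its first letter is inverse; then $M(E)\subseteq M(C)$ is a submodule. **Kisses.** A kiss from a string $C$ to a string $C'$ along $Z$ is a pair consisting of a quotient factorization $(C_2,Z,C_1)$ of $C$ and a submodule factorization $(C_2',Z,C_1')$ of $C'$ (the middle terms being required to agree up to inversion), such that $C_1,C_2,C_1',C_2'$ all have strictly positive length. **The map of a kiss.** If there is a kiss from $\operatorname{cohook}(X)$ to $\operatorname{cohook}(Y)$ along $Z$, then the given occurrence of $Z$ in $\operatorname{cohook}(X)$ lies inside $X$ and gives a quotient factorization of $X$, and the given occurrence of $Z$ in $\operatorname{cohook}(Y)=\tau_{\hat A}Y$ lies inside the substring $\tau_AY$ and gives a submodule factorization of it. The element corresponding to the kiss is the composite $X\to Z\to\tau_{\hat A}Y$ (respectively $X\to Z\to\tau_AY$) of the quotient map and the inclusion. Here $\tau_AY$ is viewed as a substring of $\operatorname{cohook}(Y)=\mathcal I\beta Y\alpha^{-1}\mathcal D$ as follows: at the start,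 if $\alpha\in Q_1$ keep $\alpha^{-1}\mathcal D$ except for the arrow incident with the fringe vertex; otherwise delete $\alpha^{-1}\mathcal D$ and further delete everything up to and including the first direct arrow that remains; symmetrically at the end, if $\beta\in Q_1$ keep $\mathcal I\beta$ except for the letter incident with the fringe vertex, and otherwise delete $\mathcal I\beta$ and further delete the last remaining inverse letter together with everything after it (cohooks in $Q$ are added before deletions are made; if the deletions are impossible, $Y$ is projective and $\tau_AY=0$). *)

(* Defs.v *)
From HB Require Import structures.
From mathcomp Require Import all_boot all_order all_algebra.

Set Implicit Arguments.
Unset Strict Implicit.
Unset Printing Implicit Defensive.

Import GRing.Theory.
Local Open Scope ring_scope.

(* A finite quiver with a set of paths of length two generating an ideal I:    *)
(* [rel2 b a] says that the path b a (first a, then b) is one of the           *)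
(* generators.  A path of length two lies in I iff it is a generator, and a    *)
(* path lies in I iff it contains a generator.                                 *)
Record bquiver := BQuiver {
  Q0 : finType;
  Q1 : finType;
  src : Q1 -> Q0;
  tgt : Q1 -> Q0;
  rel2 : rel Q1 }.

(* The opposite bound quiver: its representations are the right modules.       *)
Definition bop (B : bquiver) : bquiver :=
  @BQuiver (Q0 B) (Q1 B) (@tgt B) (@src B) (fun b a => rel2 a b).

(* Paths and strings are written right to left in the literature; here they    *)
(* are lists in order of traversal, so gamma_n ... gamma_1 is                  *)
(* [:: gamma_1; ...; gamma_n].                                                 *)
Definition composable (B : bquiver) (a b : Q1 B) : bool := src b == tgt a.

Definition in_ideal (B : bquiver) (w : seq (Q1 B)) : bool :=
  ~~ sorted (fun a b => ~~ rel2 b a) w.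

Definition adjacent (B : bquiver) (x y : Q0 B) : bool :=
  [exists a : Q1 B, ((src a == x) && (tgt a == y)) || ((src a == y) && (tgt a == x))].

Definition connected (B : bquiver) : Prop :=
  (0 < #|Q0 B|)%N /\ forall x y : Q0 B, connect (@adjacent B) x y.

(* The generators have length two, so admissibility only requires I to         *)
(* contain all sufficiently long paths.                                        *)
Definition admissible (B : bquiver) : Prop :=
  (forall b a : Q1 B, rel2 b a -> composable a b) /\
  exists N : nat, forall w : seq (Q1 B),
    sorted (@composable B) w -> (N <= size w)%N -> in_ideal w.

Definition gentle (B : bquiver) : Prop :=
  [/\ connected B,
      admissible B,
      forall x : Q0 B, (#|[set a : Q1 B | tgt a == x]| <= 2)%N
                    /\ (#|[set a : Q1 B | src a == x]| <= 2)%N,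
      forall a : Q1 B,
           (#|[set b : Q1 B | composable b a & ~~ rel2 a b]| <= 1)%N
        /\ (#|[set c : Q1 B | composable a c & ~~ rel2 c a]| <= 1)%N
    & forall a : Q1 B,
           (#|[set b : Q1 B | composable b a & rel2 a b]| <= 1)%N
        /\ (#|[set c : Q1 B | composable a c & rel2 c a]| <= 1)%N].

(* Data for a fringed quiver.  The finType [fr] indexes both the fringe        *)
(* vertices and the new arrows, since each fringe vertex comes with exactly    *)
(* one new arrow, joining it to [att f].                                       *)
Record fringe (B : bquiver) := Fringe {
  fr : finType;
  att : fr -> Q0 B;
  inward : pred fr;
  fr_rel2 : rel (Q1 B + fr)%type }.

Definition fringed (B : bquiver) (F : fringe B) : bquiver :=
  @BQuiver (Q0 B + fr F)%type (Q1 B + fr F)%type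
    (fun a => match a with
              | inl a => inl (src a)
              | inr f => if inward f then inr f else inl (att f)
              end)
    (fun a => match a with
              | inl a => inl (tgt a)
              | inr f => if inward f then inl (att f) else inr f
              end)
    (@fr_rel2 B F).

(* The degree condition forces new arrows to be attached to defective vertices *)
(* only; generators that are not paths of B run through vertices of B because  *)
(* a fringe vertex lies on a single arrow.                                     *)
Definition is_fringing (B : bquiver) (F : fringe B) : Prop :=
  [/\ forall b a : Q1 B, fr_rel2 (inl b : Q1 B + fr F) (inl a) = rel2 b a,
      forall x : Q0 B, #|[set a : Q1 (fringed F) | tgt a == inl x]| = 2
                    /\ #|[set a : Q1 (fringed F) | src a == inl x]| = 2
    & gentle (fringed F)].

(* Letters: (a, true) is the arrow a, (a, false) its formal inverse.           *)
Definition letter (B : bquiver) : finType := (Q1 B * bool)%type.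

Definition direct (B : bquiver) (l : letter B) : bool := l.2.
Definition linv (B : bquiver) (l : letter B) : letter B := (l.1, ~~ l.2).
Definition lsrc (B : bquiver) (l : letter B) : Q0 B :=
  if l.2 then src l.1 else tgt l.1.
Definition ltgt (B : bquiver) (l : letter B) : Q0 B :=
  if l.2 then tgt l.1 else src l.1.

(* [follows l m]: the letter m may come immediately after l in a string.       *)
Definition follows (B : bquiver) (l m : letter B) : bool :=
  [&& lsrc m == ltgt l,
      m != linv l,
      ~~ [&& direct l, direct m & rel2 m.1 l.1]
    & ~~ [&& ~~ direct l, ~~ direct m & rel2 l.1 m.1]].

(* A word together with its starting vertex, so that lazy paths are            *)
(* (x, [::]).                                                                  *)
Definition word (B : bquiver) : eqType := (Q0 B * seq (letter B))%type.

Definition is_string (B : bquiver) (C : word B) : bool :=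
  (if C.2 is l :: _ then lsrc l == C.1 else true) && sorted (@follows B) C.2.

(* The word starting at x or, if w is not empty, at the source of its first    *)
(* letter.                                                                     *)
Definition mkword (B : bquiver) (x : Q0 B) (w : seq (letter B)) : word B :=
  (if w is l :: _ then lsrc l else x, w).

Definition wlen (B : bquiver) (C : word B) : nat := size C.2.

(* The vertex under z_i.                                                       *)
Definition vertex_at (B : bquiver) (C : word B) (i : nat) : Q0 B :=
  last C.1 (map (@ltgt B) (take i C.2)).

Definition winv (B : bquiver) (C : word B) : word B :=
  (vertex_at C (wlen C), rev (map (@linv B) C.2)).

(* The factor gamma_j ... gamma_(i+1) of gamma_n ... gamma_1.                  *)
Definition factor (B : bquiver) (C : word B) (i j : nat) : word B :=
  (vertex_at C i, take (j - i) (drop i C.2)).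

Definition embed (B : bquiver) (F : fringe B) (C : word B) : word (fringed F) :=
  (inl C.1, [seq ((inl l.1, l.2) : letter (fringed F)) | l <- C.2]).

(* A finite-dimensional module, given by the action of the vertex idempotents  *)
(* and of the arrows on row vectors: u is sent to u *m arr a.  Homomorphisms   *)
(* M -> N are matrices f acting as u |-> u *m f, so the composite "f, then g"  *)
(* is f *m g.                                                                  *)
Record rep (k : fieldType) (B : bquiver) := Rep {
  rdim : nat;
  vtx : Q0 B -> 'M[k]_rdim;
  arr : Q1 B -> 'M[k]_rdim }.

Definition is_hom (k : fieldType) (B : bquiver) (M N : rep k B)
    (f : 'M[k]_(rdim M, rdim N)) : Prop :=
  (forall x : Q0 B, vtx M x *m f = f *m vtx N x) /\
  (forall a : Q1 B, arr M a *m f = f *m arr N a).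

Definition hom_basis (k : fieldType) (B : bquiver) (M N : rep k B)
    (fs : seq 'M[k]_(rdim M, rdim N)) : Prop :=
  free fs /\ forall f, f \in <<fs>>%VS <-> is_hom f.

Definition zero_rep (k : fieldType) (B : bquiver) : rep k B :=
  @Rep k B 0 (fun=> 0) (fun=> 0).

Definition string_rep (k : fieldType) (B : bquiver) (C : word B) : rep k B :=
  @Rep k B (wlen C).+1
    (fun x => \matrix_(p, q) ((p == q) && (vertex_at C p == x))%:R)
    (fun a => \matrix_(p, q)
       (((q == p.+1 :> nat) && (onth C.2 p == Some (a, true)))
        || ((p == q.+1 :> nat) && (onth C.2 q == Some (a, false))))%:R).

(* [nzpath x w]: w is a path starting at x which is nonzero in kQ/I.           *)
Definition nzpath (B : bquiver) (x : Q0 B) (w : seq (Q1 B)) : bool :=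
  [&& if w is a :: _ then src a == x else true,
      sorted (@composable B) w & ~~ in_ideal w].

Definition path_end (B : bquiver) (x : Q0 B) (w : seq (Q1 B)) : Q0 B :=
  last x (map (@tgt B) w).

(* Basis of the sum of the projectives A e_(xs i).  The length bound loses     *)
(* nothing: as I is admissible and generated in length two, a nonzero path     *)
(* does not repeat an arrow.                                                   *)
Definition proj_basis (B : bquiver) (n : nat) (xs : 'I_n -> Q0 B) : finType :=
  {s : ('I_n * #|Q1 B|.-bseq (Q1 B))%type | nzpath (xs s.1) s.2}.

Definition basis_elt (B : bquiver) (n : nat) (xs : 'I_n -> Q0 B)
    (s : 'I_#|{: proj_basis xs}|) : 'I_n * #|Q1 B|.-bseq (Q1 B) :=
  val (enum_val s).

Definition proj_rep (k : fieldType) (B : bquiver) (n : nat) (xs : 'I_n -> Q0 B) :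
    rep k B :=
  @Rep k B #|{: proj_basis xs}|
    (fun x => \matrix_(s, t)
       let: (i, v) := basis_elt s in
       ((s == t) && (path_end (xs i) v == x))%:R)
    (fun a => \matrix_(s, t)
       let: (i, v) := basis_elt s in
       let: (j, w) := basis_elt t in
       ((i == j) && (w == rcons v a :> seq (Q1 B)))%:R).

(* The homomorphism from the sum of the A e_(xs j) to the sum of the           *)
(* A e_(ys i) sending e_(xs j) to the sum over i of the elements               *)
(* sum_u c j i u * u of e_(xs j) A e_(ys i).                                   *)
Definition proj_map (k : fieldType) (B : bquiver) (m n : nat)
    (xs : 'I_m -> Q0 B) (ys : 'I_n -> Q0 B) (c : 'I_m -> 'I_n -> seq (Q1 B) -> k) :
    'M[k]_(rdim (proj_rep k xs), rdim (proj_rep k ys)) :=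
  \matrix_(s, t)
    let: (j, w) := basis_elt s in
    let: (i, v) := basis_elt t in
    let u := take (size v - size w) v in
    if suffix w v && (path_end (ys i) u == xs j) then c j i u else 0.

(* Applying Hom_A(-, A) to [proj_map xs ys c] gives                            *)
(* [@proj_map k (bop B) n m ys xs (transp c)].                                 *)
Definition transp (k : fieldType) (T : Type) (m n : nat)
    (c : 'I_m -> 'I_n -> seq T -> k) (i : 'I_n) (j : 'I_m) (w : seq T) : k :=
  c j i (rev w).

Definition is_cokernel (k : fieldType) (B : bquiver) (P1 P0 M : rep k B)
    (f : 'M[k]_(rdim P1, rdim P0)) (g : 'M[k]_(rdim P0, rdim M)) : Prop :=
  [/\ is_hom g, row_full g & (f == kermx g)%MS].

Definition radical (k : fieldType) (B : bquiver) (M : rep k B) : 'M[k]_(rdim M) :=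
  (\sum_(a : Q1 B) <<arr M a>>)%MS.

Definition dual_rep (k : fieldType) (B : bquiver) (M : rep k B) : rep k (bop B) :=
  @Rep k (bop B) (rdim M) (fun x => (vtx M x)^T) (fun a => (arr M a)^T).

(* T is isomorphic to tau M = D Tr M: there are a minimal projective            *)
(* presentation P1 -f-> P0 -g-> M -> 0 and an exact sequence of right modules  *)
(* Hom_A(P0, A) -> Hom_A(P1, A) -h-> D T -> 0, i.e. D T is isomorphic to Tr M. *)
Definition is_tau (k : fieldType) (B : bquiver) (M T : rep k B) : Prop :=
  exists (m n : nat) (xs : 'I_m -> Q0 B) (ys : 'I_n -> Q0 B)
         (c : 'I_m -> 'I_n -> seq (Q1 B) -> k)
         (g : 'M[k]_(rdim (proj_rep k ys), rdim M))
         (h : 'M[k]_(rdim (@proj_rep k (bop B) m xs), rdim (dual_rep T))),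
  let f := proj_map xs ys c in
  [/\ is_cokernel f g,
      (kermx g <= radical (proj_rep k ys))%MS,
      (kermx f <= radical (proj_rep k xs))%MS
    & is_cokernel (@proj_map k (bop B) n m ys xs (transp c)) h].

(* The pieces of cohook(X) = I beta X alpha^-1 D.                              *)
Record cohook_data (B : bquiver) := CohookData {
  ch_D : seq (letter B);
  ch_alpha : Q1 B;
  ch_beta : Q1 B;
  ch_I : seq (letter B) }.

(* For X = (x, [::]) the first and last conditions say that alpha and beta are *)
(* two distinct arrows starting at x.                                          *)
Definition is_cohook_data (B : bquiver) (X : word B) (H : cohook_data B) : Prop :=
  let a : letter B := (ch_alpha H, false) in
  let b : letter B := (ch_beta H, true) in
  let is_D D := all (@direct B) D && is_string (mkword (lsrc a) (rcons D a)) in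
  let is_I I := all (fun l => ~~ direct l) I && is_string (mkword (lsrc b) (b :: I)) in
  [/\ src (ch_alpha H) = X.1,
      is_D (ch_D H) /\ (forall D, is_D D -> (size D <= size (ch_D H))%N),
      is_I (ch_I H) /\ (forall I, is_I I -> (size I <= size (ch_I H))%N)
    & is_string (mkword (lsrc a) (a :: X.2 ++ [:: b]))].

Definition cohook (B : bquiver) (X : word B) (H : cohook_data B) : word B :=
  let a : letter B := (ch_alpha H, false) in
  let b : letter B := (ch_beta H, true) in
  mkword (lsrc a) (ch_D H ++ a :: X.2 ++ b :: ch_I H).

(* The position in cohook(X) at which X begins.                                *)
Definition ch_off (B : bquiver) (H : cohook_data B) : nat := (size (ch_D H)).+1.

(* The positions (a, b) at which the substring tau_A Y of cohook(Y) begins and *)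
(* ends, or None if the deletions are impossible.  If alpha is an arrow of Q,  *)
(* then the first letter of D is the one incident with a fringe vertex;        *)
(* likewise for beta and the last letter of I.  The interval (a0, b0) is what  *)
(* remains before the further deletions.                                       *)
Definition tau_interval (B : bquiver) (F : fringe B) (Y : word (fringed F))
    (H : cohook_data (fringed F)) : option (nat * nat) :=
  let C := cohook Y H in
  let old (a : Q1 (fringed F)) := if a is inl _ then true else false in
  let a0 := if old (ch_alpha H) then 1%N else ch_off H in
  let b0 := if old (ch_beta H) then (wlen C).-1 else (ch_off H + wlen Y)%N in
  let r := (factor C a0 b0).2 in
  if ~~ old (ch_alpha H) && ~~ has (@direct _) r then None else
  let a := if old (ch_alpha H) then a0 else (a0 + (find (@direct _) r).+1)%N in
  let inverse (l : letter (fringed F)) := ~~ direct l in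
  let r' := (factor C a b0).2 in
  if ~~ old (ch_beta H) && ~~ has inverse r' then None else
  let b := if old (ch_beta H) then b0 else (b0 - (find inverse (rev r')).+1)%N in
  Some (a, b).

(* A factorization (F, E, D) of C is given by the positions i <= j at which E  *)
(* begins and ends.                                                            *)
Definition is_factorization (B : bquiver) (C : word B) (i j : nat) : bool :=
  (i <= j <= wlen C)%N.

Definition quotient_fact (B : bquiver) (C : word B) (i j : nat) : bool :=
  let D := (factor C 0 i).2 in
  let F := (factor C j (wlen C)).2 in
  [&& is_factorization C i j,
      if D is l :: D' then ~~ direct (last l D') else true
    & if F is l :: _ then direct l else true].

Definition submodule_fact (B : bquiver) (C : word B) (i j : nat) : bool :=
  let D := (factor C 0 i).2 in
  let F := (factor C j (wlen C)).2 in
  [&& is_factorization C i j,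
      if D is l :: D' then direct (last l D') else true
    & if F is l :: _ then ~~ direct l else true].

(* A kiss ((i, j), (i', j')) from C to C': the positions of the middle terms.  *)
Definition kiss_pos (B : bquiver) (C C' : word B) : finType :=
  (('I_(wlen C).+1 * 'I_(wlen C).+1) * ('I_(wlen C').+1 * 'I_(wlen C').+1))%type.

Definition is_kiss (B : bquiver) (C C' : word B) (z : kiss_pos C C') : bool :=
  let: ((i, j), (i', j')) := z in
  let Z := factor C i j in
  let Z' := factor C' i' j' in
  [&& quotient_fact C i j,
      submodule_fact C' i' j',
      (Z == Z') || (Z == winv Z'),
      (0 < i)%N, (j < wlen C)%N, (0 < i')%N & (j' < wlen C')%N].

Definition kisses (B : bquiver) (C C' : word B) : seq (kiss_pos C C') :=
  enum (@is_kiss B C C').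

(* Quotient map from the string module of a substring of C to that of another  *)
(* one: o and i are the positions in C at which the two substrings begin, m    *)
(* and l the dimensions of the modules.  Basis vectors are matched by their    *)
(* position in C.                                                              *)
Definition proj_mx (k : fieldType) (o m i l : nat) : 'M[k]_(m, l) :=
  \matrix_(p, t) (o + p == i + t)%N%:R.

(* The isomorphism M(Z) -> M(Z').                                              *)
Definition ident_mx (k : fieldType) (B : bquiver) (Z Z' : word B) :
    'M[k]_((wlen Z).+1, (wlen Z').+1) :=
  \matrix_(p, q) (if Z == Z' then p == q :> nat else p + q == wlen Z)%N%:R.

(* The composite U -> Z -> T attached to the kiss z, where U begins at         *)
(* position o of C, T begins at position o' of C', and their modules have      *)
(* dimensions m and m'.                                                        *)
Definition kiss_mx (k : fieldType) (B : bquiver) (C C' : word B)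
    (o m o' m' : nat) (z : kiss_pos C C') : 'M[k]_(m, m') :=
  let: ((i, j), (i', j')) := z in
  let Z := factor C i j in
  let Z' := factor C' i' j' in
  proj_mx k o m i (wlen Z).+1 *m ident_mx k Z Z' *m (proj_mx k o' m' i' (wlen Z').+1)^T.

(* Main.v *)
Require Import Defs.
From mathcomp Require Import all_boot all_order all_algebra.
From mathcomp Require Import zify.

Set Implicit Arguments.
Unset Strict Implicit.
Unset Printing Implicit Defensive.

Import GRing.Theory.

(** The proof rests on two facts about string modules and one about cohooks.

    The translate.  Let S be a string and [w0, w1] an interval of it that changes
    direction at certain positions: its peaks, where both letters lead away, and
    its valleys, where both lead in.  Sending the generator of the projective at a
    valley to the difference of the two paths that reach it from the neighbouring
    peaks defines a map f from the sum of the projectives at the valleys to that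
    over the peaks.  Its cokernel is again a string module: at an end of the
    interval that is a peak the projective there contributes a full extra leg,
    and at an end that is a valley the last letter is cut off ([zz_cokernel]).
    Both kernels lie in radicals ([zz_min0], [zz_min1]), so f is a minimal
    projective presentation.  Now pass to the opposite algebra: every letter
    changes its sign, peaks and valleys are exchanged, and the transpose of f is,
    up to a sign, the map attached to the same interval.  Hence its cokernel is
    computed by the same lemma, with cutting and lengthening exchanged at either
    end, and this is the dual of the translate ([tau_zigzag]).  If the interval is
    a single peak, the module is projective and the translate vanishes
    ([tau_zero]).  Over the fringed algebra S is cohook(Y) and the interval is the
    string from the start of alpha^-1 to the end of beta ([ch_zigzag]).  Over the
    original algebra S is the core of cohook(Y), that is cohook(Y) without its
    two extreme letters, which are exactly those incident with fringe vertices;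
    at a side where alpha (or beta) belongs to the quiver the interval ends in a
    valley as before, and at the other sides it ends in the outermost
    peak ([core_zigzag]).  The resulting rule is the one that defines the interval of
    tau_A Y in cohook(Y) ([core_tau_interval]).

    Homomorphisms.  In matrix form a homomorphism from M(C) to M(C') is a function
    on pairs of positions over the same vertex.  Compatibility with the arrows
    says that its values at two pairs agree if the pairs are joined by a common
    letter, and that the value is zero next to certain disagreements.  At each
    vertex of a gentle quiver the half-edges fall into two classes, and every
    string passes from one class to the other ([follows_dichotomy]); so two strings
    through a vertex can be oriented alike in exactly one way.  Starting from a
    pair with a nonzero value and walking in either direction as long as the two
    strings agree, one stops where the first string goes on by a direct letter and
    the second by an inverse one ([extend]).  This is a kiss, and the function
    is constant on its support ([hom_kiss]).  Conversely the matrix of a kiss is a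
    homomorphism ([kiss_hom]), and distinct kisses have disjoint supports
    ([kiss_unique]), whence the basis ([kiss_basis]).

    Cohooks.  Walking in the completed strings cohook(X) and cohook(Y) instead of
    X and tau Y, one never has to treat the ends of a string separately: a position
    of X lies in the interior of cohook(X), and a position of cohook(Y) over a
    vertex of Q is interior because both ends of cohook(Y) are fringe vertices
    ([ch_start], [ch_end]).  The signs of the letters of a cohook outside X,
    respectively outside tau Y, confine all kisses to these substrings
    ([kiss_in]).  So one basis theorem serves both algebras, modules over the
    original algebra being inflated to the fringed one. *)

(** * Letters, positions and directions *)

(** The letter by which the string is left at position p in direction d, where
    true is the direction of traversal.  Treating the direction as a parameter,
    an argument at one end of a string covers its mirror image at the other. *)
Definition out (B : bquiver) (s : seq (letter B)) (d : bool) (p : nat) :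
    option (letter B) :=
  if d then onth s p else if p is p'.+1 then omap (@linv B) (onth s p') else None.

Definition mv (d : bool) (p : nat) : nat := if d then p.+1 else p.-1.

(** The conditions of gentleness that concern single arrows and vertices,
    together with admissibility: the part on which the theory of strings rests,
    visibly symmetric under passage to the opposite quiver. *)
Definition locally_gentle (B : bquiver) : Prop :=
  [/\ admissible B,
      forall x : Q0 B, (#|[set a : Q1 B | tgt a == x]| <= 2)%N
                    /\ (#|[set a : Q1 B | src a == x]| <= 2)%N,
      forall a : Q1 B,
           (#|[set b : Q1 B | composable b a & ~~ rel2 a b]| <= 1)%N
        /\ (#|[set c : Q1 B | composable a c & ~~ rel2 c a]| <= 1)%N
    & forall a : Q1 B,
           (#|[set b : Q1 B | composable b a & rel2 a b]| <= 1)%N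
        /\ (#|[set c : Q1 B | composable a c & rel2 c a]| <= 1)%N].

Lemma gentle_local (B : bquiver) : gentle B -> locally_gentle B.
Proof. by case. Qed.

Lemma card_le1 (T : finType) (P : pred T) (x y : T) :
  #|[set z | P z]| <= 1 -> P x -> P y -> x = y.
Proof.
by move=> /card_le1_eqP h px py; apply: h; rewrite inE.
Qed.

Lemma card_le2 (T : finType) (P : pred T) (x y z : T) :
  #|[set z | P z]| <= 2 -> P x -> P y -> P z -> [|| x == y, y == z | x == z].
Proof.
move=> h px py pz; apply/negP => /negP; rewrite !negb_or => /and3P[xy yz xz].
have : #|[set x; y; z]| <= #|[set z | P z]|.
  apply/subset_leq_card/subsetP => t; rewrite !inE => /orP[/orP[]|] /eqP-> //.
rewrite setUC cardsU1 !inE negb_or (eq_sym z x) xz (eq_sym z y) yz cards2 xy /=.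
lia.
Qed.

Section Letters.
Variable B : bquiver.
Implicit Types (l m : letter B) (s : seq (letter B)) (a b c : Q1 B).

Lemma linvK : involutive (@linv B).
Proof. by case=> a [] . Qed.

Lemma lsrc_linv l : lsrc (linv l) = ltgt l.
Proof. by case: l => a []. Qed.

Lemma ltgt_linv l : ltgt (linv l) = lsrc l.
Proof. by case: l => a []. Qed.

Lemma follows_linv l m : follows (linv m) (linv l) = follows l m.
Proof.
rewrite /follows lsrc_linv ltgt_linv linvK eq_sym; congr (_ && _).
case: l m => a [] [b []]; rewrite /linv /direct /= ?andbT ?andbF //=;
by rewrite !xpair_eqE ?andbF ?andbT // eq_sym.
Qed.

Lemma follows_src l m : follows l m -> lsrc m = ltgt l.
Proof. by case/and4P => /eqP. Qed.

Lemma follows_neq l m : follows l m -> m != linv l.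
Proof. by case/and4P. Qed.

Lemma followsDD a b : follows (a, true) (b, true) = (src b == tgt a) && ~~ rel2 b a.
Proof.
rewrite /follows /linv /lsrc /ltgt /direct /=; case: eqP => //= _.
by rewrite andbT xpair_eqE andbF.
Qed.

Lemma followsII a b : follows (a, false) (b, false) = (tgt b == src a) && ~~ rel2 a b.
Proof.
rewrite /follows /linv /lsrc /ltgt /direct /=; case: eqP => //= _.
by rewrite xpair_eqE andbF.
Qed.

Lemma followsDI a b : follows (a, true) (b, false) = (tgt b == tgt a) && (b != a).
Proof.
by rewrite /follows /linv /lsrc /ltgt /direct /= !andbT xpair_eqE andbT.
Qed.

Lemma followsID a b : follows (a, false) (b, true) = (src b == src a) && (b != a).
Proof.
by rewrite /follows /linv /lsrc /ltgt /direct /= !andbT xpair_eqE andbT.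
Qed.

Hypothesis gB : locally_gentle B.

(** A string is continued by at most one letter of each sign. *)
Lemma follows_inj l m m' : follows l m -> follows l m' -> m.2 = m'.2 -> m = m'.
Proof.
case: gB => _ deg cont _.
case: l m m' => [a []] [b []] [c []] //= + + _;
  rewrite ?followsDD ?followsDI ?followsID ?followsII => /andP[/eqP h1 h2] /andP[/eqP h3 h4].
- have [_ h] := cont a; congr pair; apply: (card_le1 h);
  by rewrite /composable ?h1 ?h3 eqxx.
- have [h _] := deg (tgt a); move: (@card_le2 _ _ a b c h).
  rewrite h1 h3 eqxx => /(_ isT isT isT).
  by rewrite (eq_sym a) (negPf h2) (eq_sym a) (negPf h4) /= orbF => /eqP->.
- have [_ h] := deg (src a); move: (@card_le2 _ _ a b c h).
  rewrite h1 h3 eqxx => /(_ isT isT isT).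
  by rewrite (eq_sym a) (negPf h2) (eq_sym a) (negPf h4) /= orbF => /eqP->.
- have [h _] := cont a; congr pair; apply: (card_le1 h);
  by rewrite /composable ?h1 ?h3 eqxx.
Qed.

Lemma follows_injl l l' m : follows l m -> follows l' m -> l.2 = l'.2 -> l = l'.
Proof.
rewrite -(follows_linv l) -(follows_linv l') => h h' e.
by apply: (can_inj linvK); apply: follows_inj h h' _; rewrite /= e.
Qed.

(** At a vertex the half-edges fall into two classes, each consisting of an
    incoming and an outgoing arrow whose composite is a relation.  A string that
    enters through one class leaves through the other; y and m belong to
    different classes, so exactly one of them can follow l. *)
Lemma follows_dichotomy l y m : follows y m -> ltgt l = ltgt y ->
  follows l m (+) follows l (linv y).
Proof.
move=> ym ly; apply/addbP.
have not_both : ~~ (follows l m && follows l (linv y)).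
  apply/negP => /andP[lm ly'].
  have [e|e] := eqVneq m.2 (~~ y.2).
    by move: (follows_neq ym); rewrite (follows_inj lm ly' e) eqxx.
  have [e'|e'] := eqVneq l.2 y.2.
    move: (follows_neq ly'); rewrite (follows_injl lm ym e').
    by rewrite eqxx.
  have := ym; rewrite -follows_linv => my.
  have h : l = linv m.
    apply: follows_injl ly' my _; move: e e' => /=.
    by case: l.2; case: m.2; case: y.2.
  by move: (follows_neq lm); rewrite h linvK eqxx.
have one : follows l m || follows l (linv y).
  case: gB => _ deg _ rels; move: l y m ym ly {not_both}.
  move=> [a []] [b []] [c []]; rewrite /linv /=;
    rewrite ?(followsDD, followsDI, followsID, followsII) /ltgt /=
      => /andP[/eqP h1 h2] h3; rewrite ?h1 ?h3 ?eqxx //=.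
  - by have [<-|_] := eqVneq b a; rewrite ?orbT // h2.
  - by have [<-|//] := eqVneq c a; rewrite eq_sym h2.
  - case ca: (rel2 c a) => //=; case ba: (rel2 b a) => //=.
    have [_ h] := rels a; have := @card_le1 _ _ b c h.
    rewrite /composable h1 h3 !eqxx ba ca => /(_ isT isT) e.
    by rewrite e eqxx in h2.
  - by have [<-|//] := eqVneq c a; rewrite h2.
  - by have [<-|//] := eqVneq c a; rewrite h2.
  - case ac: (rel2 a c) => //=; case ab: (rel2 a b) => //=.
    have [h _] := rels a; have := @card_le1 _ _ b c h.
    rewrite /composable h1 h3 !eqxx ab ac => /(_ isT isT) e.
    by rewrite e eqxx in h2.
  - by have [<-|//] := eqVneq c a; rewrite eq_sym h2.
  - by have [<-|_] := eqVneq b a; rewrite ?orbT // h2.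
by move: not_both one; case: (follows l m); case: (follows _ _).
Qed.

End Letters.

Lemma eqb_neg (d d' : bool) : d != d' -> d = ~~ d'.
Proof. by case: d; case: d'. Qed.

Section Out.
Variable B : bquiver.
Implicit Types (s : seq (letter B)) (l m : letter B).

Lemma omap_linvP (o : option (letter B)) l :
  omap (@linv B) o = Some l -> o = Some (linv l).
Proof. by case: o => [m|] // [<-]; rewrite linvK. Qed.

Lemma isSome_out s d p :
  isSome (out s d p) = if d then p < size s else 0 < p <= size s.
Proof.
case: d => /=; first exact: onthTE.
by case: p => //= p; rewrite -onthTE; case: (onth s p).
Qed.

Lemma out_size s d p l : out s d p = Some l -> p <= size s.
Proof.
move=> h; have := isSome_out s d p; rewrite h; case: d {h} => /= /esym; lia.
Qed.

Lemma mv_size s d p l : out s d p = Some l -> mv d p <= size s.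
Proof.
move=> h; have := isSome_out s d p; rewrite h; case: d {h} => /= /esym; lia.
Qed.

Lemma mvK s d p l : out s d p = Some l -> mv (~~ d) (mv d p) = p.
Proof.
move=> h; have := isSome_out s d p; rewrite h; case: d {h} => //= /esym; lia.
Qed.

Lemma out_mv s d p l : out s d p = Some l -> out s (~~ d) (mv d p) = Some (linv l).
Proof.
case: d => /=; first by move=> ->.
by case: p => //= p; case: (onth s p) => //= m [<-]; rewrite linvK.
Qed.

Lemma take_onth (T : Type) (s : seq T) p (l : T) :
  onth s p = Some l -> take p.+1 s = rcons (take p s) l.
Proof.
move=> h; have ps : p < size s by rewrite -onthTE h.
by rewrite (take_nth l) // (onth_nth _ _ _ _ h).
Qed.

End Out.

Section StringWords.
Variables (B : bquiver) (C : word B).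
Local Notation s := C.2.
Implicit Types (l m : letter B) (a : Q1 B).

Lemma is_stringP :
  reflect ((forall l, onth s 0 = Some l -> lsrc l = C.1) /\
           (forall p l m, onth s p = Some l -> onth s p.+1 = Some m -> follows l m))
          (is_string C).
Proof.
rewrite /is_string; case: C => x [|l w] /=; first by constructor; split=> // -[].
apply: (iffP andP) => [[/eqP <- h]|[h1 h2]]; split=> //=.
- by move=> m [<-].
- move=> p l1 l2 h1 h2; have := pathP l h p.
  have p2 : p < size w by rewrite -onthTE h2.
  by rewrite p2 (onth_nth _ _ _ _ h1) (onth_nth _ _ _ _ h2); apply.
- by rewrite (h1 l).
apply/(pathP l) => p pw; apply: (h2 p).
  by rewrite onthE (nth_map l) //= ltnW.
by rewrite /= onthE (nth_map l).
Qed.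

Lemma vertex_at0 : vertex_at C 0 = C.1.
Proof. by rewrite /vertex_at take0. Qed.

Lemma vertex_atS p l : onth s p = Some l -> vertex_at C p.+1 = ltgt l.
Proof. by move=> h; rewrite /vertex_at (take_onth h) map_rcons last_rcons. Qed.

Hypothesis sC : is_string C.

Lemma out_src d p l : out s d p = Some l -> lsrc l = vertex_at C p.
Proof.
have [h1 h2] := is_stringP sC.
case: d p => [] [|p]; rewrite /out //.
- by move=> /h1 ->; rewrite vertex_at0.
- move=> h3; case h4: (onth s p) => [m|]; last first.
    by move: (onthTE s p) (onthTE s p.+1); rewrite h3 h4 /=; lia.
  by rewrite (vertex_atS h4); apply/follows_src/(h2 _ _ _ h4 h3).
- case h4: (onth s p) => [m|] // [<-].
  by rewrite (vertex_atS h4) lsrc_linv.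
Qed.

Lemma out_tgt d p l : out s d p = Some l -> ltgt l = vertex_at C (mv d p).
Proof. by move=> h; rewrite -lsrc_linv; apply: (out_src (out_mv h)). Qed.

Lemma out_follows d p l m :
  out s (~~ d) p = Some m -> out s d p = Some l -> follows (linv m) l.
Proof.
have [_ h] := is_stringP sC.
case: d p => [] [|p] //; rewrite /out /negb; case e: (onth s p) => [n|] //.
  by move=> [<-] /(h _ _ _ e); rewrite linvK.
by move=> /(h _ _ _ e) + [<-]; rewrite follows_linv.
Qed.

End StringWords.
Arguments is_stringP {B C}.

(** * The action of arrows and paths on the basis of a string module *)

(** The action of an arrow on a basis vector of the string module; None is the
    zero vector. *)
Definition nxt (B : bquiver) (s : seq (letter B)) (p : nat) (a : Q1 B) : option nat :=
  if out s true p == Some (a, true) then Some (mv true p)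
  else if out s false p == Some (a, true) then Some (mv false p) else None.

Definition run (B : bquiver) (s : seq (letter B)) (p : nat) (v : seq (Q1 B)) :
    option nat :=
  foldl (fun o a => obind (fun q => nxt s q a) o) (Some p) v.

Section Run.
Variables (B : bquiver).
Implicit Types (l m : letter B) (a b : Q1 B) (v w : seq (Q1 B)).

Lemma nxtE (s : seq (letter B)) p a (q : nat) :
  (nxt s p a == Some q) =
  if out s true p == Some (a, true) then q == p.+1
  else (p == q.+1) && (onth s q == Some (a, false)).
Proof.
have eqS (x y : nat) : (Some x == Some y) = (y == x) by rewrite eq_sym.
rewrite /nxt [out s true p]/=; case: (onth s p =P _) => [_|_]; first by rewrite eqS.
case: p => [|p] //=; rewrite eqSS; case: (omap _ _ =P _) => e; last first.
  apply/esym/andP => -[/eqP pq]; rewrite -pq => /eqP h; case: e; rewrite h //.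
have {}e : onth s p = Some (a, false).
  exact: omap_linvP e.
rewrite eqS eq_sym; case: (p =P q) => //= <-; by rewrite e eqxx.
Qed.

Lemma run_rcons s p v a :
  run s p (rcons v a) = obind (fun q => nxt s q a) (run s p v).
Proof. by rewrite /run foldl_rcons. Qed.

Lemma run_cat s p v w : run s p (v ++ w) = obind (fun q => run s q w) (run s p v).
Proof.
rewrite /run foldl_cat; case: (foldl _ _ v) => //=.
by elim: w.
Qed.

Lemma run_cons s p a w : run s p (a :: w) = obind (fun q => run s q w) (nxt s p a).
Proof. exact: (run_cat s p [:: a] w). Qed.

Variable (C : word B).
Hypothesis sC : is_string C.
Local Notation s := C.2.

Lemma nxtP p a q :
  nxt s p a = Some q <-> exists2 d, out s d p = Some (a, true) & q = mv d p.
Proof.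
rewrite /nxt; split.
  by case: eqP => [h [<-]|_]; [exists true|case: eqP => // h [<-]; exists false].
case=> -[] h ->; first by rewrite h eqxx.
rewrite h eqxx; case: eqP => // h'.
by have := follows_neq (out_follows sC (d := true) h h'); rewrite linvK eqxx.
Qed.

(** The entry of the matrix of an arrow in a string module. *)
Lemma nxt_step p a q :
  ((q == p.+1) && (onth s p == Some (a, true))
   || (p == q.+1) && (onth s q == Some (a, false))) = (nxt s p a == Some q).
Proof.
rewrite nxtE /= [_ && (onth s p == _)]andbC.
case: eqP => //= e; case: eqP => //= _.
case: (p =P q.+1) => //= e2; rewrite e2 in e; apply/negP => /eqP e3.
have [_ /(_ _ _ _ e3 e) h] := is_stringP sC.
by have := follows_neq h; rewrite /linv eqxx.
Qed.

Lemma nxt_inj p p' a q : nxt s p a = Some q -> nxt s p' a = Some q -> p = p'.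
Proof.
move=> /nxtP[d h1 e1] /nxtP[d' h2 e2].
have k1 := out_mv h1; have k2 := out_mv h2; rewrite -e1 in k1; rewrite -e2 in k2.
have dd : d' = d.
  case: (eqVneq d' d) => // /eqb_neg dd; rewrite dd negbK in k2.
  have := follows_neq (out_follows sC (d := d) k1 k2).
  by rewrite linvK eqxx.
by rewrite -(mvK h1) -(mvK h2) -e1 -e2 dd.
Qed.

Lemma nxt_size p a q : nxt s p a = Some q -> p <= size s /\ q <= size s.
Proof. by move=> /nxtP[d h ->]; rewrite (out_size h) (mv_size h). Qed.

Lemma run_size p v q : p <= size s -> run s p v = Some q -> q <= size s.
Proof.
case/lastP: v => [|v a] ps; first by case=> <-.
by rewrite run_rcons; case: run => //= r /nxt_size[].
Qed.

Lemma run_rconsP p v a q : run s p (rcons v a) = Some q ->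
  exists d q', [/\ run s p v = Some q', out s d q' = Some (a, true), q = mv d q',
      out s (~~ d) q = Some (a, false) & q' = mv (~~ d) q].
Proof.
rewrite run_rcons; case e: run => [q'|] //= /nxtP[d h ->].
by exists d, q'; split=> //; [rewrite (out_mv h)|rewrite (mvK h)].
Qed.

Lemma out_neq d p l : out s d p = Some l -> out s (~~ d) p = Some l -> False.
Proof.
by move=> h h'; have := follows_neq (out_follows sC h' h); rewrite linvK eqxx.
Qed.

(** A path moves along the string in a constant direction, the one in which its
    last arrow moves. *)
Lemma run_dir p v a q d : run s p (rcons v a) = Some q ->
  out s (~~ d) q = Some (a, false) -> if d then p < q else q < p.
Proof.
elim/last_ind: v a q => [|v b IH] a q /run_rconsP[d' [q' [h1 h2 h3 h4 _]]] h6.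
all: have dd' : d' = d
  by case: (eqVneq d' d) => // /eqb_neg e; case: (out_neq h6); rewrite -e.
all: move: h2 h3 h4; rewrite {}dd' => h2 h3 _.
all: have := isSome_out s d q'; rewrite h2 h3 /mv.
  by case: h1 => <-; case: (d) => /= /esym; lia.
have [d2 [q2 [k1 k2 k3 k4 _]]] := run_rconsP h1.
have e2 : d2 = d.
  by case: (eqVneq d2 d) => // /eqb_neg e; move: k4; rewrite e negbK h2.
have := IH _ _ h1; rewrite e2 in k4 => /(_ k4).
by case: (d) => /= + /esym; lia.
Qed.

End Run.

(** * Nonzero paths *)

Section NonzeroPaths.
Variable B : bquiver.
Implicit Types (a b : Q1 B) (u v w : seq (Q1 B)) (x : Q0 B).

Definition nzstep : rel (Q1 B) := [rel a b | composable a b && ~~ rel2 b a].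

Lemma nzpathE x v : nzpath x v =
  (if v is a :: _ then src a == x else true) && sorted nzstep v.
Proof. by rewrite /nzpath /in_ideal negbK sorted_relI. Qed.

Lemma nzpath_cat x u w : nzpath x (u ++ w) -> nzpath x u /\ nzpath (path_end x u) w.
Proof.
rewrite !nzpathE; case: u => [|a u] /=; first by rewrite /path_end.
rewrite cat_path => /and3P[-> -> /=]; case: w => //= b w /andP[/andP[/eqP h _] ->].
by split=> //; rewrite andbT /path_end /= h last_map.
Qed.

Lemma nzpath_rcons x v a : nzpath x (rcons v a) -> src a = path_end x v.
Proof.
by rewrite -cats1 => /nzpath_cat[_]; rewrite nzpathE andbT => /eqP.
Qed.

Lemma nzpath_last2 x v b a : nzpath x (rcons (rcons v b) a) -> nzstep b a.
Proof.
rewrite -!cats1 -catA => /nzpath_cat[_]; rewrite nzpathE => /andP[_] /=.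
by rewrite andbT.
Qed.

(** A nonzero path with a repeated arrow contains a cycle, all powers of which
    are nonzero, as each pair of consecutive arrows in a power occurs in the path
    itself.  This contradicts admissibility. *)
Lemma nzpath_uniq x v : admissible B -> nzpath x v -> uniq v.
Proof.
move=> [_ [N hN]]; rewrite nzpathE => /andP[_ sv]; apply/negPn/negP.
case: v sv => // a0 v; move: (a0 :: v) => w sv.
move=> /(uniqPn a0)[i [j [ij jv e]]].
have {}jv : j < size w := jv; set a := nth a0 w i in e.
pose t := take (j - i) (drop i.+1 w).
have pt : path nzstep a (drop i.+1 w).
  have : sorted nzstep (drop i w) by apply: drop_sorted.
  by rewrite (drop_nth a0) // (ltn_trans ij).
have {}pt : path nzstep a t.
  move: pt; rewrite -{1}(cat_take_drop (j - i) (drop i.+1 w)) cat_path.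
  by case/andP.
have st : size t = j - i by rewrite size_takel // size_drop; lia.
have lt : last a t = a.
  rewrite (last_nth a0) st; case ji: (j - i) => [|n] /=; first lia.
  by rewrite nth_take ?ji // nth_drop e; congr nth; lia.
pose c n := flatten (nseq n t).
have pc n : path nzstep a (c n) /\ last a (c n) = a.
  by elim: n => [|n [IH1 IH2]] //=; rewrite cat_path last_cat lt pt.
have sc n : n <= size (c n).
  by elim: n => // n IH; rewrite /c /= size_cat st -/(c n); move: (size (c n)) IH ij => ? *; lia.
have := path_sorted (pc N).1; rewrite sorted_relI => /andP[h1 h2].
by have := hN _ h1 (sc N); rewrite /in_ideal h2.
Qed.

Lemma nzpath_size x v : admissible B -> nzpath x v -> size v <= #|Q1 B|.
Proof. by move=> h /(nzpath_uniq h)/card_uniqP <-; apply: max_card. Qed.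

End NonzeroPaths.

Lemma run_nzpath (B : bquiver) (C : word B) p v q :
  is_string C -> run C.2 p v = Some q ->
  nzpath (vertex_at C p) v /\ path_end (vertex_at C p) v = vertex_at C q.
Proof.
move=> sC; elim/last_ind: v q => [|v a IH] q; first by case=> <-.
move=> h; have [d [q' [h1 h2 h3 h4 h5]]] := run_rconsP sC h.
have [nz e] := IH _ h1; rewrite /path_end map_rcons last_rcons.
split; last by rewrite h3 -(out_tgt sC h2).
have sa : src a = vertex_at C q' := out_src sC h2.
case/lastP: v nz e h1 {IH h} => [|v b] nz e h1; first by rewrite nzpathE /= sa -e eqxx.
have [d' [r [k1 k2 k3 k4 k5]]] := run_rconsP sC h1.
have dd : d' = d.
  by case: (eqVneq d' d) => // /eqb_neg dd; rewrite dd negbK h2 in k4.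
have ab : nzstep b a.
  by rewrite dd in k4; have := out_follows sC k4 h2; rewrite /= followsDD.
move: nz; rewrite !nzpathE => /andP[hd st]; apply/andP; split.
  by case: (v) hd => // ? ?.
case: v st {hd e h1 k1} => [|c v] /=; first by rewrite ab.
by rewrite !rcons_path last_rcons => /andP[-> ->].
Qed.

(** * Zigzags *)

(** Peaks (b = true) and valleys (b = false). *)
Definition extr (B : bquiver) (s : seq (letter B)) (b : bool) (p : nat) : bool :=
  all (fun d => if out s d p is Some l then l.2 == b else true) [:: true; false].

(** The interval [w0, w1] of a string C that carries a minimal projective
    presentation.  At its end in direction d there is a valley if ty d holds and a
    peak otherwise.  Beyond the end the string runs on monotonically: away from a
    valley by inverse letters, as in the completion of a cohook; away from a peak
    by direct letters, the remaining leg of the projective at the peak.  In both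
    cases it cannot be prolonged further in this manner.  For ty d the presented
    module ends one letter before the valley and its translate at the end of C;
    otherwise the module extends to the end of C and its translate ends one letter
    before the peak.  All conditions are preserved if the signs of all letters and
    the values of ty are reversed. *)
Record zigzag (B : bquiver) (C : word B) (w0 w1 : nat) (ty : bool -> bool) : Prop :=
  Zigzag {
    zz_le : w0 <= w1;
    zz_size : w1 <= size C.2;
    zz_add : forall d, ty d -> w0 < w1;
    zz_out : forall d p l, (if d then w1 <= p else p <= w0) ->
      out C.2 d p = Some l -> l.2 = ~~ ty d;
    zz_in : forall d l, w0 < w1 ->
      out C.2 (~~ d) (if d then w1 else w0) = Some l -> l.2 = ~~ ty d;
    zz_max : forall d l, l.2 = ~~ ty d ->
      lsrc l = vertex_at C (if d then size C.2 else 0) ->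
      exists2 m, out C.2 (~~ d) (if d then size C.2 else 0) = Some m
               & ~~ follows (linv m) l }.

Lemma extrP (B : bquiver) (s : seq (letter B)) b p :
  reflect (forall d l, out s d p = Some l -> l.2 = b) (extr s b p).
Proof.
apply: (iffP allP) => [h d l e|h d _].
  have : d \in [:: true; false] by case: (d).
  by move=> /h; rewrite e => /eqP.
by case e: out => [l|] //; rewrite (h _ _ e).
Qed.

Section Zigzag.
Variables (B : bquiver) (C : word B) (w0 w1 : nat) (ty : bool -> bool).
Hypotheses (gB : locally_gentle B) (sC : is_string C) (zz : zigzag C w0 w1 ty).
Local Notation s := C.2.
Let N := size s.
Implicit Types (a b : Q1 B) (u v w : seq (Q1 B)) (d : bool) (p q : nat).

Definition inW p := w0 <= p <= w1.
(** The positions of C between which the presented module lies. *)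
Definition y0 := if ty false then w0.+1 else 0.
Definition y1 := if ty true then w1.-1 else size s.

Let sizeE d p : (out s d p : bool) = if d then p < N else 0 < p <= N.
Proof. exact: isSome_out. Qed.

Lemma out_some d p : (if d then p < N else 0 < p <= N) -> exists l, out s d p = Some l.
Proof. by rewrite -sizeE; case: out => // l; exists l. Qed.

Lemma out_none d p : out s d p = None -> p <= N -> p = if d then N else 0.
Proof.
move=> h; have := sizeE d p; rewrite h; case: d {h} => /= /esym; lia.
Qed.

(** Climbing from q against the arrows in direction d, the first position that is
    not followed by an inverse letter is a peak of the interval.  The last two
    hypotheses keep the climb within the interval, or have it start on a leg that
    descends from a peak at the end opposite to d. *)
Lemma uphill d q a : out s d q = Some (a, false) ->
  (if d then q < w1 else w0 < q) ->
  (if d then w0 <= q else q <= w1) || ~~ ty (~~ d) ->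
  exists p v, [/\ inW p, extr s true p, run s p v = Some q
                & if d then q < p else p < q].
Proof.
have := zz_le zz; have := zz_size zz => w1N w01.
have [n] := ubnP (if d then w1 - q else q - w0).
elim: n q a => // n IH q a hn h1 h2 h3.
have h4 := out_mv h1; set q' := mv d q in h4 *.
have q'q : mv (~~ d) q' = q by apply: mvK h1.
have nq' : nxt s q' a = Some q by apply/(nxtP sC); exists (~~ d).
have [qq' q'w] : (if d then q' = q.+1 else q = q'.+1) /\ (if d then q' <= w1 else w0 <= q').
  by rewrite /q' /mv; case: (d) h2 => /=; lia.
case e : (out s d q') => [[b []]|].
- exists q', [:: a]; split; [|apply/extrP| |by case: (d) qq' => ->]; last first.
  + by rewrite run_cons nq'.
  + move=> d' l; have [->|/eqb_neg->] := eqVneq d' d; first by rewrite e => -[<-].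
    by rewrite h4 => -[<-].
  rewrite /inW; move: h3 q'w qq' => /orP[|h3]; first by case: (d); lia.
  case: (boolP (if d then w0 <= q' else q' <= w1)) => bad; first by case: (d) bad; lia.
  have := zz_out zz (d := ~~ d) _ (out_mv e); rewrite (negPf h3) /= => k.
  suff: false = true by []; apply: k; case: (d) bad => /=; lia.
- have [hw|hw] := boolP (if d then q' < w1 else w0 < q').
    have [||p [v [k1 k2 k3 k4]]] := IH q' b _ e hw.
    + by case: (d) hn qq' hw h2; lia.
    + by case/orP: h3 => [h3|->]; rewrite ?orbT //; apply/orP; left; case: (d) h3 qq' q'w; lia.
    exists p, (rcons v a); split=> //; first by rewrite run_rcons k3.
    by case: (d) k4 qq'; lia.
  have q'E : q' = if d then w1 else w0 by case: (d) hw q'w; lia.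
  have le : if d then w1 <= q' else q' <= w0 by rewrite q'E; case: (d).
  have ty1 : ty d by have /esym/negbFE := zz_out zz le e.
  have := @zz_in _ _ _ _ _ zz d _ (zz_add zz ty1); rewrite -q'E => /(_ _ h4).
  by rewrite ty1.
have q'e : q' = if d then N else 0 by apply: out_none => //; apply: mv_size h1.
have q'E : q' = if d then w1 else w0 by case: (d) q'e q'w; rewrite /N; lia.
exists q', [:: a]; split; [|apply/extrP| |by case: (d) qq' => ->].
- by rewrite /inW q'E; case: (d); lia.
- move=> d' l; have [->|/eqb_neg->] := eqVneq d' d; first by rewrite e.
  by rewrite h4 => -[<-].
- by rewrite run_cons nq'.
Qed.


Lemma extr_disjoint p : w0 < w1 -> inW p -> extr s true p -> extr s false p -> False.
Proof.
move=> w01 /andP[p0 p1] /extrP h1 /extrP h2; have := zz_size zz => wN.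
have [pw|pw] := ltnP p w1.
  have [l e] : exists l, out s true p = Some l by apply: out_some; rewrite /N; lia.
  by have := h1 _ _ e; rewrite (h2 _ _ e).
have [l e] : exists l, out s false p = Some l by apply: out_some; rewrite /N; lia.
by have := h1 _ _ e; rewrite (h2 _ _ e).
Qed.

Lemma peak_run_nil p v a q : extr s true q -> run s p (rcons v a) = Some q -> False.
Proof. by move=> /extrP h /(run_rconsP sC)[d [q' [_ _ _ /h]]]. Qed.

(** Two descents from peaks to the same position coincide unless they come from
    both sides of a valley. *)
Lemma peak_run_inj p v p2 v2 q : extr s true p -> extr s true p2 ->
  run s p v = Some q -> run s p2 v2 = Some q ->
  (p = p2 /\ v = v2) \/
  (extr s false q /\ exists d a a2 v' v2',
     [/\ out s (~~ d) q = Some (a, false), out s d q = Some (a2, false),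
         v = rcons v' a & v2 = rcons v2' a2]).
Proof.
move=> hp hp2; elim/last_ind: v v2 q => [|v a IH] v2 q.
  case/lastP: v2 => [|v2 a2] [<-]; first by case=> ->; left.
  by move=> /(peak_run_nil hp).
case/lastP: v2 => [|v2 a2] h1.
  by case=> e; move: h1; rewrite -e => /(peak_run_nil hp2).
move=> h2; have [d [r [k1 k2 k3 k4 k5]]] := run_rconsP sC h1.
have [d' [r' [j1 j2 j3 j4 j5]]] := run_rconsP sC h2.
have [e|/eqb_neg e] := eqVneq d' d.
  rewrite {}e in j2 j3 j4 j5; left; move: j4; rewrite k4 => -[e]; rewrite -e in j1 j2 *.
  have er : r = r' by rewrite k5 j5.
  rewrite -er in j1; case: (IH _ _ k1 j1) => [[-> ->] //|[/extrP hr _]].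
  by have := hr _ _ k2.
right; rewrite {}e negbK in j4; split.
  by apply/extrP => e l; have [->|/eqb_neg->] := eqVneq e d; rewrite ?j4 ?k4 => -[<-].
by exists d, a, a2, v, v2.
Qed.

(** A nonzero path out of a peak of W that leaves the string does so at a valley
    of W: anywhere else the string could be continued. *)
Lemma dead_end p v a q : inW p -> extr s true p -> run s p v = Some q ->
  nxt s q a = None -> nzpath (vertex_at C p) (rcons v a) ->
  [/\ w0 < w1, inW q & extr s false q].
Proof.
move=> Wp /extrP hp hr hn nz.
have := zz_le zz; have := zz_size zz => w1N w01.
have pN : p <= N by move: Wp; rewrite /inW /N; lia.
have qN : q <= N by apply: run_size hr.
have [_ pe] := run_nzpath sC hr.
have sa : src a = vertex_at C q by rewrite (nzpath_rcons nz).
have na d : out s d q <> Some (a, true).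
  move=> h; have : nxt s q a = Some (mv d q) by apply/(nxtP sC); exists d.
  by rewrite hn.
case/lastP: v => [|v b] in hr nz pe *.
  case: hr => pq; rewrite -{}pq in hn sa na qN pe *; exfalso.
  have [d hd] : exists d, out s d p = None.
    case e1: (out s true p) => [[b b']|]; last by exists true.
    case e2: (out s false p) => [[c c']|]; last by exists false.
    have := hp _ _ e1; have := hp _ _ e2; rewrite /= => c'e b'e; exfalso.
    rewrite {}b'e {}c'e in e1 e2.
    case: gB => _ /(_ (vertex_at C p))[_ h] _ _.
    have := @card_le2 _ (fun x => src x == vertex_at C p) a b c h.
    have sb : src b = vertex_at C p := out_src sC e1.
    have sc : src c = vertex_at C p := out_src sC e2.
    rewrite sa sb sc => /(_ (eqxx _) (eqxx _) (eqxx _)) /or3P[] /eqP e3.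
    - by apply: (na true); rewrite e3.
    - by rewrite e3 in e1; apply: (out_neq sC e1 e2).
    - by apply: (na false); rewrite e3.
  have pd := out_none hd pN.
  have pb : p = if d then w1 else w0 by move: Wp pd; rewrite /inW /N; case: (d); lia.
  have td : ty d = false.
    apply/negP => td; have w01' := zz_add zz td.
    have [l hl] : exists l, out s (~~ d) p = Some l.
      by apply: out_some; move: Wp pb pd w01'; rewrite /inW; case: (d) => /=; lia.
    have := @zz_in _ _ _ _ _ zz d l w01'; rewrite -pb td (hp _ _ hl) => /(_ hl).
    by [].
  have := @zz_max _ _ _ _ _ zz d (a, true); rewrite td -/N -pd => /(_ erefl sa)[m hm].
  have := hp _ _ hm; case: m hm => [b ?] hm /= e3; rewrite {}e3 in hm *.
  rewrite followsID sa -(out_src sC hm) eqxx /= negbK => /eqP e3.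
  by apply: (na (~~ d)); rewrite e3.
have [d [r [k1 k2 k3 k4 k5]]] := run_rconsP sC hr.
have ba : (src a == tgt b) && ~~ rel2 a b := nzpath_last2 nz.
have rq : if d then p <= r /\ q = r.+1 else r <= p /\ r = q.+1.
  have := run_dir sC hr k4; move: (isSome_out s d r); rewrite k2 k3 /mv.
  by case: (d) => /=; lia.
have Wr : (if d then w0 <= q else q <= w1) by move: Wp rq; rewrite /inW; case: (d); lia.
suff [Wq vq] : inW q /\ extr s false q.
  split=> //; have := run_dir sC hr k4; move: Wp Wq; rewrite /inW; clear.
  by case: (d); lia.
case e: (out s d q) => [l|].
  have fl := out_follows sC k4 e.
  have l2 : l.2 = false.
    apply/negbTE/negP => l2; apply: (na d); rewrite e; congr Some.
    by apply: (follows_inj gB fl); rewrite // followsDD.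
  split; last first.
    by apply/extrP => d' m; have [->|/eqb_neg->] := eqVneq d' d; rewrite ?k4 ?e => -[<-].
  suff : if d then q <= w1 else w0 <= q by move: Wr; rewrite /inW; clear; case: (d); lia.
  apply/negP => /negP bad.
  have h1 := @zz_out _ _ _ _ _ zz d _ _ _ e; have h2 := @zz_out _ _ _ _ _ zz d _ _ _ k2.
  have : true = ~~ ty d by apply: h2; move: bad rq; clear; case: (d); lia.
  by rewrite -h1 ?l2 //; move: bad; clear; case: (d); lia.
have qd := out_none e qN.
case td: (ty d); last first.
  have := @zz_max _ _ _ _ _ zz d (a, true); rewrite td -/N -qd => /(_ erefl sa)[m].
  by rewrite k4 => -[<-]; rewrite followsDD ba.
split; last first.
  by apply/extrP => d' m; have [->|/eqb_neg->] := eqVneq d' d; rewrite ?k4 ?e => // -[<-].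
suff : if d then q <= w1 else w0 <= q by move: Wr; rewrite /inW; clear; case: (d); lia.
apply/negP => /negP bad; have h2 := @zz_out _ _ _ _ _ zz d _ _ _ k2.
suff : true = ~~ ty d by rewrite td.
by apply: h2; move: bad rq; clear; case: (d); lia.
Qed.

(** The presented module is a quotient of M(C): no arrow leads into it from
    outside. *)
Lemma nxt_enter r a q : nxt s r a = Some q -> y0 <= q <= y1 -> y0 <= r <= y1.
Proof.
move=> h; have [rN _] := nxt_size sC h.
move/(nxtP sC): h => -[d h ->] qy; apply/negP => /negP ry.
suff [td rE] : ty (~~ d) /\ r = if d then w0 else w1.
  have w01 := zz_add zz td; have := @zz_in _ _ _ _ _ zz (~~ d) (a, true) w01.
  by rewrite negbK td if_neg -rE => /(_ h).
have := @zz_add _ _ _ _ _ zz true; have := zz_size zz.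
move: rN ry qy; rewrite /y0 /y1; have := zz_le zz; clear h.
by case: d => /=; case: (ty false); case: (ty true) => //= ? ? ? ? ? h;
  try (have := h isT); lia.
Qed.

Lemma valley_inside q : w0 < w1 -> inW q -> y0 <= q <= y1 -> extr s false q ->
  w0 < q < w1.
Proof.
move=> w01 Wq qy /extrP hq; have := zz_size zz => wN.
suff h d : q <> if d then w1 else w0.
  by have := h true; have := h false; move: Wq; rewrite /inW; clear; lia.
move=> qE; case td: (ty d).
  move: qy; rewrite /y0 /y1; case: (d) td qE => ->; move: w01; clear.
    by case: (ty false); lia.
  by case: (ty true); lia.
have [l hl] : exists l, out s (~~ d) q = Some l.
  by apply: out_some; rewrite qE /N; move: w01 wN; clear; case: (d) => /=; lia.
have := @zz_in _ _ _ _ _ zz d l w01; rewrite -qE => /(_ hl).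
by rewrite td (hq _ _ hl).
Qed.

Lemma valley_reached q d : w0 < q < w1 -> extr s false q ->
  exists p v, [/\ inW p, extr s true p, run s p v = Some q
                & if d then q < p else p < q].
Proof.
move=> qw /extrP hq; have := zz_size zz => wN.
have [[a b] hl] : exists l, out s d q = Some l.
  by apply: out_some; rewrite /N; move: qw wN; clear; case: (d) => /=; lia.
have /= b0 := hq _ _ hl; rewrite {}b0 in hl.
apply: uphill hl _ _; move: qw; clear; case: (d) => /=; try lia.
all: by move=> ?; apply/orP; left; lia.
Qed.

Lemma reached q : y0 <= q <= y1 ->
  exists p v, [/\ inW p, extr s true p & run s p v = Some q].
Proof.
move=> qy; have := zz_size zz => wN; have w01 := zz_le zz.
have up d a : out s d q = Some (a, false) ->
  (if d then q < w1 else w0 < q) ->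
  (if d then w0 <= q else q <= w1) || ~~ ty (~~ d) ->
  exists p v, [/\ inW p, extr s true p & run s p v = Some q].
  by move=> h1 h2 h3; have [p [v [? ? ? _]]] := uphill h1 h2 h3; exists p, v.
have [Wq|nWq] := boolP (inW q); last first.
  (* outside W the string is an extension beyond a peak, so W lies uphill      *)
  have [d hd] : exists d, if d then q < w0 else w1 < q.
    have : (q < w0) || (w1 < q) by move: nWq; rewrite /inW; clear; lia.
    by case/orP=> h; [exists true|exists false].
  have td : ty (~~ d) = false.
    apply/negP => td; move: qy hd; rewrite /y0 /y1; clear -td w01.
    by case: d td => /= ->; lia.
  have [l hl] : exists l, out s d q = Some l.
    apply: out_some; move: qy hd; rewrite /y1 /N; move: w01 wN; clear.
    by case: (d); case: (ty true) => /=; lia.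
  have := @zz_out _ _ _ _ _ zz (~~ d) _ _ _ (out_mv hl); rewrite td => hl2.
  have {}hl2 : l.2 = false.
    suff : (linv l).2 = true by case: (l) => ? [].
    by apply: hl2; move: hd; clear; case: (d) => /=; lia.
  case: l hl hl2 => a b hl /= bf; rewrite {}bf in hl.
  apply: (up d a hl); last by rewrite td orbT.
  by move: hd w01; clear; case: (d); lia.
have [pk|] := boolP (extr s true q); first by exists q, [::].
move=> /allPn[d _]; case e: (out s d q) => [[a b]|] //= bf.
have {bf}b0 : b = false by case: (b) bf.
rewrite {}b0 in e; apply: (up d a e); last first.
  by apply/orP; left; move: Wq; rewrite /inW; clear; case: (d); lia.
apply/negP => /negP bad.
have qE : q = if d then w1 else w0 by move: bad Wq; rewrite /inW; clear; case: (d); lia.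
have td : ty d.
  have := @zz_out _ _ _ _ _ zz d _ _ _ e; rewrite qE => h.
  by apply/negPn; rewrite -h //; clear; case: (d).
have := zz_add zz td; move: qE qy td; rewrite /y0 /y1; clear.
by case: (d) => /= -> + e; rewrite e; lia.
Qed.

Lemma add_valley d : ty d -> extr s false (if d then w1 else w0).
Proof.
move=> td; have w01 := zz_add zz td.
apply/extrP => d' l; have [->|/eqb_neg->] := eqVneq d' d => h; last first.
  by rewrite (zz_in zz w01 h) td.
by rewrite (@zz_out _ _ _ _ _ zz _ _ _ _ h) ?td //; clear; case: (d).
Qed.

(** A descent leaves the presented module only by stepping into a valley at an
    end of the interval. *)
Lemma run_outside p v q : inW p -> run s p v = Some q -> ~~ (y0 <= q <= y1) ->
  exists d, [/\ w0 < w1, q = (if d then w1 else w0) & extr s false q].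
Proof.
move=> Wp h qy; have wN := zz_size zz; have w01 := zz_le zz.
have qN : q <= size s.
  by apply: run_size h => //; move: Wp; rewrite /inW; move: wN; clear; lia.
have [d td qd] : exists2 d, ty d & if d then w1 <= q else q <= w0.
  move: qy; rewrite /y0 /y1.
  case td0: (ty false); case td1: (ty true) => qy.
  - case: (leqP q w0) => hq; first by exists false.
    by exists true => //; move: qy hq w01; clear; lia.
  - by exists false => //; move: qy qN; clear; lia.
  - by exists true => //; move: qy w01; clear; lia.
  - by move: qy; rewrite qN.
have w01' := zz_add zz td; exists d.
case: (eqVneq q (if d then w1 else w0)) => [->|qb]; first by split=> //; apply: add_valley.
exfalso; case/lastP: v h => [|v a] h.
  by case: h => pq; move: Wp qb qd; rewrite pq /inW; clear; case: (d); lia.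
have [d' [r [k1 k2 k3 k4 k5]]] := run_rconsP sC h.
have hd := run_dir sC h k4.
have dd : d' = d.
  by move: hd qd qb Wp; rewrite /inW; clear; case: (d); case: (d') => //; lia.
rewrite {}dd in k2 k3 k4 k5 hd.
suff : true = ~~ ty d by rewrite td.
apply: (@zz_out _ _ _ _ _ zz d _ _ _ k2); move: (mvK k2) qd qb k5; rewrite -k3.
by clear; case: (d) => /=; lia.
Qed.

Lemma run_valley q w r : extr s false q -> run s q w = Some r -> w = [::].
Proof.
case: w => // a w /extrP hq; rewrite run_cons; case e: (nxt s q a) => [r'|] // _.
by move: e => /(nxtP sC)[d /hq].
Qed.

Lemma valley_has_peak q : w0 < w1 -> inW q -> extr s false q ->
  exists p v, [/\ inW p, extr s true p & run s p v = Some q].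
Proof.
move=> w01 Wq /extrP hq; have wN := zz_size zz; pose d := q < w1.
have [[a b] hl] : exists l, out s d q = Some l.
  apply: out_some; rewrite /N /d; move: Wq w01 wN; rewrite /inW; clear.
  by case: (ltnP q w1) => /=; lia.
have /= b0 := hq _ _ hl; rewrite {}b0 in hl.
have [||p [v [? ? ? _]]] := uphill hl _ _; last by exists p, v.
  by move: Wq w01; rewrite /inW /d; clear; case: (ltnP q w1) => /=; lia.
by apply/orP; left; move: Wq; rewrite /inW /d; clear; case: (ltnP q w1) => /=; lia.
Qed.

End Zigzag.

Lemma run_none (B : bquiver) (s : seq (letter B)) p v : run s p v = None ->
  exists v1 a u q, [/\ v = rcons v1 a ++ u, run s p v1 = Some q & nxt s q a = None].
Proof.
elim/last_ind: v => [|v a IH] //; rewrite run_rcons.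
case e: (run s p v) => [q|] /= h; first by exists v, a, [::], q; rewrite cats0.
have [v1 [b [u [q [-> h1 h2]]]]] := IH e.
by exists v1, b, (rcons u a), q; rewrite rcons_cat.
Qed.

(** * Projective presentations *)

Section ProjBasis.
Variables (B : bquiver) (n : nat) (ys : 'I_n -> Q0 B).

Lemma basis_elt_nz (t : 'I_#|{: proj_basis ys}|) :
  nzpath (ys (basis_elt t).1) (basis_elt t).2.
Proof. exact: valP (enum_val t). Qed.

Lemma basis_elt_inj (t t' : 'I_#|{: proj_basis ys}|) :
  (basis_elt t).1 = (basis_elt t').1 ->
  (basis_elt t).2 = (basis_elt t').2 :> seq (Q1 B) -> t = t'.
Proof.
move=> e1 e2; apply/enum_val_inj/val_inj; rewrite -!/(basis_elt _).
by case: (basis_elt t) (basis_elt t') e1 e2 => [i v] [j w] /= -> /val_inj->.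
Qed.

Lemma basis_elt_ex i v : admissible B -> nzpath (ys i) v ->
  exists t : 'I_#|{: proj_basis ys}|,
    (basis_elt t).1 = i /\ (basis_elt t).2 = v :> seq (Q1 B).
Proof.
move=> aB nz; have sv := nzpath_size aB nz.
pose x : 'I_n * #|Q1 B|.-bseq (Q1 B) := (i, Bseq sv).
have px : nzpath (ys x.1) x.2 by [].
exists (enum_rank (exist _ x px : proj_basis ys)).
by rewrite /basis_elt enum_rankK.
Qed.

End ProjBasis.

Local Open Scope ring_scope.

(** M has the matrices of the string module of the factor of C that begins at
    position y and has as many positions as M has dimensions.  Being stated
    entrywise, this makes no demand that dimensions be equal by computation. *)
Definition ivl_rep (k : fieldType) (B : bquiver) (M : rep k B) (C : word B)
    (y : nat) : Prop :=
  (forall x p q, vtx M x p q = ((p == q) && (vertex_at C (y + p) == x))%:R) /\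
  (forall a p q, arr M a p q = (nxt C.2 (y + p) a == Some (y + q)%N)%:R).

Section Radical.
Variables (k : fieldType) (B : bquiver) (n : nat) (ys : 'I_n -> Q0 B).
Hypothesis aB : admissible B.
Local Notation P := (proj_rep k ys).

Lemma proj_arrE a (t t' : 'I_(rdim P)) :
  arr P a t t' = (((basis_elt t).1 == (basis_elt t').1) &&
     ((basis_elt t').2 == rcons (basis_elt t).2 a :> seq (Q1 B)))%:R.
Proof. by rewrite mxE; case: (basis_elt t) => ? ?; case: (basis_elt t'). Qed.

Lemma proj_vtxE x (t t' : 'I_(rdim P)) :
  vtx P x t t' = ((t == t') && (path_end (ys (basis_elt t).1) (basis_elt t).2 == x))%:R.
Proof. by rewrite mxE; case: (basis_elt t). Qed.

Lemma delta_sub_radical (t : 'I_(rdim P)) :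
  (basis_elt t).2 != [::] :> seq (Q1 B) ->
  (delta_mx (0 : 'I_1) t <= radical P)%MS.
Proof.
move=> vn; have [v [a e]] : exists v a, (basis_elt t).2 = rcons v a :> seq (Q1 B).
  by case/lastP: (bseqval (basis_elt t).2) vn => // v a _; exists v, a.
have := basis_elt_nz t; rewrite e -cats1 => /nzpath_cat[nz _].
have [t' [e1 e2]] := basis_elt_ex aB nz.
apply: (submx_trans (B := arr P a)); last first.
  by rewrite /radical (sumsmx_sup a) // genmxE.
suff -> : delta_mx 0 t = row t' (arr P a) by apply: row_sub.
apply/rowP => t2; rewrite !mxE -/(basis_elt _) eqxx /=.
have := proj_arrE a t' t2; rewrite mxE => ->; rewrite e1 e2 -e.
congr (nat_of_bool _)%:R; apply/eqP/andP => [->//|[/eqP h1 /eqP h2]].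
by apply: basis_elt_inj; rewrite ?h1 ?h2.
Qed.

(** A row belongs to the radical as soon as its coordinates at the generators
    vanish, as each longer path is the product of a path by an arrow. *)
Lemma sub_radical m (U : 'M_(m, rdim P)) :
  (forall i t, (basis_elt t).2 = [::] :> seq (Q1 B) -> U i t = 0) ->
  (U <= radical P)%MS.
Proof.
move=> h; apply/row_subP => i; rewrite (row_sum_delta (row i U)).
apply: summx_sub => t _; rewrite mxE.
have [e|ne] := eqVneq (bseqval (basis_elt t).2) [::].
  by rewrite h // scale0r sub0mx.
by rewrite scalemx_sub // delta_sub_radical.
Qed.

End Radical.

Lemma proj_mapE (k : fieldType) (B : bquiver) (m n : nat)
    (xs : 'I_m -> Q0 B) (ys : 'I_n -> Q0 B) (c : 'I_m -> 'I_n -> seq (Q1 B) -> k) r t :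
  proj_map xs ys c r t =
    let w := (basis_elt r).2 in let v := (basis_elt t).2 in
    let u := take (size v - size w) v in
    if suffix w v && (path_end (ys (basis_elt t).1) u == xs (basis_elt r).1)
    then c (basis_elt r).1 (basis_elt t).1 u else 0.
Proof. by rewrite mxE; case: (basis_elt r) => ? ?; case: (basis_elt t). Qed.

(** ** The cokernel of the map attached to a zigzag *)

(** The maps pp and vp enumerate the peaks and the valleys.  The signs of c are
    such that a valley is sent to a difference of paths; reversing the roles of
    peaks and valleys changes e into - e. *)
Section Cokernel.
Variables (k : fieldType) (B : bquiver) (C : word B) (w0 w1 : nat) (ty : bool -> bool).
Hypotheses (gB : locally_gentle B) (sC : is_string C) (zz : zigzag C w0 w1 ty).
Variables (n m : nat) (pp : 'I_n -> nat) (vp : 'I_m -> nat).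
Variables (ys : 'I_n -> Q0 B) (xs : 'I_m -> Q0 B) (e : k).
Variable (c : 'I_m -> 'I_n -> seq (Q1 B) -> k).
Hypotheses (pp_inj : injective pp) (vp_inj : injective vp).
Hypothesis ppP : forall p, (exists i, pp i = p) <-> inW w0 w1 p /\ extr C.2 true p.
Hypothesis vpP : forall p,
  (exists j, vp j = p) <-> [/\ (w0 < w1)%N, inW w0 w1 p & extr C.2 false p].
Hypotheses (ysE : forall i, ys i = vertex_at C (pp i))
           (xsE : forall j, xs j = vertex_at C (vp j)).
Hypothesis e0 : e != 0.
Hypothesis cE : forall j i u,
  c j i u = if run C.2 (pp i) u == Some (vp j) then (if pp i < vp j then e else - e)%N else 0.
Variable M : rep k B.
Local Notation s := C.2.
Local Notation a0 := (y0 w0 ty).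
Local Notation a1 := (y1 C w1 ty).
Hypothesis Mivl : ivl_rep M C a0.
Hypothesis Mdim : rdim M = (a1 - a0).+1.
Hypothesis a01 : (a0 <= a1)%N.

Local Notation P0 := (proj_rep k ys).
Local Notation P1 := (proj_rep k xs).
Local Notation f := (proj_map xs ys c).
Let aB : admissible B. Proof. by case: gB. Qed.

Let top (t : 'I_(rdim P0)) := pp (basis_elt t).1.
Let pth (t : 'I_(rdim P0)) : seq (Q1 B) := (basis_elt t).2.
Let bot (r : 'I_(rdim P1)) := vp (basis_elt r).1.
Let tl (r : 'I_(rdim P1)) : seq (Q1 B) := (basis_elt r).2.

(** The generator at a peak goes to the basis vector of M at this peak. *)
Definition zz_cover : 'M[k]_(rdim P0, rdim M) :=
  \matrix_(t, q) (run s (pp (basis_elt t).1) (basis_elt t).2 == Some (a0 + q)%N)%:R.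
Local Notation g := zz_cover.

Let top_W t : inW w0 w1 (top t).
Proof. by have [] : inW w0 w1 (top t) /\ extr s true (top t) by apply/ppP; exists (basis_elt t).1. Qed.

Let top_pk t : extr s true (top t).
Proof. by have [] : inW w0 w1 (top t) /\ extr s true (top t) by apply/ppP; exists (basis_elt t).1. Qed.

Let botP r : [/\ (w0 < w1)%N, inW w0 w1 (bot r) & extr s false (bot r)].
Proof. by apply/vpP; exists (basis_elt r).1. Qed.

Let pth_nz t : nzpath (vertex_at C (top t)) (pth t).
Proof. by rewrite -ysE; apply: basis_elt_nz. Qed.

Let ex_t p v q : inW w0 w1 p -> extr s true p -> run s p v = Some q ->
  exists t, top t = p /\ pth t = v.
Proof.
move=> Wp pk h; have [i pi] := (ppP p).2 (conj Wp pk).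
have [nz _] := run_nzpath sC h; rewrite -pi -ysE in nz.
by have [t [e1 e2]] := basis_elt_ex aB nz; exists t; rewrite /top e1 /pth e2.
Qed.

Let ex_r q w : (w0 < w1)%N -> inW w0 w1 q -> extr s false q ->
  nzpath (vertex_at C q) w -> exists r, bot r = q /\ tl r = w.
Proof.
move=> w01 Wq vq nz; have [j vj] := (vpP q).2 (And3 w01 Wq vq).
rewrite -vj -xsE in nz.
by have [t [e1 e2]] := basis_elt_ex aB nz; exists t; rewrite /bot e1 /tl e2.
Qed.

Let yrange (q : 'I_(rdim M)) : (a0 <= a0 + q <= a1)%N.
Proof. by have := ltn_ord q; rewrite {2}Mdim; move: a01; clear; lia. Qed.

Let in_yrange q : (a0 <= q <= a1)%N -> exists q' : 'I_(rdim M), q = (a0 + q')%N.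
Proof.
move=> h; have lt : (q - a0 < rdim M)%N by rewrite Mdim; move: h; clear; lia.
by exists (Ordinal lt) => /=; move: h; clear; lia.
Qed.

(** The nonzero coefficients of f: the path of t runs from its peak down to the
    valley of r and continues by the path of r. *)
Let hit r t := exists2 u, pth t = u ++ tl r & run s (top t) u = Some (bot r).

Let sgn r t : k := if (top t < bot r)%N then e else - e.

Let sgn_neq0 r t : sgn r t != 0.
Proof. by rewrite /sgn; case: ifP; rewrite ?oppr_eq0. Qed.

Let fE r t : (hit r t /\ f r t = sgn r t) \/ (~ hit r t /\ f r t = 0).
Proof.
rewrite proj_mapE /= -/(pth t) -/(tl r) cE -/(top t) -/(bot r) -/(sgn r t).
case: suffixP => [[u eu]|nu] /=; last first.
  by right; split=> // -[u eu _]; apply: nu; exists u.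
have -> : take (size (pth t) - size (tl r)) (pth t) = u.
  by rewrite {}eu size_cat addnK take_size_cat.
case: (run s (top t) u =P _) => h; last first.
  right; rewrite if_same; split=> // -[u' eu' h'].
  have su : size u = size u'.
    by apply/eqP; rewrite -(eqn_add2r (size (tl r))) -!size_cat -eu -eu'.
  have := eu'; rewrite eu => /eqP; rewrite eqseq_cat //.
  by case/andP=> /eqP eu2; rewrite -eu2 in h'.
left; split; first by exists u.
by rewrite ysE xsE; have [_ ->] := run_nzpath sC h; rewrite eqxx.
Qed.

(** A nontrivial continuation determines the arrow before it, hence the side from
    which the valley is reached. *)
Let hit_cases r t t' : hit r t -> hit r t' ->
  t = t' \/ tl r = [::] /\ (top t < bot r)%N = ~~ (top t' < bot r)%N.
Proof.
move=> [u eu hu] [u' eu' hu'].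
case: (peak_run_inj sC (top_pk t) (top_pk t') hu hu') => [[e1 e2]|].
  left; apply: basis_elt_inj; first by apply: pp_inj.
  by rewrite -/(pth t) -/(pth t') eu eu' e2.
move=> [_ [d [a [a2 [v [v2 [h1 h2 ev ev2]]]]]]]; right; split; last first.
  have r1 := hu; have r2 := hu'; rewrite ev in r1; rewrite ev2 in r2.
  have D1 := run_dir sC r1 h1; have := run_dir sC (d := ~~ d) r2.
  by rewrite negbK => /(_ h2); move: D1; clear; case: d => /=; lia.
case ew: (tl r) => [|b w] //; exfalso.
have := pth_nz t; have := pth_nz t'; rewrite eu eu' ew ev ev2.
rewrite -!cats1 -!catA => /nzpath_cat[_ /=] nz' /nzpath_cat[_ /=] nz.
have h3 := out_tgt sC h1; have h4 := out_tgt sC h2.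
move: nz nz'; rewrite !nzpathE /= => /andP[_ /andP[s1 _]] /andP[_ /andP[s2 _]].
have {s1}s1 : follows (a, true) (b, true) by rewrite followsDD.
have {s2}s2 : follows (a2, true) (b, true) by rewrite followsDD.
have [e3] := follows_injl gB s1 s2 erefl.
by rewrite e3 in h1; apply: (out_neq sC h1); rewrite negbK.
Qed.

Let single_sub r t : hit r t -> (forall t', hit r t' -> t' = t) ->
  (delta_mx (0 : 'I_1) t <= f)%MS.
Proof.
move=> h1 h2; have -> : delta_mx 0 t = (sgn r t)^-1 *: row r f.
  apply/rowP => t'; rewrite !mxE eqxx /=.
  rewrite -[X in _ = _ * X]/(_); have := fE r t'; rewrite mxE => -[[h ->]|[h ->]].
    by rewrite (h2 _ h) eqxx mulVf.
  by rewrite mulr0; case: eqP => // tt; case: h; rewrite tt.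
by rewrite scalemx_sub // row_sub.
Qed.

Let double_sub r t t' : hit r t -> hit r t' -> t != t' ->
  (delta_mx (0 : 'I_1) t - delta_mx 0 t' <= f)%MS.
Proof.
move=> h1 h2 tt.
have [//|[tl0 opp]] := hit_cases h1 h2; first by move/eqP; rewrite (negPf tt).
have -> : delta_mx 0 t - delta_mx 0 t' = (sgn r t)^-1 *: row r f.
  apply/rowP => t2; rewrite !mxE eqxx /=.
  have := fE r t2; rewrite mxE => -[[h ->]|[h ->]]; last first.
    rewrite mulr0; case: eqP => [e1|_]; first by case: h; rewrite e1.
    by case: eqP => [e1|_]; rewrite ?subr0 //; case: h; rewrite e1.
  case: (hit_cases h h1) => [->|[_ o1]]; first by rewrite eqxx (negPf tt) subr0 mulVf.
  case: (hit_cases h h2) => [->|[_ o2]]; last first.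
    by exfalso; move: o2; rewrite o1 opp; case: (_ < _)%N.
  rewrite eqxx eq_sym (negPf tt) sub0r /sgn opp.
  by case: (top t' < bot r)%N => /=; rewrite ?invrN ?mulNr ?mulrN mulVf.
by rewrite scalemx_sub // row_sub.
Qed.

Let gE t q : g t q = (run s (top t) (pth t) == Some (a0 + q)%N)%:R.
Proof. by rewrite mxE. Qed.

Let g_hom : is_hom (M := P0) (N := M) g.
Proof.
have [Mv Ma] := Mivl; split=> [x|a]; apply/matrixP => t q; rewrite mxE [RHS]mxE.
  rewrite (bigD1 t) //= big1 => [|t' tt]; last first.
    by rewrite proj_vtxE eq_sym (negPf tt) mul0r.
  rewrite [RHS](bigD1 q) //= [X in _ = _ + X]big1 => [|q' qq]; last first.
    by rewrite Mv (negPf qq) mulr0.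
  rewrite !addr0 proj_vtxE Mv !eqxx /= gE.
  case: (run s _ _ =P _) => h; rewrite ?mulr0 ?mul0r // mulr1 mul1r.
  by have [_ <-] := run_nzpath sC h; rewrite ysE.
have -> : \sum_j g t j * arr M a j q = (run s (top t) (rcons (pth t) a) == Some (a0 + q)%N)%:R.
  rewrite run_rcons; case h: (run s (top t) (pth t)) => [r|] /=; last first.
    by rewrite big1 // => j _; rewrite gE h mul0r.
  case ry: (a0 <= r <= a1)%N.
    have [r' rr] := in_yrange ry; rewrite (bigD1 r') //= big1 => [|j jr].
      by rewrite gE h rr eqxx mul1r addr0 Ma.
    by rewrite gE h rr (inj_eq Some_inj) eqn_add2l (inj_eq val_inj) eq_sym (negPf jr) mul0r.
  rewrite big1 => [|j _]; last first.
    rewrite gE h; case: eqP => [[rj]|]; rewrite ?mul0r //.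
    by rewrite rj yrange in ry.
  case: eqP => // h2; by rewrite (nxt_enter sC zz h2) ?yrange in ry.
case h: (run s (top t) (rcons (pth t) a) == _).
  have [t' [t1 t2]] := ex_t (top_W t) (top_pk t) (eqP h).
  rewrite (bigD1 t') //= big1 => [|t2' tt].
    rewrite proj_arrE -/(pth t') -/(pth t) t2 eqxx (pp_inj t1) eqxx /= mul1r addr0.
    by rewrite gE t1 t2 h.
  rewrite proj_arrE; case: andP => [[/eqP h1 /eqP h2]|]; rewrite ?mul0r //.
  case/eqP: tt; apply: basis_elt_inj; last by rewrite h2 -/(pth t) -t2.
  by rewrite -h1; apply/pp_inj/esym.
rewrite big1 // => t' _; rewrite proj_arrE; case: andP => [[/eqP h1 /eqP h2]|]; rewrite ?mul0r //.
by rewrite gE /top /pth -h1 h2 -/(top t) -/(pth t) h mulr0.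
Qed.

Let bot_tl_run r t q : hit r t -> run s (top t) (pth t) = Some q ->
  tl r = [::] /\ q = bot r.
Proof.
move=> [u -> hu]; rewrite run_cat hu /= => h; have [_ _ vr] := botP r.
have e1 := run_valley sC vr h; split=> //.
by move: h; rewrite e1 => -[].
Qed.

(** At a valley inside M the two paths from the neighbouring peaks cancel, and
    everything else is sent to zero in M. *)
Let fg0 : f *m g = 0.
Proof.
apply/matrixP => r q; rewrite mxE [RHS]mxE.
have [w01 Wr vr] := botP r.
have [/andP[/eqP w0' /eqP rq]|nq] := boolP ((tl r == [::]) && (bot r == a0 + q)%N); last first.
  apply: big1 => t _; case: (fE r t) => -[h ->]; rewrite ?mul0r // gE.
  case: eqP => h2; rewrite ?mulr0 //.
  by have [h3 h4] := bot_tl_run h h2; rewrite h3 h4 !eqxx in nq.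
have br := yrange q; rewrite -rq in br.
have ins := valley_inside zz w01 Wr br vr.
have ht d : exists t, [/\ hit r t, run s (top t) (pth t) = Some (a0 + q)%N
    & (if d then bot r < top t else top t < bot r)%N].
  have [p [v [h1 h2 h3 h4]]] := valley_reached sC zz d ins vr.
  have [t [t1 t2]] := ex_t h1 h2 h3; exists t; split.
  - by exists (pth t); rewrite ?w0' ?cats0 ?t1 ?t2.
  - by rewrite t1 t2 -rq.
  - by rewrite t1.
have [t [t1 t2 t3]] := ht true; have [t' [t1' t2' t3']] := ht false.
have t3n : (top t < bot r)%N = false by rewrite ltnNge (ltnW t3).
have tt : t' != t by apply/eqP => tt; move: t3 t3'; rewrite tt; clear; lia.
rewrite (bigD1 t) //= (bigD1 t') //= big1 => [|t4 /andP[n1 n2]]; last first.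
  case: (fE r t4) => -[h ->]; rewrite ?mul0r //.
  have [e1|[_ o1]] := hit_cases h t1; first by rewrite e1 eqxx in n1.
  have [e1|[_ o2]] := hit_cases h t1'; first by rewrite e1 eqxx in n2.
  by move: o1 o2; rewrite t3' t3n /= => ->.
rewrite !gE t2 t2' eqxx !mulr1 addr0.
case: (fE r t) => -[h ->]; last by case: h.
case: (fE r t') => -[h' ->]; last by case: h'.
by rewrite /sgn t3' t3n addNr.
Qed.

Let section_ex : exists phi : 'I_(rdim M) -> 'I_(rdim P0),
  forall q, run s (top (phi q)) (pth (phi q)) = Some (a0 + q)%N.
Proof.
have h (q : 'I_(rdim M)) : exists t, run s (top t) (pth t) = Some (a0 + q)%N; last first.
  by have [phi hphi] := fin_all_exists h; exists phi.
have [p [v [h1 h2 h3]]] := reached sC zz (yrange q).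
by have [t [t1 t2]] := ex_t h1 h2 h3; exists t; rewrite t1 t2.
Qed.

(** A linear section of g; the kernel of g is spanned by the differences between
    basis vectors and their images under g followed by the section. *)
Let lift_mx (phi : 'I_(rdim M) -> 'I_(rdim P0)) : 'M[k]_(rdim M, rdim P0) :=
  \matrix_(q, t) (t == phi q)%:R.

(** A path that leaves the string does so at a valley, and up to sign it is the
    image of a multiple of the valley's generator, the other term being zero.  A
    path that ends outside M ends at an extreme valley, which is reached from one
    peak only.  Otherwise the two representatives of a position of M either
    coincide or differ, up to sign, by the image of a valley. *)
Let in_image (phi : 'I_(rdim M) -> 'I_(rdim P0)) (t : 'I_(rdim P0)) :
  (forall q : 'I_(rdim M), run s (top (phi q)) (pth (phi q)) = Some (a0 + q)%N) ->
  (delta_mx (0 : 'I_1) t - row t (g *m lift_mx phi) <= f)%MS.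
Proof.
move=> phiP; rewrite row_mul.
case h: (run s (top t) (pth t)) => [r|]; last first.
  have -> : row t g = 0 by apply/rowP => q; rewrite !mxE -/(top t) -/(pth t) h.
  rewrite mul0mx subr0.
  have [v1 [a [u [q [ev h1 h2]]]]] := run_none h.
  have := pth_nz t; rewrite ev => nz; have [nz1 _] := nzpath_cat nz.
  have [w01 Wq vq] := dead_end gB sC zz (top_W t) (top_pk t) h1 h2 nz1.
  rewrite cat_rcons in ev nz; have [_ nz2] := nzpath_cat nz.
  have [_ e1] := run_nzpath sC h1; rewrite e1 in nz2.
  have [x [x1 x2]] := ex_r w01 Wq vq nz2.
  have ht : hit x t by exists v1; rewrite ?x1 ?x2.
  apply: (single_sub ht) => t' ht'.
  by case: (hit_cases ht' ht) => // -[]; rewrite x2.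
case ry: (a0 <= r <= a1)%N; last first.
  have -> : row t g = 0.
    apply/rowP => q; rewrite !mxE -/(top t) -/(pth t) h; case: eqP => // -[e1].
    by rewrite e1 yrange in ry.
  rewrite mul0mx subr0.
  have [d [w01 rb vr]] := run_outside sC zz (top_W t) h (negbT ry).
  have w01' := zz_le zz.
  have Wr : inW w0 w1 r by rewrite /inW rb; move: w01'; clear; case: (d); lia.
  have [x [x1 x2]] : exists x, bot x = r /\ tl x = [::] by apply: ex_r.
  have ht : hit x t by exists (pth t); rewrite ?x1 ?x2 ?cats0.
  apply: (single_sub ht) => t' ht'.
  case: (hit_cases ht' ht) => // -[_]; rewrite x1 rb => h3.
  have nt u : top u != r.
    by apply/eqP => e1; apply: (extr_disjoint sC zz w01 (top_W u) (top_pk u)); rewrite e1.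
  have := nt t; have := nt t'; have := top_W t; have := top_W t'; move: h3; rewrite rb /inW.
  by clear; case: (d); lia.
have [q rq] := in_yrange ry.
have -> : row t g = delta_mx 0 q.
  apply/rowP => q'; rewrite !mxE -/(top t) -/(pth t) h rq (inj_eq Some_inj).
  by rewrite eqn_add2l (inj_eq val_inj) eq_sym.
rewrite -rowE.
have -> : row q (lift_mx phi) = delta_mx 0 (phi q).
  by apply/rowP => t'; rewrite !mxE eqxx.
have [->|tt] := eqVneq t (phi q); first by rewrite subrr sub0mx.
have h' := phiP q; rewrite -rq in h'.
case: (peak_run_inj sC (top_pk t) (top_pk (phi q)) h h') => [[e1 e2]|].
  by case/eqP: tt; apply: basis_elt_inj => //; apply: pp_inj.
move=> [vr [d [a [a2 [v [v2 [h1 h2 ev ev2]]]]]]].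
have dd : if d then (top t < r < top (phi q))%N else (top (phi q) < r < top t)%N.
  have r1 := h; have r2 := h'; rewrite ev in r1; rewrite ev2 in r2.
  have D1 := run_dir sC r1 h1; have := run_dir sC (d := ~~ d) r2.
  by rewrite negbK => /(_ h2); move: D1; clear; case: d => /=; lia.
have Ws : inW w0 w1 r /\ (w0 < w1)%N.
  by have := top_W t; have := top_W (phi q); move: dd; rewrite /inW; clear; case: (d); lia.
have [x [x1 x2]] : exists x, bot x = r /\ tl x = [::] by case: Ws => ? ?; apply: ex_r.
apply: (@double_sub x) => //; first by exists (pth t); rewrite ?x1 ?x2 ?cats0.
by exists (pth (phi q)); rewrite ?x1 ?x2 ?cats0.
Qed.

Lemma zz_cokernel : is_cokernel f g.
Proof.
have [phi phiP] := section_ex.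
pose S := lift_mx phi.
split; first exact: g_hom.
  apply/row_fullP; exists S; apply/matrixP => q q'; rewrite !mxE.
  rewrite (bigD1 (phi q)) //= big1 => [|t tt]; last by rewrite mxE (negPf tt) mul0r.
  rewrite mxE eqxx mul1r addr0 gE phiP (inj_eq Some_inj) eqn_add2l.
  by rewrite (inj_eq val_inj).
apply/andP; split; first by apply/sub_kermxP/fg0.
have -> : kermx g = kermx g *m (1%:M - g *m S).
  by rewrite mulmxBr mulmx1 mulmxA mulmx_ker mul0mx subr0.
apply: mulmx_sub; apply/row_subP => t; rewrite linearB /= row1.
exact: in_image.
Qed.

Lemma zz_min0 : (kermx g <= radical P0)%MS.
Proof.
have [_ _ /andP[_ h]] := zz_cokernel; apply: (submx_trans h).
apply: sub_radical aB _ _ _ => r t h0; case: (fE r t) => -[ht ->] //.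
case: ht => u; rewrite /pth h0; case: u => // _ [h1].
have [w01 Wr vr] := botP r.
by case: (extr_disjoint sC zz w01 Wr _ vr); rewrite -h1.
Qed.

(** For each valley some coordinate of the image sees its generator only, because
    no path runs on from a valley. *)
Lemma zz_min1 : (kermx f <= radical P1)%MS.
Proof.
apply: sub_radical aB _ _ _ => i r h0.
have [w01 Wr vr] := botP r.
have [p [v [h1 h2 h3]]] := valley_has_peak sC zz w01 Wr vr.
have [t [t1 t2]] := ex_t h1 h2 h3; rewrite -t1 -t2 in h3.
have : (kermx f *m f) i t = 0 by rewrite mulmx_ker mxE.
rewrite mxE (bigD1 r) //= big1 => [|r' rr]; last first.
  case: (fE r' t) => -[h ->]; rewrite ?mulr0 //.
  have [e1 e2] := bot_tl_run h h3; case/eqP: rr; apply: basis_elt_inj.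
    by apply: vp_inj; rewrite -/(bot r') -e2.
  by rewrite -/(tl r') e1 h0.
have ht : hit r t by exists (pth t); rewrite /tl ?h0 ?cats0.
case: (fE r t) => -[h ->]; last by case: h.
by rewrite addr0 => /eqP; rewrite mulf_eq0 (negPf (sgn_neq0 _ _)) orbF => /eqP.
Qed.

End Cokernel.

Local Close Scope ring_scope.

(** * Duality and the Auslander-Reiten translate *)

Lemma locally_gentle_bop (B : bquiver) : locally_gentle B -> locally_gentle (bop B).
Proof.
move=> [[rc [N hN]] deg cont rels]; split.
- split; first by move=> b a /= /rc; rewrite /composable /= eq_sym.
  exists N => w sw Nw; have := hN (rev w); rewrite size_rev /in_ideal !rev_sorted.
  apply=> //; apply: sub_sorted sw => a b; by rewrite /composable /= eq_sym.
- by move=> x; have [h1 h2] := deg x; split.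
- move=> a; have [h1 h2] := cont a; split.
    apply: leq_trans h2; apply/subset_leq_card/subsetP => b; rewrite !inE /composable /=.
    by rewrite eq_sym.
  apply: leq_trans h1; apply/subset_leq_card/subsetP => b; rewrite !inE /composable /=.
  by rewrite eq_sym.
- move=> a; have [h1 h2] := rels a; split.
    apply: leq_trans h2; apply/subset_leq_card/subsetP => b; rewrite !inE /composable /=.
    by rewrite eq_sym.
  apply: leq_trans h1; apply/subset_leq_card/subsetP => b; rewrite !inE /composable /=.
  by rewrite eq_sym.
Qed.

(** The same string over the opposite quiver: traversed in the same direction,
    each arrow is now met against its orientation. *)
Definition flip (B : bquiver) (C : word B) : word (bop B) := (C.1, map (@linv B) C.2).

Section Flip.
Variables (B : bquiver) (C : word B).
Local Notation s := C.2.
Local Notation s' := (flip C).2.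

Lemma out_flip d p : out s' d p = omap (@linv B) (out s d p).
Proof.
case: d; first by rewrite /out onth_map.
by case: p => // p; rewrite /out onth_map; case: (onth s p).
Qed.

Lemma out_flipP d p (l : letter (bop B)) :
  out s' d p = Some l -> out s d p = Some (@linv B l).
Proof. by rewrite out_flip => /omap_linvP. Qed.

Lemma follows_flip (l m : letter B) :
  @follows (bop B) (@linv B l) (@linv B m) = follows l m.
Proof.
rewrite /follows; case: l m => [a []] [b []];
by rewrite /lsrc /ltgt /linv /direct /= ?andbT ?andbF //= ?andbT !xpair_eqE.
Qed.

Lemma vertex_at_flip p : vertex_at (flip C) p = vertex_at C p.
Proof.
rewrite /vertex_at /= -map_take -map_comp; congr last.
by apply: eq_map => -[a []].
Qed.

Hypothesis sC : is_string C.

Lemma is_string_flip : is_string (flip C).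
Proof.
have [h1 h2] := is_stringP sC; apply/is_stringP; split.
  by move=> l /(@out_flipP true 0)/h1 h; rewrite [RHS]/= -h; case: (l) => ? [].
move=> p l m /(@out_flipP true p) e /(@out_flipP true p.+1) e'.
by rewrite -[l](@linvK B) -[m](@linvK B) follows_flip; apply: h2 e e'.
Qed.

Lemma extr_flip b p : extr s' b p = extr s (~~ b) p.
Proof.
apply: eq_all => d; rewrite out_flip; case: (out s d p) => [[a c]|] //=.
by case: b c => [] [].
Qed.

Lemma nxt_flip (p q : nat) a : (nxt s' q a == Some p) = (nxt s p a == Some q).
Proof.
apply/eqP/eqP => [/(nxtP is_string_flip)|/(nxtP sC)] [d h ->].
  have := out_mv (out_flipP h); rewrite linvK => h2.
  by apply/(nxtP sC); exists (~~ d) => //; rewrite (mvK h).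
apply/(nxtP is_string_flip); exists (~~ d); last by rewrite (mvK h).
by rewrite out_flip (out_mv h).
Qed.

Lemma run_flip (p q : nat) w : run s' q w = Some p <-> run s p (rev w) = Some q.
Proof.
elim: w p q => [|a w IH] p q; first by split=> -[->].
rewrite run_cons rev_cons run_rcons.
split.
  case e: (nxt s' q a) => [r|] //= /IH -> /=; apply/eqP; rewrite -nxt_flip; exact/eqP.
case e: (run s p (rev w)) => [r|] //= /eqP; rewrite -nxt_flip => /eqP -> /=.
exact/IH.
Qed.

Lemma zigzag_flip w0 w1 ty : (w0 < w1)%N -> zigzag C w0 w1 ty ->
  zigzag (flip C) w0 w1 (fun d => ~~ ty d).
Proof.
move=> w01 zz; split.
- exact: zz_le zz.
- by rewrite size_map; apply: zz_size zz.
- by [].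
- by move=> d p l pw /out_flipP h; rewrite -(zz_out zz pw h) negbK.
- by move=> d l _ /out_flipP h; rewrite -(zz_in zz w01 h) negbK.
move=> d l hl; rewrite vertex_at_flip size_map => hs.
have h1 : (@linv B l).2 = ~~ ty d by rewrite /= hl negbK.
have h2 : lsrc (@linv B l) = vertex_at C (if d then size s else 0).
  by rewrite -hs; case: (l) => ? [].
have [m hm nf] := zz_max zz h1 h2.
exists (@linv B m); first by rewrite out_flip hm.
by rewrite -[l](@linvK B) follows_flip.
Qed.

Lemma ivl_dual (k : fieldType) (N : rep k B) y :
  ivl_rep N C y -> ivl_rep (dual_rep N) (flip C) y.
Proof.
move=> [h1 h2]; split=> [x p q|a p q]; rewrite mxE.
  by rewrite h1 vertex_at_flip eq_sym; case: eqP => [->|].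
by rewrite h2 nxt_flip.
Qed.

End Flip.

(** Two valleys are never adjacent: the letter between them would have to be both
    direct and inverse. *)
Lemma zz_ylen (B : bquiver) (C : word B) w0 w1 ty :
  zigzag C w0 w1 ty -> (y0 w0 ty <= y1 C w1 ty)%N.
Proof.
move=> zz; have w01 := zz_le zz; have wN := zz_size zz; rewrite /y0 /y1.
case t0: (ty false); case t1: (ty true) => //.
- have lt := zz_add zz t0; have := zz_in zz lt (d := false); have := zz_in zz lt (d := true).
  rewrite t0 t1 /= => h1 h2; case: (ltnP w0.+1 w1) => [|h3]; first by clear; lia.
  have e : w1 = w0.+1 by move: h3 lt; clear; lia.
  case e2: (onth C.2 w0) => [l|]; last by have := onthTE C.2 w0; rewrite e2 (leq_trans lt wN).
  have := h1 (linv l); rewrite e e2 => /(_ erefl); have := h2 _ e2.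
  by rewrite /= => ->.
- by have := zz_add zz t0; move: wN; clear; lia.
Qed.

Lemma enum_positions (P : pred nat) (N : nat) : exists (n : nat) (pp : 'I_n -> nat),
  injective pp /\ forall p, (exists i, pp i = p) <-> (p <= N)%N && P p.
Proof.
pose t := [seq p <- iota 0 N.+1 | P p].
have ut : uniq t by rewrite filter_uniq ?iota_uniq.
exists (size t), (fun i => nth 0 t i)%N; split.
  by move=> i j /eqP; rewrite nth_uniq // => /eqP /val_inj.
move=> p; have -> : (p <= N)%N && P p = (p \in t) by rewrite mem_filter mem_iota add0n ltnS andbC.
split=> [[i <-]|h]; first by rewrite mem_nth.
have lt : (index p t < size t)%N by rewrite index_mem.
by exists (Ordinal lt); rewrite nth_index.
Qed.

Local Open Scope ring_scope.

Section Tau.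
Variables (k : fieldType) (B : bquiver) (C : word B) (w0 w1 : nat) (ty : bool -> bool).
Hypotheses (gB : locally_gentle B) (sC : is_string C) (zz : zigzag C w0 w1 ty).
Variable M : rep k B.
Hypothesis Mivl : ivl_rep M C (y0 w0 ty).
Hypothesis Mdim : rdim M = (y1 C w1 ty - y0 w0 ty).+1.

Lemma extr_positions b : exists (n : nat) (pp : 'I_n -> nat), injective pp /\
  forall p, (exists i, pp i = p) <-> inW w0 w1 p /\ extr C.2 b p.
Proof.
have [n [pp [inj h]]] := enum_positions (fun p => inW w0 w1 p && extr C.2 b p) (size C.2).
exists n, pp; split=> // p; rewrite h; split; first by case/and3P.
case=> h1 h2; rewrite h1 h2 !andbT; have := zz_size zz; move: h1; rewrite /inW; clear; lia.
Qed.

(** The flipped string is a zigzag with peaks and valleys exchanged, and the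
    transpose of the presentation is its map with the opposite sign. *)
Lemma tau_zigzag (N : rep k B) : (w0 < w1)%N ->
  ivl_rep N C (y0 w0 (fun d => ~~ ty d)) ->
  rdim N = (y1 C w1 (fun d => ~~ ty d) - y0 w0 (fun d => ~~ ty d)).+1 -> is_tau M N.
Proof.
move=> w01 Nivl Ndim.
have [n [pp [pp_inj ppP]]] := extr_positions true.
have [m [vp [vp_inj vpP]]] := extr_positions false.
pose ys i := vertex_at C (pp i); pose xs j := vertex_at C (vp j).
pose c (j : 'I_m) (i : 'I_n) (u : seq (Q1 B)) : k :=
  if run C.2 (pp i) u == Some (vp j) then (if (pp i < vp j)%N then 1 else - 1) else 0.
have vpP' p : (exists j, vp j = p) <-> [/\ (w0 < w1)%N, inW w0 w1 p & extr C.2 false p].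
  by rewrite vpP; split=> [[]|[]].
have ysE i : ys i = vertex_at C (pp i) by [].
have xsE j : xs j = vertex_at C (vp j) by [].
have cE j i u : c j i u = if run C.2 (pp i) u == Some (vp j)
  then (if (pp i < vp j)%N then 1 else - 1) else 0 by [].
have k1 := oner_neq0 k; have ylen := zz_ylen zz.
have cok := zz_cokernel gB sC zz pp_inj ppP vpP' ysE xsE k1 cE Mivl Mdim ylen.
have min0 := zz_min0 gB sC zz pp_inj ppP vpP' ysE xsE k1 cE Mivl Mdim ylen.
have min1 := zz_min1 gB sC zz vp_inj ppP vpP' ysE xsE k1 cE.
have zz' := zigzag_flip w01 zz.
have ppP' p : (exists j, pp j = p) <->
    [/\ (w0 < w1)%N, inW w0 w1 p & extr (flip C).2 false p].
  by rewrite ppP extr_flip; split=> [[]|[]].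
have vpP2 p : (exists j, vp j = p) <-> inW w0 w1 p /\ extr (flip C).2 true p.
  by rewrite vpP extr_flip.
have cE' i j u : transp c i j u = if run (flip C).2 (vp j) u == Some (pp i)
    then (if (vp j < pp i)%N then - 1 else - - 1) else 0.
  rewrite /transp /c; have -> : (run (flip C).2 (vp j) u == Some (pp i)) =
      (run C.2 (pp i) (rev u) == Some (vp j)) by apply/eqP/eqP; rewrite run_flip.
  case: eqP => // _; have ne : pp i != vp j.
    apply/eqP => e; have [h1 h2] : inW w0 w1 (pp i) /\ extr C.2 true (pp i) by apply/ppP; exists i.
    have [_ h3] : inW w0 w1 (vp j) /\ extr C.2 false (vp j) by apply/vpP; exists j.
    by apply: (extr_disjoint sC zz w01 h1 h2); rewrite e.
  by rewrite opprK; move: ne; case: (ltngtP (pp i) (vp j)).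
have ysE' i : ys i = vertex_at (flip C) (pp i) by rewrite vertex_at_flip.
have xsE' j : xs j = vertex_at (flip C) (vp j) by rewrite vertex_at_flip.
have n10 : - 1 != 0 :> k by rewrite oppr_eq0 oner_neq0.
have y1E : y1 (flip C) w1 (fun d => ~~ ty d) = y1 C w1 (fun d => ~~ ty d).
  by rewrite /y1 size_map.
have Ndim' : rdim (dual_rep N) =
    (y1 (flip C) w1 (fun d => ~~ ty d) - y0 w0 (fun d => ~~ ty d)).+1 by rewrite y1E.
have cok' := zz_cokernel (locally_gentle_bop gB) (is_string_flip sC) zz' vp_inj
  vpP2 ppP' xsE' ysE' n10 cE' (ivl_dual sC Nivl) Ndim' (zz_ylen zz').
by exists m, n, xs, ys, c; do 2!eexists; split; [exact: cok|exact: min0|exact: min1|exact: cok'].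
Qed.

Lemma tau_zero : w0 = w1 -> is_tau M (zero_rep k B).
Proof.
move=> w01; have [n [pp [pp_inj ppP]]] := extr_positions true.
pose ys i := vertex_at C (pp i); pose vp (j : 'I_0) := 0%N; pose xs j := vertex_at C (vp j).
pose c (j : 'I_0) (i : 'I_n) (u : seq (Q1 B)) : k :=
  if run C.2 (pp i) u == Some (vp j) then (if (pp i < vp j)%N then 1 else - 1) else 0.
have vpP' p : (exists j, vp j = p) <-> [/\ (w0 < w1)%N, inW w0 w1 p & extr C.2 false p].
  by rewrite w01 ltnn; split=> [[[]]|[]].
have vp_inj : injective vp by case.
have ysE i : ys i = vertex_at C (pp i) by [].
have xsE j : xs j = vertex_at C (vp j) by [].
have cE j i u : c j i u = if run C.2 (pp i) u == Some (vp j)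
  then (if (pp i < vp j)%N then 1 else - 1) else 0 by [].
have k1 := oner_neq0 k; have ylen := zz_ylen zz.
have cok := zz_cokernel gB sC zz pp_inj ppP vpP' ysE xsE k1 cE Mivl Mdim ylen.
have min0 := zz_min0 gB sC zz pp_inj ppP vpP' ysE xsE k1 cE Mivl Mdim ylen.
have min1 := zz_min1 gB sC zz vp_inj ppP vpP' ysE xsE k1 cE.
exists 0%N, n, xs, ys, c; eexists; exists 0; split; [exact: cok|exact: min0|exact: min1|].
have no (t : 'I_(rdim (@proj_rep k (bop B) 0 xs))) : False by case: (basis_elt t).1.
split.
- by split=> ?; rewrite mulmx0 mul0mx.
- by rewrite /row_full eqn_leq rank_leq_col.
- apply/andP; split; apply/row_subP => i; last by case: (no i).
  have -> : row i (@proj_map k (bop B) n 0 ys xs (transp c)) = 0.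
    by apply/rowP => t; case: (no t).
  exact: sub0mx.
Qed.

End Tau.

Local Close Scope ring_scope.

(** * Kisses *)

Definition mvn (d : bool) (t p : nat) : nat := if d then p + t else p - t.

Lemma onth_factor (T : Type) (s : seq T) i n t : t < n ->
  onth (take n (drop i s)) t = onth s (i + t).
Proof.
move=> tn; rewrite !onthE map_take map_drop nth_take // nth_drop //.
Qed.

Lemma onth_rev (T : Type) (s : seq T) t : t < size s ->
  onth (rev s) t = onth s (size s - t.+1).
Proof. by move=> ts; rewrite !onthE map_rev nth_rev size_map. Qed.

Section Factors.
Variables (B : bquiver) (C : word B) (i j : nat).
Hypothesis ij : i <= j <= size C.2.

Lemma size_factor : size (factor C i j).2 = j - i.
Proof. by rewrite size_takel // size_drop; move: ij; clear; lia. Qed.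

Lemma vertex_at_factor t : t <= j - i -> vertex_at (factor C i j) t = vertex_at C (i + t).
Proof.
move=> tj; rewrite /vertex_at /factor /= take_takel // /vertex_at.
by rewrite -last_cat -map_cat takeD.
Qed.

Lemma out_factor d t : (if d then t < j - i else 0 < t <= j - i) ->
  out (factor C i j).2 d t = out C.2 d (i + t).
Proof.
case: d => /= h; first by rewrite onth_factor.
by case: t h => // t h; rewrite addnS onth_factor.
Qed.

Hypothesis sC : is_string C.

Lemma is_string_factor : is_string (factor C i j).
Proof.
have [h1 h2] := is_stringP sC; apply/is_stringP; split.
  move=> l h; have lt : 0 < j - i by rewrite -size_factor -onthTE h.
  by apply: (out_src sC (d := true)); rewrite -[i]addn0 -(@out_factor true).
move=> p l m hl hm; have lt : p.+1 < j - i by rewrite -size_factor -onthTE hm.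
by apply: (h2 (i + p)); rewrite -?addnS -(@onth_factor _ _ _ (j - i)) // ltnW.
Qed.

Lemma nxt_factor t u x : t <= j - i -> u <= j - i ->
  (nxt (factor C i j).2 t x == Some u) = (nxt C.2 (i + t) x == Some (i + u)).
Proof.
move=> tj uj; apply/eqP/eqP => [/(nxtP is_string_factor)|/(nxtP sC)] [d h uE].
  apply/(nxtP sC); exists d; last by have := mvK h; rewrite uE; case: (d) => /=; lia.
  rewrite -out_factor //; have := isSome_out (factor C i j).2 d t; rewrite h size_factor.
  by case: (d).
apply/(nxtP is_string_factor); exists d; last first.
  have := mvK h; rewrite -uE; move: uE; clear; case: (d) => /=; lia.
rewrite out_factor //; have := mvK h; rewrite -uE; move: uE uj tj; clear.
by case: (d) => /=; lia.
Qed.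

End Factors.

(** A nonlazy string is not its own inverse: its middle letter would be its own
    inverse, or its two middle letters mutually inverse. *)
Lemma string_neq_inv (B : bquiver) (s : seq (letter B)) :
  sorted (@follows B) s -> s = rev (map (@linv B) s) -> s = [::].
Proof.
move=> ss e; apply/eqP/negPn/negP => s0; set n := size s.
have n0 : 0 < n by rewrite lt0n size_eq0.
have [l0 _] : exists l : letter B, True by case: (s) s0 => // l; exists l.
have h t : t < n -> nth l0 s t = linv (nth l0 s (n - t.+1)).
  by move=> tn; rewrite {1}e nth_rev size_map // (nth_map l0) //; move: tn; clear; lia.
case: (boolP (odd n)) => on.
  have := h (n./2) _; have -> : n - n./2.+1 = n./2 by move: (odd_double_half n); rewrite on; lia.
  have lt : n./2 < n by move: (odd_double_half n); rewrite on; lia.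
  by move=> /(_ lt); case: (nth _ _ _) => a [].
pose t := n./2.-1; have en : n = t.+1.*2.
  by have := odd_double_half n; rewrite (negPf on) /t; lia.
have := h t.+1; have -> : n - t.+2 = t by rewrite en; lia.
have lt : t.+1 < n by rewrite en; lia.
move=> /(_ lt) => h2; have /sortedP/(_ _ lt) := ss; move/(_ l0)/follows_neq.
by rewrite h2 eqxx.
Qed.

Section Matching.
Variables (B : bquiver) (C C' : word B).
Hypotheses (gB : locally_gentle B) (sC : is_string C) (sC' : is_string C').
Local Notation s := C.2.
Local Notation s' := C'.2.
Implicit Types (d e : bool) (i j p q t : nat).

(** The position of C' matched to p by an identification of the factor [i, j] of C
    with the factor of C' beginning at i', preserving (e = true) or reversing
    (e = false) the direction. *)
Definition mate e i j i' p := if e then i' + (p - i) else i' + (j - p).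

(** In terms of letters and vertices, the two factors are equal (e = true) or
    mutually inverse (e = false); see [agree_factor] and [agree_factor_inv].  The
    direction d in C corresponds to the direction d == e in C'. *)
Definition agree e i j i' j' := j - i = j' - i' /\
  forall p, i <= p <= j -> vertex_at C p = vertex_at C' (mate e i j i' p) /\
    forall d, (if d then p < j else i < p) ->
      out s d p = out s' (d == e) (mate e i j i' p).

Lemma agree_of_letters e i j i' j' : i <= j <= size s -> i' <= j' <= size s' ->
  j - i = j' - i' -> vertex_at C i = vertex_at C' (mate e i j i' i) ->
  (forall t, t < j - i -> onth s (i + t) =
     if e then onth s' (i' + t) else omap (@linv B) (onth s' (j' - t.+1))) ->
  agree e i j i' j'.
Proof.
move=> ij ij' len vi let_eq; split=> // p pij.
have outs d : (if d then p < j else i < p) ->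
    out s d p = out s' (d == e) (mate e i j i' p).
  case: d => h.
    have pi : i + (p - i) = p by move: pij; clear; lia.
    have lt : p - i < j - i by move: pij h; clear; lia.
    have := let_eq _ lt; rewrite pi {1 2}/out /mate => ->; case: (e) => //=.
    have -> : i' + (j - p) = (j' - (p - i).+1).+1 by move: pij h len ij'; clear; lia.
    by [].
  case: p pij h => // p pij h.
  have pi : i + (p - i) = p by move: pij h; clear; lia.
  have lt : p - i < j - i by move: pij h; clear; lia.
  have := let_eq _ lt; rewrite pi {1 2}/out /mate => ->; case: (e) => //=.
    have -> : i' + (p.+1 - i) = (i' + (p - i)).+1 by move: h; clear; lia.
    by [].
  have -> : j' - (p - i).+1 = i' + (j - p.+1) by move: pij h len ij'; clear; lia.
  by case: (onth s' _) => [l|] //=; rewrite linvK.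
split=> //; have [jei|nij] := eqVneq i j.
  by have -> : p = i; [move: pij; rewrite jei; clear; lia|].
have [d hd] : exists d, if d then p < j else i < p.
  have : (p < j) || (i < p) by move: nij pij; clear; lia.
  by case/orP; [exists true|exists false].
have [l hl] : exists l, out s d p = Some l.
  apply/out_some; move: ij pij hd; clear; case: (d); lia.
have hl' := hl; rewrite (outs d hd) in hl'.
by rewrite -(out_src sC hl) (out_src sC' hl').
Qed.

Lemma agree_factor i j i' j' : i <= j <= size s -> i' <= j' <= size s' ->
  agree true i j i' j' <-> factor C i j = factor C' i' j'.
Proof.
move=> ij ij'; split=> [[len h]|e].
  have iij : i <= i <= j by move: ij; clear; lia.
  have [v0 _] := h i iij; rewrite /mate subnn addn0 in v0; rewrite /factor v0.
  congr pair; apply: eq_from_onth => t; case: (ltnP t (j - i)) => tn; last first.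
    have e1 := size_factor ij; have e2 := size_factor ij'; rewrite /factor /= in e1 e2.
    by rewrite !onth_default ?e1 ?e2 -?len.
  have itj : i <= i + t <= j by move: tn ij; clear; lia.
  rewrite !onth_factor -?len //; have [_ /(_ true)] := h (i + t) itj.
  by rewrite /mate /out addKn; apply; move: tn ij; clear; lia.
have len : j - i = j' - i' by rewrite -(size_factor ij) e size_factor.
apply: agree_of_letters => //.
  by rewrite /mate subnn addn0; have := congr1 (fun w : word B => w.1) e.
move=> t tn; have := congr1 (fun w : word B => onth w.2 t) e.
by rewrite /factor /= !onth_factor -?len.
Qed.

Lemma agree_factor_inv i j i' j' : i <= j <= size s -> i' <= j' <= size s' ->
  agree false i j i' j' <-> factor C i j = winv (factor C' i' j').
Proof.
move=> ij ij'; rewrite /winv /wlen (size_factor ij') vertex_at_factor //.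
have -> : i' + (j' - i') = j' by move: ij'; clear; lia.
have onth_inv n t : j' - i' = n -> t < n ->
    onth (rev (map (@linv B) (factor C' i' j').2)) t = omap (@linv B) (onth s' (j' - t.+1)).
  move=> en tn; rewrite onth_rev ?size_map ?(size_factor ij') ?en // onth_map.
  rewrite onth_factor ?en; last by move: tn; clear; lia.
  by congr omap; congr onth; move: en tn ij'; clear; lia.
split=> [[len h]|e].
  have iij : i <= i <= j by move: ij; clear; lia.
  have [v0 _] := h i iij; rewrite /mate len in v0.
  have vE : i' + (j' - i') = j' by move: ij'; clear; lia.
  rewrite vE in v0.
  rewrite [LHS]surjective_pairing; congr pair; first exact: v0.
  apply: eq_from_onth => t; case: (ltnP t (j - i)) => tn; last first.
    by rewrite !onth_default // ?size_rev ?size_map size_factor -?len.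
  have itj : i <= i + t <= j by move: tn ij; clear; lia.
  rewrite (onth_inv (j - i)) // onth_factor //; have [_ /(_ true)] := h (i + t) itj.
  rewrite /mate /out /= => -> //; last by move: tn ij; clear; lia.
  by have -> : i' + (j - (i + t)) = (j' - t.+1).+1 by move: len tn ij ij'; clear; lia.
have len : j - i = j' - i'.
  by rewrite -(size_factor ij) e size_rev size_map size_factor.
apply: agree_of_letters => //.
  rewrite /mate len; have := congr1 (fun w : word B => w.1) e.
  by rewrite /factor /= => ->; congr vertex_at; move: ij'; clear; lia.
move=> t tn; rewrite -(onth_factor _ _ tn) -(onth_inv (j - i)) //.
by have := congr1 (fun w : word B => onth w.2 t) e.
Qed.

Lemma mate_mv e i j i' p d : i <= p <= j -> (if d then p < j else i < p) ->
  mate e i j i' (mv d p) = mv (d == e) (mate e i j i' p).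
Proof. by rewrite /mate /mv; clear; case: d; case: e => /=; lia. Qed.

(** Direction e at q is the one that corresponds to direction d at p: the letter by
    which C' leaves q belongs to the class of half-edges through which C leaves p. *)
Definition aligned d p e q := exists u y,
  [/\ out s (~~ d) p = Some u, out s' e q = Some y & follows (linv u) y].

Definition inner p q := [/\ vertex_at C p = vertex_at C' q,
  0 < p < size s & 0 < q < size s'].

Lemma inner_out p q d e : inner p q -> exists x y, out s d p = Some x /\ out s' e q = Some y.
Proof.
move=> [_ hp hq].
have [x hx] : exists x, out s d p = Some x.
  by apply: out_some; move: hp; clear; case: (d); lia.
have [y hy] : exists y, out s' e q = Some y.
  by apply: out_some; move: hq; clear; case: (e); lia.
by exists x, y.
Qed.

Lemma aligned_xor d p e q : inner p q ->
  (aligned d p e q \/ aligned d p (~~ e) q) /\ ~ (aligned d p e q /\ aligned d p (~~ e) q).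
Proof.
move=> pq; have [v _ _] := pq.
have [u [y [hu hy]]] := inner_out (~~ d) e pq.
have [_ [y' [_ hy']]] := inner_out (~~ d) (~~ e) pq.
have f1 := out_follows sC' hy' hy.
have src : ltgt (linv u) = ltgt (linv y').
  by rewrite !ltgt_linv (out_src sC hu) (out_src sC' hy').
have := follows_dichotomy gB f1 src; rewrite linvK => /addbP h.
split.
  case h1: (follows (linv u) y); first by left; exists u, y.
  by right; exists u, y'; split=> //; rewrite -h h1.
move=> [[u1 [y1 [k1 k2 k3]]] [u2 [y2 [k4 k5 k6]]]].
move: h; move: k1 k4 k3 k6; rewrite hu => -[<-] [<-].
by move: k2 k5; rewrite hy hy' => -[<-] [<-] -> ->.
Qed.

Lemma aligned_neg d p e q : inner p q -> aligned d p e q -> aligned (~~ d) p (~~ e) q.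
Proof.
move=> pq [u [y [hu hy uy]]]; have [v _ _] := pq.
have [x [y' [hx hy']]] := inner_out d (~~ e) pq.
exists x, y'; rewrite negbK; split=> //.
have f1 := out_follows sC' hy' hy; have f2 := out_follows sC hu hx.
have src : ltgt (linv x) = ltgt (linv y').
  by rewrite !ltgt_linv (out_src sC hx) (out_src sC' hy').
have := follows_dichotomy gB f1 src; rewrite linvK.
case h: (follows (linv x) y) => //= _.
have src2 : ltgt (linv y) = ltgt (linv u).
  by rewrite !ltgt_linv (out_src sC hu) (out_src sC' hy).
have := follows_dichotomy gB f2 src2; rewrite linvK.
by rewrite -follows_linv linvK -[follows _ u]follows_linv linvK h uy.
Qed.

Lemma aligned_step d p e q l : out s d p = Some l -> out s' e q = Some l ->
  (exists l', out s' e (mv e q) = Some l') -> aligned d (mv d p) e (mv e q).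
Proof.
move=> h1 h2 [l' h3]; exists (linv l), l'; split=> //; first exact: out_mv.
by apply: (out_follows sC' (out_mv h2) h3).
Qed.

Lemma aligned_eq d p e q x y : aligned d p e q -> out s d p = Some x ->
  out s' e q = Some y -> x.2 = y.2 -> x = y.
Proof.
move=> [u [y' [hu hy uy]]] hx; rewrite hy => -[e1] xy; subst y'.
exact: (follows_inj gB (out_follows sC hu hx) uy xy).
Qed.

(** In aligned directions a letter of C is not met backwards in C'. *)
Lemma aligned_back d p e q x : inner p q -> aligned d p e q -> out s d p = Some x ->
  out s' (~~ e) q = Some x -> False.
Proof.
move=> pq al hx hy; have [_] := aligned_xor d e pq; apply; split=> //.
have [u [_ [hu _]]] := inner_out (~~ d) e pq.
by exists u, x; split=> //; apply: (out_follows sC hu hx).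
Qed.

End Matching.

Local Open Scope ring_scope.

(** * Homomorphisms between string modules *)

(** The entry at given positions of the surrounding strings, zero outside the
    matrix. *)
Definition ext (k : fieldType) (m n lo a : nat) (f : 'M[k]_(m, n)) (p q : nat) : k :=
  \sum_(u < m | (lo + u == p)%N) \sum_(v < n | (a + v == q)%N) f u v.

Lemma extE (k : fieldType) (m n lo a : nat) (f : 'M[k]_(m, n))
  (u : 'I_m) (v : 'I_n) : ext lo a f (lo + u) (a + v) = f u v.
Proof.
rewrite /ext (big_pred1 u) => [|u']; last by rewrite eqn_add2l.
by rewrite (big_pred1 v) // => v'; rewrite eqn_add2l.
Qed.

Lemma ext_in (k : fieldType) (m n lo a : nat) (f : 'M[k]_(m, n)) p q :
  ext lo a f p q != 0 -> exists (u : 'I_m) (v : 'I_n), p = (lo + u)%N /\ q = (a + v)%N.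
Proof.
move=> h; case: (pickP (fun u : 'I_m => lo + u == p)%N) => [u /eqP <-|h2].
  case: (pickP (fun v : 'I_n => a + v == q)%N) => [v /eqP <-|h2]; first by exists u, v.
  by case/eqP: h; rewrite /ext big1 // => ? _; rewrite big_pred0.
by case/eqP: h; rewrite /ext big_pred0.
Qed.

(** The nonzero entries of the matrix of a kiss; see [kiss_mxE]. *)
Definition kiss_supp (B : bquiver) (C C' : word B) (z : kiss_pos C C') (p q : nat) : bool :=
  let: ((i, j), (i', j')) := z in
  (i <= p <= j)%N && (q == mate (factor C i j == factor C' i' j') i j i' p).

Section KissCriterion.
Variable B : bquiver.

Lemma factor_prefix (C0 : word B) (n : nat) : (0 < n <= size C0.2)%N ->
  exists l D, (factor C0 0 n).2 = l :: D /\ out C0.2 false n = Some (linv (last l D)).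
Proof.
case: n => // n nN; rewrite /factor /= drop0 subn0.
case e: (take n.+1 C0.2) => [|l D].
  by have := congr1 size e; rewrite size_takel //= .
exists l, D; split=> //; have -> : onth C0.2 n = Some (last l D) => //.
have [x hx] : exists x, onth C0.2 n = Some x.
  have : onth C0.2 n by rewrite onthTE.
  by case: onth => // x; exists x.
by rewrite hx; have := take_onth hx; rewrite e lastI => /rcons_inj[_ <-].
Qed.

Lemma factor_suffix (C0 : word B) (n : nat) : (n < size C0.2)%N ->
  exists l D, (factor C0 n (wlen C0)).2 = l :: D /\ out C0.2 true n = Some l.
Proof.
move=> nN; rewrite /factor /wlen /= -size_drop take_size.
case e: (drop n C0.2) => [|l D].
  have : (0 < size (drop n C0.2))%N by rewrite size_drop subn_gt0.
  by rewrite e.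
exists l, D; split=> //.
by rewrite /out -[C0.2](cat_take_drop n) e onth_cat size_takel ?(ltnW nN) // ltnn subnn.
Qed.

Lemma kissP (C1 C2 : word B) (i j : 'I_(wlen C1).+1) (i' j' : 'I_(wlen C2).+1) :
  reflect [/\ (i <= j)%N, (i' <= j')%N,
      forall d, exists a, out C1.2 d (if d then j else i) = Some (a, true),
      forall d, exists a, out C2.2 d (if d then j' else i') = Some (a, false)
    & (factor C1 i j == factor C2 i' j') || (factor C1 i j == winv (factor C2 i' j'))]
    (@is_kiss B C1 C2 ((i, j), (i', j'))).
Proof.
have jN := ltn_ord j; have jN' := ltn_ord j'; rewrite !ltnS /wlen in jN jN'.
have iN := ltn_ord i; have iN' := ltn_ord i'; rewrite !ltnS /wlen in iN iN'.
rewrite /is_kiss /quotient_fact /submodule_fact /is_factorization /wlen jN jN' !andbT.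
apply: (iffP idP).
  move=> /and3P[/and3P[ij q1 q2] /and3P[ij' s1 s2] /and5P[e i0 jl i0' jl']].
  split=> // d; case: d; rewrite //.
  - have [l [D [e1 e2]]] := factor_suffix jl; move: q2; rewrite e1 /direct => h.
    by exists l.1; rewrite e2; case: (l) h => ? [].
  - have [|l [D [e1 e2]]] := @factor_prefix C1 i; first by rewrite i0.
    by move: q1; rewrite e1 /direct e2 /linv => -> /=; exists (last l D).1.
  - have [l [D [e1 e2]]] := factor_suffix jl'; move: s2; rewrite e1 /direct => h.
    by exists l.1; rewrite e2; case: (l) h => ? [].
  - have [|l [D [e1 e2]]] := @factor_prefix C2 i'; first by rewrite i0'.
    by move: s1; rewrite e1 /direct e2 /linv => -> /=; exists (last l D).1.
move=> [ij ij' h1 h2 e].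
have [a1 o1] := h1 true; have [a2 o2] := h1 false.
have [b1 p1] := h2 true; have [b2 p2] := h2 false.
have jl : (j < size C1.2)%N by have := isSome_out C1.2 true j; rewrite o1 /= => <-.
have jl' : (j' < size C2.2)%N by have := isSome_out C2.2 true j'; rewrite p1 /= => <-.
have i0 : (0 < i <= size C1.2)%N by have := isSome_out C1.2 false i; rewrite o2 /= => <-.
have i0' : (0 < i' <= size C2.2)%N by have := isSome_out C2.2 false i'; rewrite p2 /= => <-.
have [l1 [D1 [e1 f1]]] := factor_suffix jl; have [l2 [D2 [e2 f2]]] := factor_prefix i0.
have [l3 [D3 [e3 f3]]] := factor_suffix jl'; have [l4 [D4 [e4 f4]]] := factor_prefix i0'.
rewrite e1 e2 e3 e4 ij ij' e jl jl' /=.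
case/andP: i0 => -> _; case/andP: i0' => -> _; rewrite !andbT /direct.
move: f1 f3; rewrite o1 p1 => -[<-] [<-] /=.
have : (linv (last l2 D2)).2 = true.
  by have := f2; rewrite o2 => /Some_inj <-.
have : (linv (last l4 D4)).2 = false.
  by have := f4; rewrite p2 => /Some_inj <-.
by rewrite /=; case: (last l2 D2).2; case: (last l4 D4).2.
Qed.

End KissCriterion.

Section KissEntries.
Variables (B : bquiver) (C C' : word B) (z : kiss_pos C C').
Hypothesis hz : is_kiss z.
Local Notation i := (z.1.1 : nat).
Local Notation j := (z.1.2 : nat).
Local Notation i' := (z.2.1 : nat).
Local Notation j' := (z.2.2 : nat).

Lemma kiss_ord : [/\ (i <= j <= size C.2)%N & (i' <= j' <= size C'.2)%N].
Proof.
move: hz; rewrite /is_kiss; case: z => [[i j] [i' j']] /=.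
by case/and3P => /and3P[h1 _ _] /and3P[h2 _ _] _; split.
Qed.

Lemma kiss_mxE (k : fieldType) (lo m a n : nat) (u : 'I_m) (v : 'I_n) :
  kiss_mx k lo m a n z u v = (kiss_supp z (lo + u) (a + v))%:R.
Proof.
have [] := kiss_ord; rewrite /kiss_mx /kiss_supp; move: hz; rewrite /is_kiss.
case: z => [[i j] [i' j']] /= h ij ij'.
have szZ : wlen (factor C i j) = (j - i)%N by apply: size_factor.
have szZ' : wlen (factor C' i' j') = (j' - i')%N by apply: size_factor.
have len : (j - i = j' - i')%N.
  rewrite -szZ -szZ'; case/and3P: h => _ _ /andP[/orP[/eqP->//|/eqP->] _].
  by rewrite /wlen size_rev size_map.
set e := factor C i j == factor C' i' j'; rewrite !mxE.
have [ipj|nipj] := boolP (i <= lo + u <= j)%N; last first.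
  rewrite big1 // => t _; rewrite !mxE big1 ?mul0r // => r _; rewrite !mxE.
  case: eqP => [hr|]; rewrite ?mul0r //; case/negP: nipj.
  by have := ltn_ord r; rewrite {2}szZ hr; move: ij; clear; lia.
have ltr : (lo + u - i < (wlen (factor C i j)).+1)%N by rewrite szZ; move: ipj; clear; lia.
rewrite andTb; transitivity (\sum_(t < (wlen (factor C' i' j')).+1)
    (a + v == i' + t)%N%:R * (t == (if e then lo + u - i else j - (lo + u)) :> nat)%N%:R : k).
  apply: eq_bigr => t _; rewrite mulrC !mxE; congr (_ * _).
  rewrite (bigD1 (Ordinal ltr)) //= big1 => [|r rr].
    rewrite !mxE /= addr0; have -> : (lo + u == i + (lo + u - i))%N by move: ipj; clear; lia.
    rewrite mul1r -/e szZ; case: (e); first by rewrite eq_sym.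
    by congr (nat_of_bool _)%:R; have := ltn_ord t; rewrite {2}szZ' -len; move: ipj; clear; lia.
  rewrite !mxE; case: eqP => [hr|]; rewrite ?mul0r //; case/eqP: rr; apply/val_inj => /=.
  by rewrite hr; clear; lia.
have ltt : ((if e then lo + u - i else j - (lo + u)) < (wlen (factor C' i' j')).+1)%N.
  by rewrite szZ' -len; move: ipj; clear; case: (e); lia.
rewrite (bigD1 (Ordinal ltt)) //= big1 => [|t tt].
  by rewrite eqxx mulr1 addr0 /mate; case: (e).
by case: (t =P _ :> nat) => [ht|]; rewrite ?mulr0 //; case/eqP: tt; apply/val_inj.
Qed.

End KissEntries.

Local Close Scope ring_scope.

Local Open Scope ring_scope.

(** The module M is carried by the positions [lo, hi] of C and N by the positions
    [a, b] of C'.  The hypotheses say that M is a quotient of M(C) and N a submodule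
    of M(C'), that the letters beyond their neighbours admit no further kisses, and
    that the extreme vertices of C' do not occur in M. *)
Section KissBasis.
Variables (k : fieldType) (B : bquiver) (C C' : word B) (lo hi a b : nat).
Variables (M N : rep k B).
Hypotheses (gB : locally_gentle B) (sC : is_string C) (sC' : is_string C').
Local Notation s := C.2.
Local Notation s' := C'.2.
Hypothesis lohi : [/\ (0 < lo)%N, (lo <= hi)%N & (hi < size s)%N].
Hypothesis ab : (a <= b <= size s')%N.
Hypothesis Xend : forall d l, out s d (if d then hi else lo) = Some l -> l.2 = true.
Hypothesis Xbeyond : forall d p l, (if d then hi < p else p < lo)%N ->
  out s d p = Some l -> l.2 = false.
Hypothesis Tend : forall d l, out s' d (if d then b else a) = Some l -> l.2 = false.
Hypothesis Tbeyond : forall d p l, (if d then b < p else p < a)%N ->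
  out s' d p = Some l -> l.2 = true.
Hypothesis vend : forall d p, (lo <= p <= hi)%N ->
  vertex_at C p != vertex_at C' (if d then size s' else 0%N).
Hypotheses (Mivl : ivl_rep M C lo) (Mdim : rdim M = (hi - lo).+1).
Hypotheses (Nivl : ivl_rep N C' a) (Ndim : rdim N = (b - a).+1).

Let Mrange (u : 'I_(rdim M)) : (lo <= lo + u <= hi)%N.
Proof. by have := ltn_ord u; rewrite {2}Mdim; case: lohi; clear; lia. Qed.

Let Nrange (v : 'I_(rdim N)) : (a <= a + v <= b)%N.
Proof. by have := ltn_ord v; rewrite {2}Ndim; move: ab; clear; lia. Qed.

Let inM p : (lo <= p <= hi)%N -> exists u : 'I_(rdim M), p = (lo + u)%N.
Proof.
move=> h; have lt : (p - lo < rdim M)%N by rewrite Mdim; move: h; clear; lia.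
by exists (Ordinal lt) => /=; move: h; clear; lia.
Qed.

Let inN p : (a <= p <= b)%N -> exists u : 'I_(rdim N), p = (a + u)%N.
Proof.
move=> h; have lt : (p - a < rdim N)%N by rewrite Ndim; move: h; clear; lia.
by exists (Ordinal lt) => /=; move: h; clear; lia.
Qed.

Let ext_range (f : 'M[k]_(rdim M, rdim N)) p q : ext lo a f p q != 0 ->
  (lo <= p <= hi)%N /\ (a <= q <= b)%N.
Proof. by move=> /ext_in[u [v [-> ->]]]. Qed.

Lemma inner_of p q : (lo <= p <= hi)%N -> (q <= size s')%N ->
  vertex_at C p = vertex_at C' q -> inner C C' p q.
Proof.
move=> hp hq v; split=> //; first by case: lohi; move: hp; clear; lia.
have := vend true hp; have := vend false hp; rewrite v => h0 h1.
case: (eqVneq q 0%N) h0 => [->|]; rewrite ?eqxx // => q0 _.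
case: (eqVneq q (size s')) h1 => [->|]; rewrite ?eqxx // => q1 _.
by move: hq q0 q1; clear; lia.
Qed.

Section Hom.
Variable f : 'M[k]_(rdim M, rdim N).
Hypothesis hf : is_hom f.
Local Notation F := (ext lo a f).

Lemma hom_vertex p q : F p q != 0 -> vertex_at C p = vertex_at C' q.
Proof.
move=> h; have [u [v [pu qv]]] := ext_in h; rewrite {}pu {}qv extE in h *.
have := congr1 (fun A : 'M_(_, _) => A u v) (hf.1 (vertex_at C' (a + v))).
rewrite mxE [RHS]mxE (bigD1 u) //= big1 => [|u' uu]; last first.
  by rewrite (proj1 Mivl) eq_sym (negPf uu) mul0r.
rewrite [RHS](bigD1 v) //= [X in _ = _ + X]big1 => [|v' vv]; last first.
  by rewrite (proj1 Nivl) (negPf vv) mulr0.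
rewrite (proj1 Mivl) (proj1 Nivl) !eqxx /= mulr1 !addr0.
by case: eqP => // _; rewrite mul0r => e; rewrite -e eqxx in h.
Qed.

Let hom_inner p q : F p q != 0 -> inner C C' p q.
Proof.
move=> h; have [h1 /andP[_ h2]] := ext_range h.
apply: inner_of (hom_vertex h) => //; apply: leq_trans h2 _; by case/andP: ab.
Qed.

Lemma arr_actl x u v : (arr M x *m f) u v =
  if nxt s (lo + u) x is Some p then F p (a + v) else 0.
Proof.
rewrite mxE; case e: nxt => [p|]; last first.
  by rewrite big1 // => u' _; rewrite (proj2 Mivl) e mul0r.
have [hp|hp] := boolP (lo <= p <= hi)%N.
  have [u' eu] := inM hp; rewrite (bigD1 u') //= big1 => [|u2 uu].
    by rewrite (proj2 Mivl) e eu eqxx mul1r addr0 extE.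
  rewrite (proj2 Mivl) e eu (inj_eq Some_inj) eqn_add2l (inj_eq val_inj).
  by rewrite eq_sym (negPf uu) mul0r.
rewrite big1 => [|u' _]; last first.
  rewrite (proj2 Mivl) e; case: eqP => [[pu]|]; rewrite ?mul0r //.
  by rewrite pu Mrange in hp.
by apply/esym/eqP; apply/negP => /negP /ext_range[]; rewrite (negPf hp).
Qed.

Lemma arr_actr x (u : 'I_(rdim M)) (v : 'I_(rdim N)) q' : nxt s' q' x = Some (a + v)%N ->
  (f *m arr N x) u v = F (lo + u) q'.
Proof.
move=> e; rewrite mxE.
have inj w : (nxt s' (a + w) x == Some (a + v)%N) = (a + w == q')%N.
  by apply/eqP/eqP => [h|-> //]; apply: (nxt_inj sC' h e).
have [hq|hq] := boolP (a <= q' <= b)%N.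
  have [v' ev] := inN hq; rewrite (bigD1 v') //= big1 => [|v2 vv].
    by rewrite (proj2 Nivl) inj ev eqxx mulr1 addr0 extE.
  by rewrite (proj2 Nivl) inj ev eqn_add2l (inj_eq val_inj) (negPf vv) mulr0.
rewrite big1 => [|v' _]; last first.
  rewrite (proj2 Nivl) inj; case: eqP => [qv|]; rewrite ?mulr0 //.
  by rewrite -qv Nrange in hq.
by apply/esym/eqP; apply/negP => /negP /ext_range[_]; rewrite (negPf hq).
Qed.

Lemma arr_actr0 x (u : 'I_(rdim M)) (v : 'I_(rdim N)) : (forall q', nxt s' q' x <> Some (a + v)%N) ->
  (f *m arr N x) u v = 0.
Proof.
move=> h; rewrite mxE big1 // => v' _; rewrite (proj2 Nivl).
by case: eqP => [/h //|]; rewrite mulr0.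
Qed.

(** Compatibility with an arrow, read off at the entry (p, q).  Positions of C'
    outside [a, b] may be included since N is a submodule. *)
Lemma hom_square x p p' q q' : (lo <= p <= hi)%N -> nxt s p x = Some p' ->
  nxt s' q' x = Some q -> F p' q = F p q'.
Proof.
move=> hp e e'; have [u pu] := inM hp; rewrite {}pu in e hp *.
have [hq|hq] := boolP (a <= q <= b)%N.
  have [v qv] := inN hq; rewrite {}qv in e' hq *.
  have := congr1 (fun A : 'M_(_, _) => A u v) (hf.2 x).
  by rewrite (arr_actr _ e') arr_actl e.
transitivity (0 : k); apply/eqP; last rewrite eq_sym; apply/negP => /negP.
  by move=> /ext_range[_]; rewrite (negPf hq).
move=> /ext_range[_ hq']; case/negP: hq.
move: e' => /(nxtP sC')[d h1 ->]; have h2 := Tend (d := d).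
case: (eqVneq q' (if d then b else a)) => [e2|ne].
  by rewrite e2 in h1; have := h2 _ h1.
by move: ne hq' (mvK h1); clear; case: (d) => /=; lia.
Qed.

Lemma hom_zero_left x p p' q : (lo <= p <= hi)%N -> nxt s p x = Some p' ->
  (forall q', nxt s' q' x <> Some q) -> F p' q = 0.
Proof.
move=> hp e h; apply/eqP/negP => /negP fq; have [_ hq] := ext_range fq.
have [u pu] := inM hp; have [v qv] := inN hq; rewrite {}pu {}qv in e h fq.
have := congr1 (fun A : 'M_(_, _) => A u v) (hf.2 x).
by rewrite arr_actl e (arr_actr0 _ h) => e2; rewrite e2 eqxx in fq.
Qed.

(** Along a direction in which the letters agree a homomorphism is constant, and
    where they disagree only one choice of signs is possible. *)
Lemma extend d p e q : F p q != 0 -> aligned C C' d p e q ->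
  exists n, [/\
    forall t, (t <= n)%N -> F (mvn d t p) (mvn e t q) = F p q,
    forall t, (t < n)%N -> out s d (mvn d t p) = out s' e (mvn e t q),
    exists x, out s d (mvn d n p) = Some (x, true),
    exists y, out s' e (mvn e n q) = Some (y, false)
    & (d || (n <= p)%N) && (e || (n <= q)%N)].
Proof.
have [m] := ubnP (if d then hi - p else p - lo)%N.
elim: m p q => // m IH p q hm Fpq al.
have [hp hq] := ext_range Fpq; have pq := hom_inner Fpq.
have [x [y [hx hy]]] := inner_out d e pq.
have [xy|nxy] := eqVneq x y.
  move: xy hy => <- {y} hy.
  have FF : F (mv d p) (mv e q) = F p q.
    case: x hx hy => [x []] hx hy.
      by apply: (hom_square hp (x := x)); [apply/(nxtP sC); exists d|apply/(nxtP sC'); exists e].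
    apply/esym; apply: (hom_square (x := x)).
    - case: (eqVneq p (if d then hi else lo)) => [pe|ne].
        by rewrite pe in hx; have := Xend hx.
      by move: ne hp (mvK hx); clear; case: (d) => /=; lia.
    - by apply/(nxtP sC); exists (~~ d); rewrite ?(out_mv hx) ?(mvK hx).
    - by apply/(nxtP sC'); exists (~~ e); rewrite ?(out_mv hy) ?(mvK hy).
  have F1 : F (mv d p) (mv e q) != 0 by rewrite FF.
  have [hp1 _] := ext_range F1; have pq1 := hom_inner F1.
  have [_ [y1 [_ hy1]]] := inner_out d e pq1.
  have al1 : aligned C C' d (mv d p) e (mv e q).
    by apply: (aligned_step sC' hx hy); exists y1.
  have [|n [h1 h2 h3 h4 h5]] := IH _ _ _ F1 al1.
    by move: hm hp hp1 (mvK hx); clear; case: (d) => /=; lia.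
  have mvnS c t r l (w : seq (letter B)) : out w c r = Some l -> mvn c t.+1 r = mvn c t (mv c r).
    by move=> /mvK; rewrite /mvn /mv; clear; case: c => /=; lia.
  exists n.+1; split.
  - case=> [_|t tn]; first by rewrite /mvn !addn0 !subn0 !if_same.
    by rewrite (mvnS _ _ _ _ _ hx) (mvnS _ _ _ _ _ hy) h1 // FF.
  - case=> [_|t tn]; first by rewrite /mvn !addn0 !subn0 !if_same hx hy.
    by rewrite (mvnS _ _ _ _ _ hx) (mvnS _ _ _ _ _ hy) h2.
  - by rewrite (mvnS _ _ _ _ _ hx).
  - by rewrite (mvnS _ _ _ _ _ hy).
  - by move: h5 (mvK hx) (mvK hy); clear; case: (d); case: (e) => /=; lia.
have [x2 y2] : x.2 = true /\ y.2 = false.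
  have : x.2 != y.2 by apply/eqP => e2; case/eqP: nxy; apply: aligned_eq hx hy e2.
  case x2: x.2; case y2: y.2 => // _; exfalso.
  (* the arrow of the source's inverse letter reaches p, but nothing in the      *)
  (* target reaches q by it, so the entry vanishes                               *)
  case: x hx x2 {nxy} => [x c] /= hx x2; rewrite {}x2 in hx.
  have hp1 : (lo <= mv d p <= hi)%N.
    case: (eqVneq p (if d then hi else lo)) => [pe|ne].
      by rewrite pe in hx; have := Xend hx.
    by move: ne hp (mvK hx); clear; case: (d) => /=; lia.
  case/eqP: Fpq; apply: (hom_zero_left hp1 (x := x)).
    by apply/(nxtP sC); exists (~~ d); rewrite ?(out_mv hx) ?(mvK hx).
  move=> q' /(nxtP sC')[c' h1 h2]; have := out_mv h1; rewrite -h2.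
  have [->|/eqb_neg->] := eqVneq (~~ c') e.
    by rewrite hy => -[yE]; rewrite yE in y2.
  by move=> h3; apply: (aligned_back gB sC sC' pq al hx h3).
exists 0%N; rewrite /mvn !addn0 !subn0 !if_same; split=> //.
- by case=> // _; rewrite !addn0 !subn0 !if_same.
- by exists x.1; rewrite hx -x2 -surjective_pairing.
- by exists y.1; rewrite hy -y2 -surjective_pairing.
- by rewrite !leq0n !orbT.
Qed.

End Hom.

Section Kiss.
Variables (i j : 'I_(wlen C).+1) (i' j' : 'I_(wlen C').+1).
Hypothesis hz : @is_kiss B C C' ((i, j), (i', j')).
Let zz : kiss_pos C C' := ((i, j), (i', j')).

Let ijs : (i <= j <= size s)%N /\ (i' <= j' <= size s')%N.
Proof. by have [] := kiss_ord hz. Qed.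

(** Outside the intervals the letters have the wrong signs for the ends of a
    kiss. *)
Lemma kiss_in : [/\ (lo <= i)%N, (j <= hi)%N, (a <= i')%N & (j' <= b)%N].
Proof.
have [_ _ h1 h2 _] := kissP _ _ _ _ hz.
have [c1 o1] := h1 false; have [c2 o2] := h1 true.
have [c3 o3] := h2 false; have [c4 o4] := h2 true.
split; rewrite leqNgt; apply/negP => lt.
- by have := Xbeyond (d := false) lt o1.
- by have := Xbeyond (d := true) lt o2.
- by have := Tbeyond (d := false) lt o3.
- by have := Tbeyond (d := true) lt o4.
Qed.

Lemma kiss_agree : agree C C' (factor C i j == factor C' i' j') i j i' j'.
Proof.
have [ij ij'] := ijs; have [_ _ _ _] := kissP _ _ _ _ hz.
case: (factor C i j =P factor C' i' j') => [e _|_ /= /eqP e].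
  exact/(agree_factor sC sC' ij ij').
exact/(agree_factor_inv sC sC' ij ij').
Qed.

(** The orientation e may differ from the one used by the kiss only if the middle
    term is lazy, and then both induce the same matching. *)
Lemma kiss_suppE e p q : agree C C' e i j i' j' ->
  kiss_supp zz p q = (i <= p <= j)%N && (q == mate e i j i' p).
Proof.
have [ij ij'] := ijs => ag; rewrite /kiss_supp /=.
case: e ag => ag.
  by have /(agree_factor sC sC' ij ij') -> := ag; rewrite eqxx.
case: (factor C i j =P factor C' i' j') => [e|//].
have /(agree_factor_inv sC sC' ij ij') e2 := ag.
have /andP[_ ss] := is_string_factor ij sC.
have ij0 : (j - i = 0)%N.
  rewrite -(size_factor ij) (string_neq_inv ss) //.
  by rewrite [LHS](congr1 snd e2) e.
have [h|//] := boolP (i <= p <= j)%N; congr (_ == _); rewrite /mate /=.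
by move: h ij0; clear; lia.
Qed.

Lemma kiss_supp_inner p q : kiss_supp zz p q -> inner C C' p q.
Proof.
rewrite (kiss_suppE _ _ kiss_agree) => /andP[pij /eqP qE].
have [len h] := kiss_agree; have [hv _] := h _ pij.
have [h1 h2 h3 h4] := kiss_in; have [ij ij'] := ijs.
apply: inner_of; last by rewrite qE.
  by move: pij h1 h2; clear; lia.
by rewrite qE /mate; move: pij len ij ij'; clear; case: eqP => _; lia.
Qed.

(** A lazy middle term is read in the orientation in which its position is aligned,
    so that the orientation of a kiss is determined by any point of its support. *)
Lemma kiss_aligned p q : kiss_supp zz p q ->
  exists e, [/\ aligned C C' true p e q, agree C C' e i j i' j' & q = mate e i j i' p].
Proof.
move=> sp; have pq := kiss_supp_inner sp.
move: sp; rewrite (kiss_suppE _ _ kiss_agree).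
set e0 := factor C i j == factor C' i' j' => /andP[pij /eqP qE].
have ag := kiss_agree; rewrite -/e0 in ag; have [len h] := ag; have [hv ho] := h _ pij.
rewrite -qE in ho.
have al d : (if d then p < j else i < p)%N -> aligned C C' d p (d == e0) q.
  move=> hd; have [u [_ [hu _]]] := inner_out (~~ d) true pq.
  have [x [_ [hx _]]] := inner_out d true pq.
  exists u, x; split=> //; first by rewrite -ho.
  exact: (out_follows sC hu hx).
case: (ltnP p j) => pj; first by exists e0; split=> //; have := al true pj.
case: (ltnP i p) => ip.
  exists e0; split=> //; have := aligned_neg gB sC sC' pq (al false ip).
  by case: (e0).
have [e al0] : exists e, aligned C C' true p e q.
  by have [[] ? _] := aligned_xor gB sC sC' true true pq; [exists true|exists false].
have ijp : i = p :> nat /\ j = p :> nat by move: pj ip pij; clear; lia.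
exists e; split=> //; last by rewrite qE /mate; move: ijp; clear; case: (e); case: (e0); lia.
split=> // p1 p1ij; have -> : p1 = p by move: p1ij ijp; clear; lia.
have -> : mate e i j i' p = q.
  by rewrite qE /mate; move: ijp; clear; case: (e); case: (e0); lia.
split=> [|d hd]; first by case: pq.
by exfalso; move: hd ijp; clear; case: d; lia.
Qed.

(** From a point of its support a kiss extends up to the first disagreement of the
    two strings, which determines its ends. *)
Lemma kiss_extent e d p : agree C C' e i j i' j' -> (i <= p <= j)%N ->
  let n := (if d then j - p else p - i)%N in let q := mate e i j i' p in
  [/\ forall t, (t < n)%N -> out s d (mvn d t p) = out s' (d == e) (mvn (d == e) t q),
      exists x, out s d (mvn d n p) = Some (x, true)
    & exists y, out s' (d == e) (mvn (d == e) n q) = Some (y, false)].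
Proof.
move=> [len h] pij n q; have [_ _ h1 h2 _] := kissP _ _ _ _ hz; have [ij ij'] := ijs.
split.
- move=> t tn; have ti : (i <= mvn d t p <= j)%N.
    by move: tn pij; rewrite /n /mvn; clear; case: (d); lia.
  have [_ /(_ d) ->] := h _ ti; last by move: tn pij; rewrite /n /mvn; clear; case: (d); lia.
  congr (out _ _ _); rewrite /q /mate /mvn; move: tn pij len ij ij'; rewrite /n; clear.
  by case: (d); case: (e) => /=; lia.
- have [x hx] := h1 d; exists x; rewrite -hx; congr (out _ _ _); rewrite /mvn /n; move: pij; clear.
  by case: (d); lia.
have [y hy] := h2 (d == e); exists y; rewrite -hy; congr (out _ _ _); rewrite /mvn /n /q /mate.
by move: pij len ij ij'; clear; case: (d); case: (e) => /=; lia.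
Qed.

Lemma kiss_ext p q :
  ext lo a (kiss_mx k lo (rdim M) a (rdim N) zz) p q = (kiss_supp zz p q)%:R.
Proof.
have [h1 h2 h3 h4] := kiss_in; have [ij ij'] := ijs.
have [sp|nsp] := boolP (kiss_supp zz p q).
  move: (sp); rewrite (kiss_suppE _ _ kiss_agree) => /andP[pij /eqP qE].
  have [len _] := kiss_agree.
  have [u pu] : exists u : 'I_(rdim M), p = (lo + u)%N.
    by apply: inM; move: pij h1 h2; clear; lia.
  have [v qv] : exists v : 'I_(rdim N), q = (a + v)%N.
    apply: inN; rewrite qE /mate; move: pij h3 h4 len ij ij'; clear.
    by case: eqP => _; lia.
  by rewrite pu qv extE kiss_mxE -?pu -?qv ?sp.
apply/eqP/negP => /negP h; have [u [v [pu qv]]] := ext_in h.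
by move: h; rewrite pu qv extE kiss_mxE // -pu -qv (negPf nsp) eqxx.
Qed.

(** The source of the kiss is a quotient, so an arrow does not lead into it from
    outside. *)
Lemma kiss_supp_nxt x p p' q : nxt s p x = Some p' -> kiss_supp zz p' q ->
  exists2 q', nxt s' q' x = Some q & kiss_supp zz p q'.
Proof.
have ag := kiss_agree; rewrite (kiss_suppE _ _ ag) => hn /andP[pij /eqP qE].
set e := factor C i j == factor C' i' j' in ag qE.
move/(nxtP sC): hn => [d hp p'E]; have op' := out_mv hp; rewrite -p'E in op'.
have [_ _ h1 _ _] := kissP _ _ _ _ hz; have [y hy] := h1 (~~ d).
have ne : p' != (if ~~ d then j else i) by apply/eqP => pe; rewrite pe hy in op'.
have p'p := mvK hp; rewrite -p'E in p'p.
have hd : (if ~~ d then p' < j else i < p')%N by move: ne pij; clear; case: (d) => /=; lia.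
have pij2 : (i <= p <= j)%N by rewrite -p'p; move: hd pij; clear; case: (d) => /=; lia.
exists (mate e i j i' p); last by rewrite (kiss_suppE _ _ ag) pij2 eqxx.
have [_ /(_ p' pij)[_ /(_ (~~ d) hd)]] := ag; rewrite op' -qE => /esym oq.
have mE : mate e i j i' p = mv (~~ d == e) q by rewrite qE -(mate_mv e i' pij hd) p'p.
by apply/(nxtP sC'); exists (~~ (~~ d == e)); rewrite mE ?(out_mv oq) ?(mvK oq).
Qed.

(** Dually, no arrow leads out of the target of the kiss. *)
Lemma kiss_supp_nxtr x p q' q : nxt s' q' x = Some q -> kiss_supp zz p q' ->
  exists2 p', nxt s p x = Some p' & kiss_supp zz p' q.
Proof.
have ag := kiss_agree; rewrite (kiss_suppE _ _ ag) => hn /andP[pij /eqP q'E].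
set e := factor C i j == factor C' i' j' in ag q'E.
move/(nxtP sC'): hn => [c hq qE]; pose d := c == e.
have cE : (d == e) = c by rewrite /d; case: (c); case: (e).
have [_ _ _ h2 _] := kissP _ _ _ _ hz; have [y hy] := h2 c.
have [len h] := ag; have [ij ij'] := ijs.
have ne : q' != (if c then j' else i') by apply/eqP => pe; rewrite pe hy in hq.
have hd : (if d then p < j else i < p)%N.
  move: ne pij len ij ij'; rewrite q'E /mate /d; clear.
  by case: (c); case: (e) => /=; lia.
have [_ /(_ d hd)] := h _ pij; rewrite cE -q'E hq => hp.
exists (mv d p); first by apply/(nxtP sC); exists d.
rewrite (kiss_suppE _ _ ag) qE q'E -[c]cE -mate_mv // eqxx andbT.
by move: hd pij (mvK hp); clear; case: (d) => /=; lia.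
Qed.

Lemma kiss_hom : is_hom (kiss_mx k lo (rdim M) a (rdim N) zz : 'M_(rdim M, rdim N)).
Proof.
move: (kiss_mx _ _ _ _ _ zz) kiss_ext => f fext.
have fE u v : f u v = (kiss_supp zz (lo + u) (a + v))%:R by rewrite -fext extE.
split=> x; apply/matrixP => u v.
  rewrite mxE [RHS]mxE (bigD1 u) //= big1 => [|u' uu]; last first.
    by rewrite (proj1 Mivl) eq_sym (negPf uu) mul0r.
  rewrite [RHS](bigD1 v) //= [X in _ = _ + X]big1 => [|v' vv]; last first.
    by rewrite (proj1 Nivl) (negPf vv) mulr0.
  rewrite (proj1 Mivl) (proj1 Nivl) !eqxx /= !addr0 fE.
  case sp: kiss_supp; last by rewrite mulr0 mul0r.
  by have [-> _ _] := kiss_supp_inner sp; rewrite mulr1 mul1r.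
rewrite arr_actl.
have [[q' hq]|nq] : (exists q', nxt s' q' x = Some (a + v)%N) \/
    forall q', nxt s' q' x <> Some (a + v)%N.
  case h: [exists d : bool, out s' d (a + v) == Some (x, false)].
    left; have /existsP[d /eqP hd] := h; exists (mv d (a + v)).
    by apply/(nxtP sC'); exists (~~ d); rewrite ?(out_mv hd) ?(mvK hd).
  right=> q' /(nxtP sC')[d h1 h2]; move/existsP: h; apply; exists (~~ d).
  by rewrite h2 (out_mv h1).
- rewrite (arr_actr _ _ hq) fext; case hp: nxt => [p|]; last first.
    case sp: kiss_supp => //; have [p' hp'] := kiss_supp_nxtr hq sp.
    by rewrite hp in hp'.
  rewrite fext; congr (nat_of_bool _)%:R; apply/idP/idP => sp.
    by have [q2 h2 sp2] := kiss_supp_nxt hp sp; rewrite (nxt_inj sC' hq h2).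
  by have [p2 h2 sp2] := kiss_supp_nxtr hq sp; move: h2; rewrite hp => -[->].
rewrite (arr_actr0 _ _ nq); case hp: nxt => [p|] //.
rewrite fext; case sp: kiss_supp => //.
by have [q2 /nq] := kiss_supp_nxt hp sp.
Qed.

End Kiss.

Lemma kiss_unique (z z2 : kiss_pos C C') p q : is_kiss z -> is_kiss z2 ->
  kiss_supp z p q -> kiss_supp z2 p q -> z = z2.
Proof.
case: z => [[i j] [i' j']]; case: z2 => [[i2 j2] [i2' j2']] hz hz2 sp sp2.
have pq := kiss_supp_inner hz sp.
have [e [al ag qE]] := kiss_aligned hz sp.
have [e2 [al2 ag2 qE2]] := kiss_aligned hz2 sp2.
have ee : e2 = e.
  case: (eqVneq e2 e) => // /eqb_neg ee; rewrite ee in al2.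
  by have [_ []] := aligned_xor gB sC sC' true e pq.
rewrite {}ee {al2} in ag2 qE2.
have [pij pij2] : (i <= p <= j)%N /\ (i2 <= p <= j2)%N.
  by move: sp sp2; rewrite (kiss_suppE hz _ _ ag) (kiss_suppE hz2 _ _ ag2) => /andP[-> _] /andP[-> _].
have ext_eq d : (if d then j - p else p - i)%N = (if d then j2 - p else p - i2)%N.
  have := kiss_extent hz d ag pij; have := kiss_extent hz2 d ag2 pij2.
  rewrite /= -qE -qE2 => -[h1 [x1 k1] [y1 m1]] [h2 [x2 k2] [y2 m2]].
  case: (ltngtP (if d then j - p else p - i)%N (if d then j2 - p else p - i2)%N) => // lt.
    by have := h1 _ lt; rewrite k2 m2.
  by have := h2 _ lt; rewrite k1 m1.
have [[len _] [len2 _]] := (ag, ag2).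
have [/andP[ij _] /andP[ij' _]] := kiss_ord hz; rewrite /= in ij ij'.
have [/andP[ij2 _] /andP[ij2' _]] := kiss_ord hz2; rewrite /= in ij2 ij2'.
have ei : i = i2 :> nat by have := ext_eq false; move: pij pij2; clear; lia.
have ej : j = j2 :> nat by have := ext_eq true; move: pij pij2; clear; lia.
have ei' : i' = i2' :> nat.
  by move: qE2; rewrite qE /mate ei ej; clear; case: (e); lia.
have ej' : j' = j2' :> nat by move: len len2 ei ej ei' ij' ij2'; clear; lia.
by congr ((_, _), (_, _)); apply/val_inj.
Qed.

(** A homomorphism that is nonzero at a pair of positions is constant and nonzero
    on the support of a kiss through it. *)
Lemma hom_kiss (f : 'M_(rdim M, rdim N)) p q : is_hom f -> ext lo a f p q != 0 ->
  exists z : kiss_pos C C', [/\ is_kiss z, kiss_supp z p q &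
    forall p2 q2, kiss_supp z p2 q2 -> ext lo a f p2 q2 = ext lo a f p q].
Proof.
move=> hf; set F := ext lo a f => Fpq.
have [hp hq] := ext_range Fpq.
have inn p1 q1 : F p1 q1 != 0 -> inner C C' p1 q1.
  move=> h; have [h1 /andP[_ h2]] := ext_range h.
  by apply: inner_of (hom_vertex hf h) => //; apply: leq_trans h2 _; case/andP: ab.
have pq := inn _ _ Fpq.
have [e al0] : exists e, aligned C C' true p e q.
  by have [[] ? _] := aligned_xor gB sC sC' true true pq; [exists true|exists false].
have al d : aligned C C' d p (d == e) q.
  by case: d; last have := aligned_neg gB sC sC' pq al0; case: (e) al0.
have [n1 P1] := extend hf Fpq (al true); have [n2 P2] := extend hf Fpq (al false).
pose n d := if d then n1 else n2.
have Pn d : [/\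
    forall t, (t <= n d)%N -> F (mvn d t p) (mvn (d == e) t q) = F p q,
    forall t, (t < n d)%N -> out s d (mvn d t p) = out s' (d == e) (mvn (d == e) t q),
    exists x, out s d (mvn d (n d) p) = Some (x, true),
    exists y, out s' (d == e) (mvn (d == e) (n d) q) = Some (y, false)
    & (d || (n d <= p)%N) && ((d == e) || (n d <= q)%N)] by case: d.
pose i0 := (p - n2)%N; pose j0 := (p + n1)%N.
pose i1 := (if e then q - n2 else q - n1)%N; pose j1 := (if e then q + n1 else q + n2)%N.
have rng d : (lo <= mvn d (n d) p <= hi)%N /\ (a <= mvn (d == e) (n d) q <= b)%N.
  by apply: (@ext_range f); rewrite -/F; have [-> // _ _ _ _] := Pn d.
have [abn [lo0 lohi' hiN]] := (ab, lohi).
have pn : (n2 <= p)%N by have [_ _ _ _ /andP[]] := Pn false.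
have qn : (if e then n2 <= q else n1 <= q)%N.
  have [_ _ _ _ /andP[_]] := Pn false; have [_ _ _ _ /andP[_]] := Pn true.
  by case: (e).
have [b1 b2] := rng true; have [b3 b4] := rng false; rewrite /mvn /n in b1 b2 b3 b4.
have ij0 : (i0 <= j0 <= size s)%N by rewrite /i0 /j0; move: b1 hiN; clear; lia.
have ij1 : (i1 <= j1 <= size s')%N.
  by rewrite /i1 /j1; move: b2 b4 abn; clear; case: (e) => /=; lia.
have len : (j0 - i0 = j1 - i1)%N.
  by rewrite /i0 /j0 /i1 /j1; move: pn qn; clear; case: (e) => /=; lia.
have mateE d t : (t <= n d)%N -> mate e i0 j0 i1 (mvn d t p) = mvn (d == e) t q.
  rewrite /mate /mvn /i0 /j0 /i1 /n; move: pn qn; clear.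
  by case: d; case: (e) => /=; lia.
have along p1 : (i0 <= p1 <= j0)%N -> exists d t, (t <= n d)%N /\ p1 = mvn d t p.
  rewrite /i0 /j0 => h; case: (leqP p p1) => h1.
    by exists true, (p1 - p)%N; rewrite /n /mvn; move: h h1; clear; lia.
  by exists false, (p - p1)%N; rewrite /n /mvn; move: h h1; clear; lia.
have Fc p1 : (i0 <= p1 <= j0)%N -> F p1 (mate e i0 j0 i1 p1) = F p q.
  by move=> /along[d [t [td ->]]]; rewrite mateE //; have [-> // _ _ _ _] := Pn d.
have ag : agree C C' e i0 j0 i1 j1.
  split=> // p1 p1ij; have F1 : F p1 (mate e i0 j0 i1 p1) != 0 by rewrite Fc.
  have in1 := inn _ _ F1; split=> [|d hd]; first by case: in1.
  case: (boolP (if d then p <= p1 else p1 <= p)%N) => side.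
    have [t td pE] : exists2 t, (t < n d)%N & p1 = mvn d t p.
      exists (if d then p1 - p else p - p1)%N; move: side hd p1ij pn;
        by rewrite /n /mvn /i0 /j0; clear; case: (d); lia.
    by have [_ h2 _ _ _] := Pn d; rewrite pE mateE ?h2 // ltnW.
  (* moving back towards p: the inverse of the letter crossed from the other     *)
  (* side                                                                        *)
  have [t td pE] : exists2 t, (t < n (~~ d))%N & p1 = mvn (~~ d) t.+1 p.
    exists (if d then (p - p1).-1 else (p1 - p).-1)%N; move: side hd p1ij pn;
      by rewrite /n /mvn /i0 /j0; clear; case: (d) => /=; lia.
  have F2 : F (mvn (~~ d) t p) (mvn (~~ d == e) t q) != 0.
    by have [h1 _ _ _ _] := Pn (~~ d); rewrite h1 // ltnW.
  have [x [y [hx hy]]] := inner_out (~~ d) (~~ d == e) (inn _ _ F2).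
  have xy : x = y by apply: Some_inj; have [_ h2 _ _ _] := Pn (~~ d); rewrite -hx -hy h2.
  have mS c u r : (if c then true else (u < r)%N) -> mv c (mvn c u r) = mvn c u.+1 r.
    by rewrite /mv /mvn; clear; case: c; lia.
  have pE2 : p1 = mv (~~ d) (mvn (~~ d) t p).
    by rewrite pE /mv /mvn; clear; case: (d) => /=; lia.
  have qE2 : mate e i0 j0 i1 p1 = mv (~~ d == e) (mvn (~~ d == e) t q).
    rewrite pE mateE // /mv /mvn; clear; case: (d); case: (e) => /=; lia.
  have := out_mv hx; have := out_mv hy; rewrite -pE2 -qE2 negbK xy => hy' ->.
  by rewrite -hy'; congr (out _ _ _); case: (d); case: (e).
have end0 d : mvn d (n d) p = if d then j0 else i0 by rewrite /mvn /n; case: d.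
have end1 d : mvn d (n (d == e)) q = if d then j1 else i1.
  by rewrite /mvn /n /i1 /j1; clear; case: d; case: (e).
have eqbK d : (d == e) == e = d by clear; case: d; case: (e).
have pin : (i0 <= p <= j0)%N by rewrite /i0 /j0; clear; lia.
have qE : q = mate e i0 j0 i1 p.
  by rewrite /mate /i0 /j0 /i1; move: qn pn; clear; case: (e); lia.
clearbody i0 j0 i1 j1.
have lti : (i0 < (wlen C).+1)%N by move: ij0; rewrite /wlen; clear; lia.
have ltj : (j0 < (wlen C).+1)%N by move: ij0; rewrite /wlen; clear; lia.
have lti' : (i1 < (wlen C').+1)%N by move: ij1; rewrite /wlen; clear; lia.
have ltj' : (j1 < (wlen C').+1)%N by move: ij1; rewrite /wlen; clear; lia.
pose z : kiss_pos C C' := ((Ordinal lti, Ordinal ltj), (Ordinal lti', Ordinal ltj')).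
have hz : is_kiss z.
  apply/kissP; split=> /=.
  - by case/andP: ij0.
  - by case/andP: ij1.
  - by move=> d; have [_ _ [x hx] _ _] := Pn d; exists x; rewrite -hx end0; case: (d).
  - move=> d; have [_ _ _ [y hy] _] := Pn (d == e); rewrite eqbK end1 in hy.
    by exists y; rewrite -hy; case: (d).
  case: (e) ag => ag'; first by have /(agree_factor sC sC' ij0 ij1) -> := ag'; rewrite eqxx.
  by have /(agree_factor_inv sC sC' ij0 ij1) -> := ag'; rewrite eqxx orbT.
exists z; split=> // [|p2 q2]; rewrite (kiss_suppE hz _ _ ag) /=.
  by rewrite pin -qE eqxx.
by move=> /andP[h /eqP ->]; apply: Fc.
Qed.

Theorem kiss_basis :
  hom_basis [seq kiss_mx k lo (rdim M) a (rdim N) z | z <- kisses C C'].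
Proof.
pose fs := [seq (kiss_mx k lo (rdim M) a (rdim N) z : 'M[k]_(rdim M, rdim N)) | z <- kisses C C'].
have mem_k z : (z \in kisses C C') = is_kiss z by rewrite mem_enum.
have uk : uniq (kisses C C') := enum_uniq _.
have supp_ex (z : kiss_pos C C') : is_kiss z -> exists (u : 'I_(rdim M)) (v : 'I_(rdim N)),
    kiss_supp z (lo + u) (a + v).
  case: z => [[i j] [i' j']] hz; have [h1 h2 h3 h4] := kiss_in hz.
  have [len _] := kiss_agree hz; have [/= ij ij'] := kiss_ord hz.
  have [u pu] : exists u : 'I_(rdim M), i = (lo + u)%N :> nat.
    by apply: inM; move: ij h1 h2; clear; lia.
  have [v qv] : exists v : 'I_(rdim N),
      mate (factor C i j == factor C' i' j') i j i' i = (a + v)%N.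
    by apply: inN; rewrite /mate; move: len ij ij' h3 h4; clear; case: eqP => _; lia.
  by exists u, v; rewrite /kiss_supp -pu -qv eqxx andbT; case/andP: ij => ->; rewrite leqnn.
(* the value at a point of the support of a kiss reads off its coefficient       *)
have entry (c : kiss_pos C C' -> k) (z : kiss_pos C C') (u : 'I_(rdim M)) (v : 'I_(rdim N)) :
    is_kiss z -> kiss_supp z (lo + u) (a + v) ->
    (\sum_(z <- kisses C C') c z *: (kiss_mx k lo (rdim M) a (rdim N) z : 'M_(rdim M, rdim N))) u v = c z.
  move=> hz sp; rewrite summxE (bigD1_seq z) ?mem_k //= big_seq_cond big1 => [|z2 /andP[]].
    by rewrite mxE kiss_mxE // sp mulr1 addr0.
  rewrite mem_k => hz2 zz2; rewrite mxE kiss_mxE //.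
  case sp2: kiss_supp; last by rewrite mulr0.
  by case/eqP: zz2; apply: kiss_unique hz2 hz sp2 sp.
have size_fs : size fs = size (kisses C C') by rewrite size_map.
pose zd := nth (ord0, ord0, (ord0, ord0)) (kisses C C').
have nth_fs i : (i < size (kisses C C'))%N ->
    fs`_i = (kiss_mx k lo (rdim M) a (rdim N) (zd i) : 'M_(rdim M, rdim N)).
  by move=> h; rewrite (nth_map (ord0, ord0, (ord0, ord0))).
split.
  change (is_true (free (in_tuple fs))); apply/freeP => c hc i; have lti := ltn_ord i.
  rewrite {2}size_fs in lti.
  have hz : is_kiss (zd i) by rewrite -mem_k mem_nth.
  have [u [v sp]] := supp_ex _ hz.
  pose c' z := if insub (index z (kisses C C')) is Some i then c i else 0.
  have := entry c' _ _ _ hz sp; have -> : c' (zd i) = c i.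
    by rewrite /c' index_uniq // valK.
  rewrite (big_nth (ord0, ord0, (ord0, ord0))) -size_fs big_mkord => <-.
  have := congr1 (fun A : 'M_(_, _) => A u v) hc; rewrite mxE => <-; congr (fun_of_matrix _ u v).
  apply: eq_bigr => j _; have ltj : (j < size (kisses C C'))%N by rewrite -size_fs.
  by rewrite /= nth_fs // /c' index_uniq // valK.
move=> f; split=> [hf|hf].
  rewrite (coord_span (X := in_tuple fs) hf).
  have homD (g h : 'M_(rdim M, rdim N)) c : is_hom g -> is_hom h -> is_hom (c *: g + h).
    move=> [g1 g2] [h1 h2]; split=> x; rewrite mulmxDr mulmxDl -scalemxAl -scalemxAr.
      by rewrite g1 h1.
    by rewrite g2 h2.
  elim/big_rec: _ => [|i g _ hg]; first by split=> x; rewrite mulmx0 mul0mx.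
  apply: homD => //; have lti := ltn_ord i; rewrite {2}size_fs in lti.
  rewrite /= nth_fs //; have : is_kiss (zd i) by rewrite -mem_k mem_nth.
  by case: (zd i) => [[? ?] [? ?]]; apply: kiss_hom.
(* the coefficient of a kiss is the value of f at any point of its support       *)
have pts (z : kiss_pos C C') : exists p, is_kiss z -> kiss_supp z (lo + p.1) (a + p.2).
  case hz: (is_kiss z); last by exists (0, 0)%N.
  by have [u [v sp]] := supp_ex _ hz; exists (val u, val v).
have {pts}[pt ptP] := fin_all_exists pts.
pose c z := ext lo a f (lo + (pt z).1) (a + (pt z).2).
have const z p q : is_kiss z -> kiss_supp z p q -> ext lo a f p q = c z.
  move=> hz sp; case: (eqVneq (c z) 0) => [c0|cn].
    case: (eqVneq (ext lo a f p q) 0) => [->//|fn].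
    have [z2 [hz2 sp2 h2]] := hom_kiss hf fn.
    by rewrite -(h2 _ _ (_ : kiss_supp z2 (lo + (pt z).1) (a + (pt z).2))) // (kiss_unique hz2 hz sp2 sp) ptP.
  have [z2 [hz2 sp2 h2]] := hom_kiss hf cn.
  by apply: h2; rewrite (kiss_unique hz2 hz sp2 (ptP _ hz)).
have -> : f = \sum_(z <- kisses C C') c z *: (kiss_mx k lo (rdim M) a (rdim N) z : 'M_(rdim M, rdim N)).
  apply/matrixP => u v; rewrite -[LHS](extE lo a).
  case: (eqVneq (ext lo a f (lo + u) (a + v)) 0) => [f0|fn].
    rewrite f0 summxE big_seq big1 // => z; rewrite mem_k => hz; rewrite mxE kiss_mxE //.
    case sp: kiss_supp; last by rewrite mulr0.
    by rewrite -(const _ _ _ hz sp) f0 mul0r.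
  have [z [hz sp _]] := hom_kiss hf fn.
  by rewrite (entry _ _ _ _ hz sp) (const _ _ _ hz sp).
rewrite big_seq; apply: memv_suml => z hz; apply: memvZ; apply: memv_span.
exact: map_f.
Qed.

End KissBasis.

Local Close Scope ring_scope.

(** * Fringed quivers and cohooks *)

Lemma string_rep_ivl (k : fieldType) (B : bquiver) (C : word B) :
  is_string C -> ivl_rep (string_rep k C) C 0.
Proof.
by move=> sC; split=> [x p q|a p q]; rewrite mxE // add0n nxt_step.
Qed.

Lemma factor_ivl (k : fieldType) (B : bquiver) (C : word B) i j :
  is_string C -> i <= j <= size C.2 -> ivl_rep (string_rep k (factor C i j)) C i.
Proof.
move=> sC ij; have [h1 h2] := string_rep_ivl k (is_string_factor ij sC).
have lt (p : 'I_(rdim (string_rep k (factor C i j)))) : p <= j - i.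
  by rewrite -(size_factor ij) -ltnS; apply: ltn_ord.
split=> [x p q|a p q]; first by rewrite h1 add0n vertex_at_factor.
by rewrite h2 !add0n nxt_factor.
Qed.

Lemma factor_factor (B : bquiver) (C : word B) i j a b :
  i <= j <= size C.2 -> a <= b <= j - i ->
  factor (factor C i j) a b = factor C (i + a) (i + b).
Proof.
move=> ij ab; rewrite {1}/factor vertex_at_factor //; last by move: ab; clear; lia.
rewrite /factor /=; congr pair.
have {1}-> : j - i = (j - i - a) + a by move: ab; clear; lia.
rewrite -take_drop drop_drop take_takel ?subnDl 1?addnC //.
by move: ab; clear; lia.
Qed.

Lemma is_string_mkword (B : bquiver) (x : Q0 B) w :
  is_string (mkword x w) = sorted (@follows B) w.
Proof. by case: w => [|l w] //=; rewrite /is_string /= eqxx. Qed.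

Section Fringe.
Variables (B : bquiver) (F : fringe B).
Hypothesis hF : is_fringing F.
Local Notation Bh := (fringed F).

Let gh : gentle Bh. Proof. by case: hF. Qed.
Let lh : locally_gentle Bh := gentle_local gh.

Definition old_letter (l : letter Bh) : bool := if l.1 is inl _ then true else false.

Lemma ltgt_new (l : letter Bh) f : ltgt l = inr f -> l = (inr f, ~~ inward f).
Proof.
case: l => [[a|g] b]; rewrite /ltgt /=; first by case: b.
by case: b; case i: (inward g) => // -[<-]; rewrite i.
Qed.

(** A fringe vertex lies on a single arrow, so no string passes through it. *)
Lemma follows_inl (l m : letter Bh) : follows l m -> exists x, ltgt l = inl x.
Proof.
move=> lm; case e: (ltgt l) => [x|f]; first by exists x.
have := follows_neq lm; have := follows_src lm; rewrite e -ltgt_linv.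
by move=> /ltgt_new em; rewrite (ltgt_new e) -em linvK eqxx.
Qed.

Lemma old_ends (l : letter Bh) x y : lsrc l = inl x -> ltgt l = inl y -> old_letter l.
Proof.
case: l => [[a|f] b] //; rewrite /old_letter /lsrc /ltgt /=.
by case: b; case: (inward f).
Qed.

Lemma old_src (l : letter Bh) : old_letter l -> exists x, lsrc l = inl x.
Proof.
case: l => [[a|f] b] // _; rewrite /lsrc /=.
by case: b; [exists (src a)|exists (tgt a)].
Qed.

(** Every vertex of B has two incoming and two outgoing arrows, of which the last
    letter of a string excludes one of each sort. *)
Lemma follows_ex (l : letter Bh) v b : ltgt l = inl v -> exists m, m.2 = b /\ follows l m.
Proof.
case: hF => _ deg _; have [_ _ _ rels] := lh.
have [din dout] := deg v.
case: l => a [] lv; case: b.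
- have sub : ~~ ([set c : Q1 Bh | src c == inl v] \subset [set c | composable a c & rel2 c a]).
    apply/negP => /subset_leq_card; rewrite dout => h.
    by have := leq_trans h (rels a).2.
  have /subsetPn[c] := sub; rewrite !inE negb_and => /eqP sc nc.
  exists (c, true); split=> //; rewrite followsDD sc -lv eqxx /=.
  by move: nc; rewrite /composable sc -lv eqxx.
- have sub : ~~ ([set c : Q1 Bh | tgt c == inl v] \subset [set a]).
    by apply/negP => /subset_leq_card; rewrite din cards1.
  have /subsetPn[c] := sub; rewrite !inE => /eqP sc nc.
  by exists (c, false); split=> //; rewrite followsDI sc -lv eqxx.
- have sub : ~~ ([set c : Q1 Bh | src c == inl v] \subset [set a]).
    by apply/negP => /subset_leq_card; rewrite dout cards1.
  have /subsetPn[c] := sub; rewrite !inE => /eqP sc nc.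
  by exists (c, true); split=> //; rewrite followsID sc -lv eqxx.
have sub : ~~ ([set c : Q1 Bh | tgt c == inl v] \subset [set c | composable c a & rel2 a c]).
  apply/negP => /subset_leq_card; rewrite din => h.
  by have := leq_trans h (rels a).1.
have /subsetPn[c] := sub; rewrite !inE negb_and => /eqP sc nc.
exists (c, false); split=> //; rewrite followsII sc -lv eqxx /=.
by move: nc; rewrite /composable sc -lv eqxx.
Qed.

(** ** Strings of B as strings of the fringed quiver *)

Definition emb (l : letter B) : letter Bh := (inl l.1, l.2).

Lemma emb_inj : injective emb.
Proof. by case=> [a b] [c d] [-> ->]. Qed.

Lemma embed_inj : injective (@embed B F).
Proof. by case=> [x w] [y w'] [-> /(inj_map emb_inj) ->]. Qed.

Lemma lsrc_emb l : lsrc (emb l) = inl (lsrc l).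
Proof. by case: l => a []. Qed.

Lemma ltgt_emb l : ltgt (emb l) = inl (ltgt l).
Proof. by case: l => a []. Qed.

Lemma follows_emb l m : follows (emb l) (emb m) = follows l m.
Proof.
case: hF => rel _ _.
case: l m => [a []] [c []]; rewrite ?(followsDD, followsDI, followsID, followsII) /= ?rel //.
Qed.

Lemma out_embed (C : word B) d p : out (embed F C).2 d p = omap emb (out C.2 d p).
Proof.
case: d; first by rewrite /out onth_map.
by case: p => // p; rewrite /out onth_map; case: (onth _ p).
Qed.

Lemma vertex_at_embed (C : word B) p : vertex_at (embed F C) p = inl (vertex_at C p).
Proof.
rewrite /vertex_at /= -map_take -map_comp -(last_map (inl : Q0 B -> Q0 Bh)) -map_comp.
by congr last; apply: eq_map => l; rewrite /= ltgt_emb.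
Qed.

Lemma is_string_embed (C : word B) : is_string (embed F C) = is_string C.
Proof.
apply/is_stringP/is_stringP => -[h1 h2]; split.
- move=> l h; have := h1 (emb l); rewrite onth_map h => /(_ erefl).
  by rewrite lsrc_emb => -[].
- move=> p l m hl hm; rewrite -follows_emb; apply: (h2 p).
    by rewrite onth_map hl.
  by rewrite onth_map hm.
- move=> l; rewrite onth_map; case h: (onth C.2 0) => [l'|] //= -[<-].
  by rewrite lsrc_emb (h1 _ h).
move=> p l m; rewrite !onth_map; case hl: (onth C.2 p) => [l'|] // -[<-].
case hm: (onth C.2 p.+1) => [m'|] // -[<-].
by rewrite follows_emb; apply: h2 hl hm.
Qed.

Lemma embed_factor (C : word B) i j : embed F (factor C i j) = factor (embed F C) i j.
Proof. by rewrite /factor -[RHS]/(_, _) vertex_at_embed /embed /= map_take map_drop. Qed.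

Lemma embed_ex (D : word Bh) x : D.1 = inl x -> all old_letter D.2 ->
  exists C : word B, embed F C = D.
Proof.
case: D => [_ w] /= -> old.
have [w' e] : exists w', map emb w' = w.
  elim: w old => [|[[a|f] b] w IH] //= ; first by exists [::].
  by move=> /IH[w' <-]; exists ((a, b) :: w').
by exists (x, w'); rewrite -e.
Qed.

Lemma nxt_embed (C : word B) p a : nxt (embed F C).2 p (inl a) = nxt C.2 p a.
Proof.
rewrite /nxt !out_embed; have e o : (omap emb o == Some (inl a, true)) = (o == Some (a, true)).
  by rewrite -[Some (inl a, true)]/(omap emb (Some (a, true))) (inj_eq (inj_omap emb_inj)).
by rewrite !e.
Qed.

Lemma nxt_embed_new (C : word B) p f : nxt (embed F C).2 p (inr f) = None.
Proof.
rewrite /nxt !out_embed.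
by case: (out C.2 true p) => [l|]; case: (out C.2 false p) => [m|] /=.
Qed.

Local Open Scope ring_scope.

Definition inflate (k : fieldType) (M : rep k B) : rep k Bh :=
  @Rep k Bh (rdim M) (fun x => if x is inl x then vtx M x else 0)
    (fun a => if a is inl a then arr M a else 0).

Lemma inflate_hom (k : fieldType) (M N : rep k B) (f : 'M_(rdim M, rdim N)) :
  is_hom (M := inflate M) (N := inflate N) f <-> is_hom f.
Proof.
split=> -[h1 h2]; split.
- by move=> x; apply: (h1 (inl x)).
- by move=> x; apply: (h2 (inl x)).
- by case=> [x|f'] /=; rewrite ?h1 // mul0mx mulmx0.
- by case=> [x|f'] /=; rewrite ?h2 // mul0mx mulmx0.
Qed.

Lemma inflate_ivl (k : fieldType) (X : word B) (C : word Bh) i j :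
  is_string X -> is_string C -> (i <= j <= size C.2)%N -> embed F X = factor C i j ->
  ivl_rep (inflate (string_rep k X)) C i.
Proof.
move=> sX sC ij e; have [h1 h2] := string_rep_ivl k sX.
have szX : size X.2 = (j - i)%N by rewrite -(size_factor ij) -e size_map.
have lt (p : 'I_(rdim (string_rep k X))) : (p <= j - i)%N.
  by rewrite -szX -ltnS; apply: ltn_ord.
split=> [x p q|a p q].
  rewrite -(@vertex_at_factor _ _ _ j) // -e vertex_at_embed.
  case: x => [x|f]; last by rewrite /= mxE andbF.
  by rewrite -[LHS]/(vtx (string_rep k X) x p q) h1 add0n.
rewrite -(nxt_factor ij sC) // -e; case: a => [a|f]; last by rewrite nxt_embed_new /= mxE.
by rewrite nxt_embed -[LHS]/(arr (string_rep k X) a p q) h2 !add0n.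
Qed.

End Fringe.

Lemma sorted_glue (T : Type) (e : rel T) (s1 s2 : seq T) x :
  sorted e (rcons s1 x) -> path e x s2 -> sorted e (s1 ++ x :: s2).
Proof.
by case: s1 => [|a s1] //=; rewrite rcons_path cat_path /= => /andP[-> ->].
Qed.

Section Cohook.
Variables (B : bquiver) (F : fringe B).
Hypothesis hF : is_fringing F.
Local Notation Bh := (fringed F).
Variables (Y : word B) (H : cohook_data Bh).
Hypothesis hH : is_cohook_data (embed F Y) H.
Local Notation CY := (cohook (embed F Y) H).
Local Notation D := (ch_D H).
Local Notation I := (ch_I H).
Local Notation L := (size (ch_D H)).
Local Notation n := (size Y.2).
Let al : letter Bh := (ch_alpha H, false).
Let be : letter Bh := (ch_beta H, true).
Let lh : locally_gentle Bh. Proof. by case: hF => _ _ /gentle_local. Qed.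

Lemma ch_seq : CY.2 = D ++ al :: (embed F Y).2 ++ be :: I.
Proof. by []. Qed.

Lemma ch_size : size CY.2 = L + n + (size I) + 2.
Proof. by rewrite ch_seq size_cat /= size_cat size_map /=; clear; lia. Qed.

Local Notation N := (size CY.2).

Lemma ch_D_letter t l : t < L -> onth CY.2 t = Some l -> l.2 = true.
Proof.
case: hH => _ [/andP[/allP dD _] _] _ _ tL; rewrite ch_seq onth_cat tL => h.
by apply: (dD l); apply/onthP; exists t.
Qed.

Lemma ch_alpha_letter : onth CY.2 L = Some al.
Proof. by rewrite ch_seq onth_cat ltnn subnn. Qed.

Lemma ch_beta_letter : onth CY.2 (L.+1 + n) = Some be.
Proof.
rewrite ch_seq onth_cat ltnNge addSnnS leq_addr /= addKn /=.
by rewrite onth_cat size_map ltnn subnn.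
Qed.

Lemma ch_I_letter t l : L.+1 + n < t -> onth CY.2 t = Some l -> l.2 = false.
Proof.
case: hH => _ _ [/andP[/allP dI _] _] _ tL.
have {tL}-> : t = L + ((n + (t - (L.+1 + n)).-1.+1).+1) by move: tL; clear; lia.
rewrite ch_seq onth_cat ltnNge leq_addr /= addKn /=.
rewrite onth_cat size_map ltnNge leq_addr /= addKn /= => h.
by apply/negbTE/(dI l)/onthP; eexists; apply: h.
Qed.

Lemma ch_string : is_string CY.
Proof.
case: hH => _ [/andP[_ +] _] [/andP[_ +] _]; rewrite !is_string_mkword => s1 s3 s2.
apply: sorted_glue s1 _; move: s2; rewrite /= !cat_path /= andbT.
by move=> /andP[-> ->].
Qed.

Let sC := ch_string.

(** If D began at a vertex of Q, it could be prolonged, against its maximality. *)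
Lemma ch_start : exists f, vertex_at CY 0 = inr f.
Proof.
case: hH => _ [/andP[dD s1] maxD] _ _; rewrite is_string_mkword in s1.
pose l0 := head al D; have -> : vertex_at CY 0 = lsrc l0.
  by rewrite vertex_at0 /cohook /mkword /= /l0; case: (D).
case e: (lsrc l0) => [x|f]; last by exists f.
have [m [m2 fm]] : exists m, m.2 = false /\ follows (linv l0) m.
  by apply: (follows_ex hF (v := x)); rewrite ltgt_linv.
suff h : all (@direct Bh) (linv m :: D) &&
    is_string (mkword (lsrc al) (rcons (linv m :: D) al)).
  by have := maxD _ h; rewrite /= ltnn.
rewrite is_string_mkword /= dD /direct /= m2 /=.
have := fm; rewrite -follows_linv linvK /l0; move: s1.
by case: (D) => [|d D'] //= s1 h; rewrite ?h ?s1.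
Qed.

Lemma ch_end : exists f, vertex_at CY N = inr f.
Proof.
case: hH => _ _ [/andP[dI s1] maxI] _; rewrite is_string_mkword in s1.
have -> : vertex_at CY N = ltgt (last be I).
  by rewrite /vertex_at take_size ch_seq map_cat last_cat /= map_cat last_cat /= last_map.
case e: (ltgt _) => [x|f]; last by exists f.
have [m [m2 fm]] := follows_ex hF false e.
suff h : all (fun l => ~~ direct l) (rcons I m) &&
    is_string (mkword (lsrc be) (be :: rcons I m)).
  by have := maxI _ h; rewrite size_rcons ltnn.
by rewrite is_string_mkword all_rcons dI /direct m2 /= rcons_path fm andbT; exact: s1.
Qed.

Lemma ch_inner p : 0 < p < N -> exists x, vertex_at CY p = inl x.
Proof.
move=> hp; have [m hm] : exists m, out CY.2 false p = Some m.
  by apply: out_some; move: hp; clear; lia.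
have [l hl] : exists l, out CY.2 true p = Some l by apply: out_some; case/andP: hp.
have [x] := follows_inl (out_follows sC (d := true) hm hl).
by rewrite ltgt_linv (out_src sC hm); exists x.
Qed.

Lemma ch_inner_old t l : 0 < t -> t.+1 < N -> onth CY.2 t = Some l -> old_letter l.
Proof.
move=> t0 tN h.
have [x hx] : exists x, vertex_at CY t = inl x by apply: ch_inner; rewrite t0 ltnW.
have [y hy] : exists y, vertex_at CY t.+1 = inl y by apply: ch_inner.
apply: (@old_ends _ _ l x y); first by rewrite -hx (out_src sC (d := true) h).
by rewrite -hy (vertex_atS h).
Qed.

Lemma ch_first_new l : onth CY.2 0 = Some l -> ~~ old_letter l.
Proof.
move=> h; have [f] := ch_start; rewrite -(out_src sC (d := true) h) => e.
by apply/negP => /old_src[x]; rewrite e.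
Qed.

Lemma ch_last_new l : onth CY.2 N.-1 = Some l -> ~~ old_letter l.
Proof.
move=> h; have [f] := ch_end; have -> : N = N.-1.+1 by rewrite ch_size; clear; lia.
rewrite (vertex_atS h) => e; apply/negP => /(@old_src _ _ (linv l))[x].
by rewrite lsrc_linv e.
Qed.

(** All interior vertices of a cohook lie in Q, so the arrow alpha is new exactly
    if its inverse is the first letter. *)
Lemma ch_alpha_old : old_letter al = (0 < L).
Proof.
case: ltnP => L0.
  apply: (@ch_inner_old L) => //; last exact: ch_alpha_letter.
  by rewrite ch_size; clear; lia.
apply/negbTE/ch_first_new; rewrite -ch_alpha_letter; congr onth.
by move: L0; clear; lia.
Qed.

Lemma ch_beta_old : old_letter be = (0 < size I).
Proof.
case: ltnP => L0.
  apply: (@ch_inner_old (L.+1 + n)) => //; last exact: ch_beta_letter.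
  by rewrite ch_size; move: L0; clear; lia.
apply/negbTE/ch_last_new; rewrite -ch_beta_letter; congr onth.
by rewrite ch_size; move: L0; clear; lia.
Qed.

Lemma ch_factor : factor CY L.+1 (L.+1 + n) = embed F Y.
Proof.
have [e _ _ _] := hH; rewrite /factor (vertex_atS ch_alpha_letter) [ltgt _]e.
rewrite addKn; congr pair.
rewrite ch_seq -cat_rcons drop_cat size_rcons ltnn subnn drop0.
by rewrite -[X in take X](size_map (@emb B F)) take_size_cat.
Qed.

Lemma ch_Y_end d l : out CY.2 d (if d then L.+1 + n else L.+1) = Some l -> l.2 = true.
Proof.
by case: d; rewrite /out ?ch_beta_letter ?ch_alpha_letter /= => -[<-].
Qed.

Lemma ch_Y_beyond d p l : (if d then L.+1 + n < p else p < L.+1) ->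
  out CY.2 d p = Some l -> l.2 = false.
Proof.
case: d; rewrite /out; first exact: ch_I_letter.
case: p => // p pL; case h: (onth _ p) => [m|] // [<-] /=.
by rewrite (ch_D_letter _ h).
Qed.

Lemma ch_zigzag : zigzag CY L (L + n + 2) (fun=> true).
Proof.
have szN := ch_size; split.
- by clear; lia.
- by rewrite szN; clear; lia.
- by move=> _ _; clear; lia.
- case=> [] [|p] l hp; rewrite /out //.
  + by apply: ch_I_letter; move: hp; clear; lia.
  + by apply: ch_I_letter; move: hp; clear; lia.
  + case e: (onth _ p) => [m|] // [<-] /=; rewrite (ch_D_letter _ e) //.
- case=> l _; rewrite /out /=.
    have -> : L + n + 2 = (L.+1 + n).+1 by clear; lia.
    by rewrite ch_beta_letter => -[<-].
  by rewrite ch_alpha_letter => -[<-].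
move=> d l _ ls; set e := if d then _ else _ in ls *.
have [f ef] : exists f, vertex_at CY e = inr f.
  by rewrite /e; case: (d); [apply: ch_end|apply: ch_start].
have [m hm] : exists m, out CY.2 (~~ d) e = Some m.
  by apply: out_some; rewrite /e szN; clear; case: (d) => /=; lia.
exists m => //; apply/negP => /follows_inl[x].
by rewrite ltgt_linv (out_src sC hm) ef.
Qed.

(** * The core of a cohook *)

(** The core of the cohook: what remains when the two letters incident with
    fringe vertices are removed is a string of B. *)
Lemma ch_core : exists S : word B, embed F S = factor CY 1 N.-1.
Proof.
have iN : 1 <= N.-1 <= N by rewrite ch_size; clear; lia.
have [x hx] : exists x, vertex_at CY 1 = inl x.
  by apply: ch_inner; rewrite ch_size; clear; lia.
apply: (embed_ex (x := x)) => //.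
apply/allP => l /onthP[t ht].
have tN : t < N.-1 - 1 by rewrite -(size_factor iN) -onthTE ht.
move: ht; rewrite onth_factor // add1n; apply: ch_inner_old => //.
by move: tN; clear; lia.
Qed.

End Cohook.

Section FindOnth.
Variables (T : Type) (a : pred T).
Implicit Types (s : seq T).

Lemma onth_before_find s p x : p < find a s -> onth s p = Some x -> a x = false.
Proof. by move=> h e; have := before_find x h; rewrite (onth_nth _ _ _ _ e). Qed.

Lemma onth_find s x : onth s (find a s) = Some x -> a x.
Proof.
move=> e; have hs : has a s by rewrite has_find -onthTE e.
by have := nth_find x hs; rewrite (onth_nth _ _ _ _ e).
Qed.

Lemma onth_after_rfind s p x : size s - find a (rev s) <= p -> onth s p = Some x -> a x = false.
Proof.
move=> h e; have ps : p < size s by rewrite -onthTE e.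
apply: (@onth_before_find (rev s) (size s - p.+1)).
  by have := find_size a (rev s); rewrite size_rev; move: h ps; clear; lia.
by rewrite onth_rev -?e; [congr onth|]; move: ps; clear; lia.
Qed.

Lemma onth_rfind s x : onth s (size s - find a (rev s)).-1 = Some x ->
  0 < size s - find a (rev s) -> a x.
Proof.
move=> e h; apply: (@onth_find (rev s)); rewrite onth_rev -?e; last by move: h; clear; lia.
by congr onth; move: h; clear; lia.
Qed.

End FindOnth.

Section Core.
Variables (B : bquiver) (F : fringe B).
Hypothesis hF : is_fringing F.
Local Notation Bh := (fringed F).
Variables (Y : word B) (H : cohook_data Bh).
Hypothesis hH : is_cohook_data (embed F Y) H.
Local Notation CY := (cohook (embed F Y) H).
Local Notation I := (ch_I H).
Local Notation L := (size (ch_D H)).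
Local Notation n := (size Y.2).
Local Notation N := (size CY.2).
Local Notation al := ((ch_alpha H, false) : letter Bh).
Local Notation be := ((ch_beta H, true) : letter Bh).
Variable S : word B.
Hypothesis eS : embed F S = factor CY 1 N.-1.
Let sC : is_string CY := ch_string hH.
Let szN : N = L + n + size I + 2 := ch_size Y H.

Let lh : locally_gentle Bh. Proof. by case: hF => _ _ /gentle_local. Qed.

Let iN : 1 <= N.-1 <= N.
Proof. by rewrite szN; clear; lia. Qed.

Lemma core_size : size S.2 = L + n + size I.
Proof.
have := size_factor iN; rewrite -eS size_map szN => ->; clear; lia.
Qed.

Lemma core_string : is_string S.
Proof. by rewrite -(is_string_embed hF) eS; apply: is_string_factor. Qed.

Lemma core_letter p : p < size S.2 -> onth CY.2 p.+1 = omap (@emb B F) (onth S.2 p).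
Proof.
move=> pS; rewrite -onth_map -[map _ _]/((embed F S).2) eS onth_factor ?add1n //.
by move: pS; rewrite core_size szN; clear; lia.
Qed.

Lemma core_letterE p l : onth S.2 p = Some l -> onth CY.2 p.+1 = Some (emb F l).
Proof. by move=> h; rewrite core_letter ?h // -onthTE h. Qed.

(** A side of the core ends in a valley exactly if alpha, respectively beta, is an
    arrow of B.  Then the interval ends where this arrow does; otherwise it ends
    at the first peak from the left, respectively the last one from the right. *)
Definition core_ty (d : bool) : bool := if d then 0 < size I else 0 < L.
Definition core_w0 : nat := if 0 < L then L.-1 else find (@direct B) S.2.
Definition core_w1 : nat := if 0 < size I then (L + n).+1
  else size S.2 - find (fun l => ~~ direct l) (rev S.2).
Local Notation w0 := core_w0.
Local Notation w1 := core_w1.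

Let left_out p l : p < w0 -> onth S.2 p = Some l -> l.2 = (0 < L).
Proof.
rewrite /w0; case: (ltnP 0 L) => L0 pw h; last exact: (onth_before_find pw h).
by have := core_letterE h; apply: (@ch_D_letter _ _ _ _ hH); move: pw; clear; lia.
Qed.

Let left_in l : onth S.2 w0 = Some l -> l.2 = ~~ (0 < L).
Proof.
rewrite /w0; case: (ltnP 0 L) => L0 h; last exact: (onth_find h).
have := core_letterE h; rewrite prednK // ch_alpha_letter => -[_ <-].
by [].
Qed.

Let right_out p l : w1 <= p -> onth S.2 p = Some l -> l.2 = ~~ (0 < size I).
Proof.
rewrite /w1; case: (ltnP 0 (size I)) => L0 pw h.
  by apply: (@ch_I_letter _ _ _ _ hH _ (emb F l) _ (core_letterE h)); move: pw; clear; lia.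
by apply/negbFE; apply: (onth_after_rfind pw h).
Qed.

Let right_in l : 0 < w1 -> onth S.2 w1.-1 = Some l -> l.2 = (0 < size I).
Proof.
rewrite /w1; case: (ltnP 0 (size I)) => L0 pw h.
  have := core_letterE h; have -> : (L + n).+1.-1.+1 = L.+1 + n by clear; lia.
  by rewrite ch_beta_letter => -[_ <-].
by apply/negbTE; apply: (onth_rfind h pw).
Qed.

Lemma core_bounds : [/\ w0 <= w1, w1 <= size S.2 & forall d, core_ty d -> w0 < w1].
Proof.
have szS := core_size.
have w0S : w0 <= size S.2.
  by rewrite /w0; case: (ltnP 0 L) => L0; [rewrite szS; move: L0; clear; lia|exact: find_size].
have w1S : w1 <= size S.2.
  by rewrite /w1; case: (ltnP 0 (size I)) => I0; [rewrite szS; move: I0; clear; lia|exact: leq_subr].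
have strict d : core_ty d -> w0 < w1.
  rewrite ltnNge; case: d => /= ty; apply/negP => w10.
    (* the letter beta, at position L + n of the core, is direct                 *)
    have w1E : w1 = (L + n).+1 by rewrite /w1 ty.
    have [l hl] : exists l, onth S.2 (L + n) = Some l.
      by apply: (out_some (d := true)); rewrite szS /=; move: ty; clear; lia.
    have l2 : l.2 = true.
      by apply: etrans ty; apply: right_in; rewrite w1E.
    case: (ltnP 0 L) => L0.
      by move: w10; rewrite w1E /w0 L0 /=; clear; lia.
    have := left_out (_ : L + n < w0) hl; rewrite l2 (leqNgt 1) ltnS L0 => /(_ _)/eqP.
    by rewrite -w1E => /(_ w10).
  have w0E : w0 = L.-1 by rewrite /w0 ty.
  have [l hl] : exists l, onth S.2 w0 = Some l.
    by apply: (out_some (d := true)); rewrite szS w0E /=; move: ty; clear; lia.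
  have := left_in hl; rewrite ty => l2.
  case: (ltnP 0 (size I)) => I0.
    by move: w10; rewrite w0E /w1 I0 /=; clear; lia.
  by have := right_out w10 hl; rewrite l2 ltnNge I0.
split=> //; rewrite leqNgt; apply/negP => lt.
case L0 : (core_ty false); first by have := strict false L0; move: lt; clear; lia.
case I0 : (core_ty true); first by have := strict true I0; move: lt; clear; lia.
have [l hl] : exists l, onth S.2 w1 = Some l.
  by apply: (out_some (d := true)); apply: leq_trans lt w0S.
have := left_out lt hl; have := right_out (leqnn _) hl.
by rewrite -[0 < L]/(core_ty false) L0 -[0 < size I]/(core_ty true) I0 => ->.
Qed.

(** The core cannot be prolonged within B: at either end the cohook continues by a
    new letter of the sign in question, and a string has only one continuation of
    each sign. *)
Lemma core_zigzag : zigzag S w0 w1 core_ty.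
Proof.
have [le1 le2 strict] := core_bounds; split=> //.
- case=> [] [|p] l hp; rewrite /out //; try exact: right_out.
  by case e: (onth _ p) => [m|] // [<-] /=; rewrite (left_out _ e).
- case=> l w01; last exact: left_in.
  have w10 : 0 < w1 by apply: leq_ltn_trans w01.
  rewrite /out /= -(prednK w10); case e: (onth _ _) => [m|] // [<-] /=.
  by rewrite (right_in _ e).
move=> d l l2 ls; set e := if d then _ else _ in ls *.
have szS := core_size.
pose P := e.+1.
have PS : P <= N.-1 /\ 1 <= P by rewrite /P /e szN szS; clear; case: (d); lia.
have vP : vertex_at CY P = inl (vertex_at S e).
  rewrite -vertex_at_embed eS vertex_at_factor //.
  by rewrite /e szN szS; clear; case: (d); lia.
have [x hx] : exists x, out CY.2 d P = Some x.
  by apply: out_some; rewrite /P /e szN szS; clear; case: (d); lia.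
have [m' hm'] : exists m', out CY.2 (~~ d) P = Some m'.
  by apply: out_some; rewrite /P /e szN szS; clear; case: (d) => /=; lia.
have x2 : x.2 = ~~ core_ty d.
  move: hx; rewrite /P /e /core_ty; case: (d); rewrite /out.
    case: (ltnP 0 (size I)) => I0.
      by apply: (@ch_I_letter _ _ _ _ hH); rewrite szS; move: I0; clear; lia.
    have -> : (size S.2).+1 = L.+1 + n by rewrite szS; move: I0; clear; lia.
    by rewrite ch_beta_letter => -[<-].
  case: (ltnP 0 L) => L0.
    by case e0: (onth _ 0) => [y|] // [<-]; rewrite /= (ch_D_letter hH L0 e0).
  have -> : 0 = L by move: L0; clear; lia.
  by rewrite ch_alpha_letter => -[<-].
have xnew : ~~ old_letter x.
  move: hx; rewrite /P /e; case: (d); rewrite /out.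
    have -> : (size S.2).+1 = N.-1 by rewrite szN szS; clear; lia.
    exact: ch_last_new.
  by case e0: (onth _ 0) => [y|] // [<-]; have := ch_first_new hF hH e0.
have fx := out_follows sC hm' hx.
have nfl : ~~ follows (linv m') (emb F l).
  apply/negP => fl; move: xnew.
  have ex : emb F l = x by apply: (follows_inj lh fl fx); rewrite x2 -l2.
  by rewrite -ex.
case hm: (out S.2 (~~ d) e) => [m|]; last first.
  case/negP: nfl.
  (* the core is lazy and both neighbours of its vertex are new                  *)
  have S0 : size S.2 = 0.
    by have := isSome_out S.2 (~~ d) e; rewrite hm /e; clear; case: (d) => /= /esym; lia.
  have L0 : L = 0 by move: szS; rewrite S0; clear; lia.
  have I0 : size I = 0 by move: szS; rewrite S0; clear; lia.
  have o0 : out CY.2 false 1 = Some (linv al).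
    by rewrite /out -[X in onth _ X]L0 ch_alpha_letter.
  have o1 : out CY.2 true 1 = Some be.
    rewrite /out -(ch_beta_letter Y H); congr onth.
    by move: szS; rewrite S0; clear; lia.
  have m'E : m' = if d then linv al else be.
    move: hm'; rewrite /P /e S0 if_same; case: (d); first by rewrite o0 => -[<-].
    by rewrite o1 => -[<-].
  have m'2 : m'.2 = true by rewrite m'E; case: (d).
  have m'new : ~~ old_letter m'.
    have := ch_alpha_old hF hH; have := ch_beta_old hF hH; rewrite L0 I0 => b_new a_new.
    by rewrite m'E; case: (d); [rewrite -[old_letter _]/(old_letter al) a_new|rewrite b_new].
  have lt : l.2 = true by rewrite l2 /core_ty L0 I0 if_same.
  have src1 := out_src sC hm'; rewrite vP -ls -lsrc_emb in src1.
  case: m' m'2 m'new src1 {hm' fx m'E} => [c b] /= -> cn src1.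
  case: l lt src1 {l2 ls} => [c' b'] /= -> src1; rewrite followsID.
  have -> : src (inl c' : Q1 Bh) = src c by rewrite -[LHS]/(lsrc (emb F (c', true))) -src1.
  by rewrite eqxx; apply/eqP => /= cE; rewrite -cE in cn.
exists m => //; rewrite -(follows_emb hF); suff -> : emb F (linv m) = linv m' by [].
have : out (embed F S).2 (~~ d) e = Some (emb F m) by rewrite out_embed hm.
rewrite eS out_factor // ?add1n ?hm' => [[->]|]; first by [].
have := isSome_out S.2 (~~ d) e; rewrite hm /e szN szS; clear; case: (d) => /= /esym; lia.
Qed.

Lemma core_Y : factor S L (L + n) = Y.
Proof.
apply: (@embed_inj _ F); rewrite embed_factor eS factor_factor //.
  by rewrite !add1n -addSn ch_factor.
by rewrite szN; clear; lia.
Qed.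

Lemma core_y0 : y0 w0 core_ty = L.
Proof. by rewrite /y0 /core_ty /w0; case: (posnP L) => [->|L0] //=; rewrite prednK. Qed.

Lemma core_y1 : y1 S w1 core_ty = L + n.
Proof.
by rewrite /y1 /core_ty /w1 core_size; case: (posnP (size I)) => [->|I0] //=; rewrite addn0.
Qed.

(** The ends of the translate, given by the negated type. *)
Definition core_t0 : nat := y0 w0 (fun d => ~~ core_ty d).
Definition core_t1 : nat := y1 S w1 (fun d => ~~ core_ty d).
Local Notation t0 := core_t0.
Local Notation t1 := core_t1.

Lemma core_t0E : t0 = if 0 < L then 0 else w0.+1.
Proof. by rewrite /t0 /y0 /=; case: (0 < L). Qed.

Lemma core_t1E : t1 = if 0 < size I then size S.2 else w1.-1.
Proof. by rewrite /t1 /y1 /=; case: (0 < size I). Qed.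

Lemma core_t01 : w0 < w1 -> t0 <= t1 <= size S.2.
Proof.
move=> w01; have := zz_ylen (zigzag_flip w01 core_zigzag).
rewrite /y1 size_map -/(y1 S w1 (fun d => ~~ core_ty d)) -/t0 -/t1 => -> /=.
have [_ h _] := core_bounds; rewrite core_t1E.
by case: (0 < size I) => //; apply: leq_trans (leq_pred _) h.
Qed.

Let has_onth (a : pred (letter B)) (s : seq (letter B)) p l :
  onth s p = Some l -> a l -> has a s.
Proof. by move=> h al'; apply/hasP; exists l => //; apply/onthP; exists p. Qed.

Lemma core_has_inverse : size I = 0 ->
  has (fun l => ~~ direct l) (drop t0 S.2) = (w0 < w1).
Proof.
move=> I0; have [le1 le2 strict] := core_bounds.
have onth_dropE p : onth (drop t0 S.2) p = onth S.2 (t0 + p).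
  by rewrite !onthE map_drop nth_drop.
apply/idP/idP => [/hasP[l /onthP[p hp] nl]|w01].
  rewrite onth_dropE in hp; case: (ltnP 0 L) => L0; first exact: (strict false).
  have pw : t0 + p < w1.
    rewrite ltnNge; apply/negP => h; have := right_out h hp.
    by rewrite I0 /= => l2; rewrite /direct l2 in nl.
  by move: pw; rewrite core_t0E (ltnNge 0 L) L0 /=; clear; lia.
have w10 : 0 < w1 by apply: leq_ltn_trans w01.
have [l hl] : exists l, onth S.2 w1.-1 = Some l.
  by apply: (out_some (d := true)); rewrite /= prednK.
have l2 := right_in w10 hl; rewrite I0 in l2.
have t0w : t0 <= w1.-1.
  rewrite core_t0E; case: (ltnP 0 L) => L0 //.
  case: (ltnP w0 w1.-1) => // h; have wE : w0 = w1.-1 by move: h w01; clear; lia.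
  by have := left_in (l := l); rewrite wE hl l2 (ltnNge 0 L) L0 => /(_ erefl).
apply: (@has_onth _ _ (w1.-1 - t0) l); last by rewrite /direct l2.
by rewrite onth_dropE -hl; congr onth; move: t0w; clear; lia.
Qed.

(** The deletions are possible exactly if the interval is not a single peak, and
    then they stop at the ends of the translate.  The core begins at position 1 of
    the cohook, whence the shift by one. *)
Lemma core_tau_interval : tau_interval (embed F Y) H =
  if w0 < w1 then Some (t0.+1, t1.+1) else None.
Proof.
have -> : tau_interval (embed F Y) H =
    let oa := old_letter al in let ob := old_letter be in
    let a0 := if oa then 1 else L.+1 in
    let b0 := if ob then N.-1 else L.+1 + wlen (embed F Y) in
    let r := (factor CY a0 b0).2 in
    if ~~ oa && ~~ has (@direct _) r then None else
    let a := if oa then a0 else a0 + (find (@direct _) r).+1 in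
    let r' := (factor CY a b0).2 in
    if ~~ ob && ~~ has (fun l => ~~ direct l) r' then None else
    Some (a, if ob then b0 else b0 - (find (fun l => ~~ direct l) (rev r')).+1) by [].
rewrite (ch_alpha_old hF hH) (ch_beta_old hF hH).
have [le1 le2 strict] := core_bounds; have szS := core_size.
set oa := 0 < L; set ob := 0 < size I; cbv zeta.
have -> : (if oa then 1 else L.+1) = 1 by rewrite /oa; case: (posnP L) => [->|].
have -> : (if ob then N.-1 else L.+1 + wlen (embed F Y)) = N.-1.
  by rewrite /wlen size_map szN /ob; case: (posnP (size I)) => [->|//] /=; clear; lia.
have -> : (factor CY 1 N.-1).2 = map (@emb B F) S.2 by rewrite -eS.
rewrite has_map find_map.
rewrite -[has _ _]/(has (@direct B) S.2) -[find _ S.2]/(find (@direct B) S.2).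
case: (boolP (~~ oa && ~~ has (@direct B) S.2)) => [/andP[noa nd]|hd].
  have w0E : w0 = size S.2.
    by rewrite /w0 -/oa (negPf noa); apply/eqP; rewrite eqn_leq find_size leqNgt -has_find.
  by rewrite w0E ltnNge le2.
have -> : (if oa then 1 else 1 + (find (@direct B) S.2).+1) = t0.+1.
  by rewrite core_t0E -/oa /w0 -/oa; case: (oa).
have t0S : t0 <= size S.2.
  rewrite core_t0E -/oa; case oaE: (oa) => //; move: hd; rewrite oaE /= negbK has_find.
  by rewrite /w0 -/oa oaE.
have szS' : N.-1 = (size S.2).+1 by rewrite szN szS; clear; lia.
have -> : (factor CY t0.+1 N.-1).2 = map (@emb B F) (drop t0 S.2).
  have := factor_factor (a := t0) (b := size S.2) iN; rewrite szS' !add1n => <-.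
    rewrite -szS' -eS /factor /= -map_drop -(size_map (@emb B F)) -size_drop.
    by rewrite -map_drop take_oversize ?size_map // size_drop.
  by rewrite t0S; clear; lia.
rewrite has_map -map_rev find_map.
rewrite -[has _ _]/(has (fun l => ~~ direct l) (drop t0 S.2)).
rewrite -[find _ (rev _)]/(find (fun l => ~~ direct l) (rev (drop t0 S.2))).
case obE: ob.
  by rewrite (strict true obE) core_t1E -/ob obE szS'.
have I0 : size I = 0 by move: obE; rewrite /ob; clear; lia.
rewrite core_has_inverse //; case: (ltnP w0 w1) => //= w01.
congr (Some (_, _)); rewrite core_t1E -/ob obE.
have h : has (fun l => ~~ direct l) (rev (drop t0 S.2)) by rewrite has_rev core_has_inverse.
have -> : find (fun l => ~~ direct l) (rev (drop t0 S.2)) =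
          find (fun l => ~~ direct l) (rev S.2).
  by rewrite -[in RHS](cat_take_drop t0 S.2) rev_cat find_cat h.
have w1E : w1 = size S.2 - find (fun l => ~~ direct l) (rev S.2) by rewrite /w1 -/ob obE.
rewrite szS'; have := find_size (fun l => ~~ direct l) (rev S.2); rewrite size_rev.
by move: w1E w01 le2; clear; lia.
Qed.

Lemma core_T_end d l : w0 < w1 ->
  out CY.2 d (if d then t1.+1 else t0.+1) = Some l -> l.2 = false.
Proof.
move=> w01; have [le1 le2 _] := core_bounds; have szS := core_size.
case: d; rewrite /out.
  rewrite core_t1E; case: (ltnP 0 (size I)) => I0.
    by apply: (@ch_I_letter _ _ _ _ hH); rewrite szS; move: I0; clear; lia.
  have w10 : 0 < w1 by apply: leq_ltn_trans w01.
  rewrite core_letter ?prednK //; case h: (onth _ _) => [m|] // [<-].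
  by rewrite /= (right_in w10 h) (ltnNge 0 (size I)) I0.
rewrite core_t0E; case: (ltnP 0 L) => L0.
  by case h: (onth _ _) => [m|] // [<-]; rewrite /= (ch_D_letter hH L0 h).
rewrite core_letter; last by apply: leq_trans w01 le2.
by case h: (onth _ _) => [m|] // [<-]; rewrite /= (left_in h) (ltnNge 0 L) L0.
Qed.

Lemma core_T_beyond d p l : (if d then t1.+1 < p else p < t0.+1) ->
  out CY.2 d p = Some l -> l.2 = true.
Proof.
have [le1 le2 _] := core_bounds; have szS := core_size.
case: d => hp h; have := isSome_out CY.2; move=> /(_ _ p) ho.
  have pN : p < N by have := ho true; rewrite h /= => <-.
  move: hp h; rewrite core_t1E /out; case: (ltnP 0 (size I)) => I0 hp h.
    by move: hp pN; rewrite szN szS; clear; lia.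
  case: p hp h pN {ho} => // p hp h pN; case: (ltnP p (size S.2)) => pS.
    move: h; rewrite core_letter //; case h: (onth _ _) => [m|] // [<-].
    have w1p : w1 <= p by move: hp; clear; lia.
    by rewrite /= (right_out w1p h) (ltnNge 0 (size I)) I0.
  move: h; have -> : p.+1 = L.+1 + n by move: pN pS; rewrite szN szS; clear -I0; lia.
  by rewrite ch_beta_letter => -[<-].
move: hp h {ho}; rewrite core_t0E /out; case: (ltnP 0 L) => L0 /=; case: p => // p hp.
case: p hp => [|p] hp.
  have -> : 0 = L by move: L0; clear; lia.
  by rewrite ch_alpha_letter => -[<-].
have pw : p < w0 by move: hp; clear; lia.
have [w0S pS] : w0 <= size S.2 /\ p < size S.2 by move: pw le1 le2; clear; lia.
rewrite core_letter //; case h: (onth _ _) => [m|] // [<-].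
by rewrite /= (left_out pw h) (ltnNge 0 L) L0.
Qed.

(** If the translate vanishes, no direct letter of the cohook is followed later
    by an inverse one, so that the cohook receives no kiss. *)
Lemma core_no_kiss (C : word Bh) (z : kiss_pos C CY) : w0 = w1 -> ~~ is_kiss z.
Proof.
move=> w01; have [le1 le2 strict] := core_bounds; have szS := core_size.
have L0 : L = 0.
  by case: (posnP L) => // h; have := strict false h; rewrite w01 ltnn.
have I0 : size I = 0.
  by case: (posnP (size I)) => // h; have := strict true h; rewrite w01 ltnn.
apply/negP; case: z => [[i j] [i' j']] /kissP[_ ij' _ h _].
have [x hx] : exists x, out CY.2 false i' = Some (x, false) := h false.
have [y hy] : exists y, out CY.2 true j' = Some (y, false) := h true.
have jN : j' < N by have := isSome_out CY.2 true j'; rewrite hy => <-.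
case: (nat_of_ord i') ij' hx => [|[|p]] // ij' hx.
  move: hx; have o0 : onth CY.2 0 = Some al by rewrite -(ch_alpha_letter Y H) L0.
  by rewrite /out o0.
have pS : p < size S.2 by move: ij' jN; rewrite szN szS; clear; lia.
have pw : w1 <= p.
  rewrite leqNgt; apply/negP => lt; move: hx; rewrite -w01 in lt.
  rewrite /out core_letter //; case e: (onth _ _) => [m|] // [_] /=.
  by rewrite (left_out lt e) L0.
move: hy; rewrite /out; case jE: (nat_of_ord j') ij' jN => [|q] // ij' jN.
case: (ltnP q (size S.2)) => qS.
  rewrite core_letter //; case e: (onth _ _) => [m|] // [_].
  by rewrite (right_out _ e) ?I0 //; move: pw ij'; clear; lia.
have -> : q.+1 = L.+1 + n by move: qS jN; rewrite szN szS; clear -I0; lia.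
by rewrite ch_beta_letter.
Qed.

End Core.

(** * The translates and the bases *)

Section Assembly.
Variables (k : fieldType) (B : bquiver) (F : fringe B).
Hypotheses (gB : gentle B) (hF : is_fringing F).
Variables (X Y : word B) (HX HY : cohook_data (fringed F)).
Hypotheses (sX : is_string X) (sY : is_string Y).
Hypotheses (hHX : is_cohook_data (embed F X) HX) (hHY : is_cohook_data (embed F Y) HY).
Local Notation CX := (cohook (embed F X) HX).
Local Notation CY := (cohook (embed F Y) HY).

Let lh : locally_gentle (fringed F). Proof. by case: hF => _ _ /gentle_local. Qed.
Let sCX : is_string CX := ch_string hHX.
Let sCY : is_string CY := ch_string hHY.

Let Xin : (size (ch_D HX)).+1 <= (size (ch_D HX)).+1 + size X.2 <= size CX.2.
Proof. by rewrite ch_size; clear; lia. Qed.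

Let Yin : (size (ch_D HY)).+1 <= (size (ch_D HY)).+1 + size Y.2 <= size CY.2.
Proof. by rewrite ch_size; clear; lia. Qed.

Lemma tau_fringed :
  is_tau (string_rep k (embed F Y)) (string_rep k CY).
Proof.
have lt : size (ch_D HY) < size (ch_D HY) + size Y.2 + 2 by clear; lia.
apply: (tau_zigzag lh sCY (ch_zigzag hF hHY)) => //.
- by have := factor_ivl k sCY Yin; rewrite ch_factor.
- by rewrite /y0 /y1 /= /wlen size_map addn2 /= subSS addKn.
- exact: string_rep_ivl.
- by rewrite /y0 /y1 /= subn0.
Qed.

(** Homomorphisms from X into a substring [a, b] of cohook(Y) that contains the
    targets of all kisses. *)
Lemma cohook_kiss_basis (M N : rep k (fringed F)) a b :
  a <= b <= size CY.2 ->
  (forall d l, out CY.2 d (if d then b else a) = Some l -> l.2 = false) ->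
  (forall d p l, (if d then b < p else p < a) -> out CY.2 d p = Some l -> l.2 = true) ->
  ivl_rep M CX (size (ch_D HX)).+1 -> rdim M = (size X.2).+1 ->
  ivl_rep N CY a -> rdim N = (b - a).+1 ->
  hom_basis (M := M) (N := N)
    [seq kiss_mx k (ch_off HX) (rdim M) a (rdim N) z | z <- kisses CX CY].
Proof.
move=> ab Tend Tbeyond Mivl Mdim Nivl Ndim.
apply: (kiss_basis lh sCX sCY (hi := (size (ch_D HX)).+1 + size X.2) (b := b)) => //.
- by rewrite /ch_off; split; rewrite ?ch_size; clear; lia.
- by move=> d l; apply: ch_Y_end.
- by move=> d p l; apply: ch_Y_beyond.
- move=> d p hp; have [x ->] : exists x, vertex_at CX p = inl x.
    by apply: (ch_inner hHX); move: hp; rewrite /ch_off ch_size; clear; lia.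
  by case: d; [have [f ->] := ch_end hF hHY|have [f ->] := ch_start hF hHY].
by rewrite Mdim /ch_off addKn.
Qed.

Lemma basis_fringed :
  hom_basis (M := string_rep k (embed F X)) (N := string_rep k CY)
    [seq kiss_mx k (ch_off HX) _ 0 _ z | z <- kisses CX CY].
Proof.
apply: (cohook_kiss_basis (b := size CY.2)) => //.
- by rewrite leqnn.
- by case=> l; rewrite /out // onth_default.
- by case=> p l //= hp; rewrite onth_default // ltnW.
- by have := factor_ivl k sCX Xin; rewrite ch_factor.
- by rewrite /= /wlen size_map.
- exact: string_rep_ivl.
- by rewrite subn0.
Qed.

Lemma tau_basis_core :
  match tau_interval (embed F Y) HY with
  | Some (a, b) =>
      exists T : word B,
      [/\ is_string T,
          embed F T = factor CY a b,
          is_tau (string_rep k Y) (string_rep k T)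
        & @hom_basis k B (string_rep k X) (string_rep k T)
            [seq kiss_mx k (ch_off HX) _ a _ z | z <- kisses CX CY]]
  | None =>
      is_tau (string_rep k Y) (zero_rep k B) /\
      @hom_basis k B (string_rep k X) (zero_rep k B)
        [seq kiss_mx k (ch_off HX) _ 0 _ z | z <- kisses CX CY]
  end.
Proof.
have [S eS] := ch_core hHY; rewrite (core_tau_interval hF hHY eS).
have lB := gentle_local gB; have sS := core_string hF hHY eS.
have zz := core_zigzag hF hHY eS; have [le1 le2 _] := core_bounds hHY eS.
have szS := core_size eS.
have Yiv : size (ch_D HY) <= size (ch_D HY) + size Y.2 <= size S.2.
  by rewrite szS; clear; lia.
have Mivl : ivl_rep (string_rep k Y) S (y0 (core_w0 HY S) (core_ty HY)).
  by rewrite core_y0; have := factor_ivl k sS Yiv; rewrite (core_Y hHY eS).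
have Mdim : rdim (string_rep k Y) =
    (y1 S (core_w1 Y HY S) (core_ty HY) - y0 (core_w0 HY S) (core_ty HY)).+1.
  by rewrite core_y0 (core_y1 eS) addKn.
case: ltnP => w01; last first.
  have wE : core_w0 HY S = core_w1 Y HY S by apply/eqP; rewrite eqn_leq le1.
  split; first exact: (tau_zero lB sS zz Mivl Mdim wE).
  have -> : kisses CX CY = [::].
    apply/eqP; rewrite -size_eq0 -cardE; apply/eqP/eq_card0 => z.
    by apply/negbTE/(core_no_kiss hHY eS).
  split=> [|f]; first exact: nil_free.
  by rewrite [f]thinmx0 mem0v; split=> // _; split=> x; rewrite mulmx0 mul0mx.
have tS := core_t01 hF hHY eS w01.
set t0 := core_t0 HY S in tS *; set t1 := core_t1 Y HY S in tS *.
have sT := is_string_factor tS sS.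
have eT : embed F (factor S t0 t1) = factor CY t0.+1 t1.+1.
  rewrite embed_factor eS factor_factor //; first by rewrite ch_size; clear; lia.
  by move: tS; rewrite szS ch_size; clear; lia.
have szT : rdim (string_rep k (factor S t0 t1)) = (t1 - t0).+1.
  by rewrite /= /wlen size_factor.
have tC : t0.+1 <= t1.+1 <= size CY.2 by move: tS; rewrite szS ch_size; clear; lia.
exists (factor S t0 t1); split=> //.
  by apply: (tau_zigzag lB sS zz Mivl Mdim w01 _ szT); apply: factor_ivl.
have [] := @cohook_kiss_basis (inflate F (string_rep k X))
  (inflate F (string_rep k (factor S t0 t1))) t0.+1 t1.+1 tC.
- by move=> d l; apply: (core_T_end hHY eS).
- by move=> d p l; apply: (core_T_beyond hHY eS).
- by apply: (inflate_ivl _ sX sCX Xin); rewrite ch_factor.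
- by [].
- exact: (inflate_ivl _ sT sCY tC eT).
- by rewrite subSS; exact: szT.
move=> fr span; split; first exact: fr.
by move=> f; rewrite span inflate_hom.
Qed.

End Assembly.

Theorem theorem4p3 (k : fieldType) (B : bquiver) (F : fringe B)
    (hB : gentle B) (hF : is_fringing F)
    (X Y : word B) (hX : is_string X) (hY : is_string Y)
    (HX HY : cohook_data (fringed F))
    (hHX : is_cohook_data (embed F X) HX) (hHY : is_cohook_data (embed F Y) HY) :
  let X' := embed F X in
  let Y' := embed F Y in
  let CX := cohook X' HX in
  let CY := cohook Y' HY in
  (is_tau (string_rep k Y') (string_rep k CY) /\
   @hom_basis k (fringed F) (string_rep k X') (string_rep k CY)
     [seq kiss_mx k (ch_off HX) _ 0 _ z | z <- kisses CX CY]) /\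
  match tau_interval Y' HY with
  | Some (a, b) =>
      exists T : word B,
      [/\ is_string T,
          embed F T = factor CY a b,
          is_tau (string_rep k Y) (string_rep k T)
        & @hom_basis k B (string_rep k X) (string_rep k T)
            [seq kiss_mx k (ch_off HX) _ a _ z | z <- kisses CX CY]]
  | None =>
      is_tau (string_rep k Y) (zero_rep k B) /\
      @hom_basis k B (string_rep k X) (zero_rep k B)
        [seq kiss_mx k (ch_off HX) _ 0 _ z | z <- kisses CX CY]
  end.
Proof.
move=> X' Y' CX CY; split; last exact: tau_basis_core.
by split; [apply: tau_fringed|apply: basis_fringed].
Qed.
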